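(* Let $1<q<2<p<\infty$ and consider $$-u''=\lambda|u|^{q-2}u+|u|^{p-2}u\ \text{ in }(0,1),\qquad u(0)=u(1)=0.$$ Let $j\in\mathbb{N}_0$. Then the set of all pairs $(\lambda,u)$, where $\lambda\in\mathbb{R}$ and $u$ is a nontrivial solution having precisely $j+1$ nodal intervals $I_0,\dots,I_j$ (ordered from left to right) with sign $\pm(-1)^k$ on $I_k$ for $k=0,\dots,j$, is given by $\mathcal{C}_j^\pm$ (same sign), where $\mathcal{C}_j^+=\mathcal{C}_{j,1}^+\cup\mathcal{C}_{j,2}^+$, $\mathcal{C}_j^-=\mathcal{C}_{j,1}^-\cup\mathcal{C}_{j,2}^-$ and $$\mathcal{C}_{j,1}^\pm=\{(\lambda,\pm\underline{u}_j(\lambda)):0<\lambda\le\Lambda_j\}\cup\{(\lambda,\pm\overline{u}_j(\lambda)):\lambda_{j*}\le\lambda<\Lambda_j\},$$ $$\mathcal{C}_{j,2}^\pm=\{(\lambda,\pm u_j(\lambda,a,\sigma)):\lambda<\lambda_{j*},\ a\in\mathcal{Z}_{j,\lambda},\ \sigma=(1,-1,1,\dots,(-1)^j)\},$$ with $\Lambda_j,\lambda_{j*},\underline{u}_j(\lambda),\overline{u}_j(\lambda),\mathcal{Z}_{j,\lambda},u_j(\lambda,a,\sigma)$ as defined in the context.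
   Context: Solutions are classical ($C^2$ on $[0,1]$). A solution $u$ has precisely $j+1$ nodal intervals if there are mutually disjoint open intervals $I_0,\dots,I_j\subset(0,1)$ such that $|u|>0$ on each $I_k$ and $u=0$ on $[0,1]\setminus\bigcup_kI_k$ (so $u$ may vanish on sets of positive measure). Notation: $G_\lambda(z)=\frac{\lambda}{q}|z|^q+\frac1p|z|^p$, $\lambda_-=\max\{0,-\lambda\}$, $T_\lambda(\alpha)=\int_0^\alpha\frac{ds}{\sqrt{2(G_\lambda(\alpha)-G_\lambda(s))}}$ for $\alpha>0$, $\alpha\ge(\frac{p\lambda_-}{q})^{1/(p-q)}$, and $\phi_{\alpha,\lambda}(z)=\int_0^z\frac{ds}{\sqrt{2(G_\lambda(\alpha)-G_\lambda(s))}}$ for $0\le z\le\alpha$. The function $w_{\alpha,\lambda}:[0,2T_\lambda(\alpha)]\to\mathbb{R}$ is $w_{\alpha,\lambda}(x)=\phi_{\alpha,\lambda}^{-1}(x)$ for $0\le x\le T_\lambda(\alpha)$ and $w_{\alpha,\lambda}(x)=\phi_{\alpha,\lambda}^{-1}(2T_\lambda(\alpha)-x)$ for $T_\lambda(\alpha)\le x\le2T_\lambda(\alpha)$. For $\lambda>0$, $\alpha_\lambda>0$ is the unique number such that $T_\lambda$ is strictly increasing on $(0,\alpha_\lambda]$ and strictly decreasing on $[\alpha_\lambda,\infty)$; $\Lambda_j>0$ is the unique number with $T_{\Lambda_j}(\alpha_{\Lambda_j})=\frac1{2j+2}$. Moreover $$\lambda_{j*}=-\Big(\sqrt{2q}\big(\tfrac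 pq\big)^{(2-q)/2(p-q)}\int_0^1\frac{dt}{\sqrt{t^q-t^p}}\Big)^{2(p-q)/(p-2)}(j+1)^{2(p-q)/(p-2)}.$$ For $0<\lambda\le\Lambda_j$, $\underline\alpha_j(\lambda)\in(0,\alpha_\lambda]$ and $\overline\alpha_j(\lambda)\in[\alpha_\lambda,\infty)$ are the solutions $\alpha$ of $T_\lambda(\alpha)=\frac1{2j+2}$ in these intervals (they coincide for $\lambda=\Lambda_j$). For $\lambda_{j*}\le\lambda\le0$, $\overline\alpha_j(\lambda)$ is the unique solution $\alpha>0$, $\alpha\ge(\frac{p|\lambda|}q)^{1/(p-q)}$, of $T_\lambda(\alpha)=\frac1{2j+2}$. The functions $\underline u_j(\lambda)$ and $\overline u_j(\lambda)$ are given by $$u(x)=(-1)^kw_{\alpha,\lambda}\big(x-\tfrac k{j+1}\big)\quad\text{for }x\in\big[\tfrac k{j+1},\tfrac{k+1}{j+1}\big],\ k=0,\dots,j,$$ with $\alpha=\underline\alpha_j(\lambda)$ and $\alpha=\overline\alpha_j(\lambda)$, respectively. For $\lambda<0$ let $l(\lambda)=2T_\lambda\big((\frac{p|\lambda|}q)^{1/(p-q)}\big)$ and $\mathcal{Z}_{j,\lambda}=\{a=(a_0,\dots,a_j)\in[0,1]^{j+1}:0\le a_0\le a_0+l(\lambda)\le a_1\le a_1+l(\lambda)\le\dots\le a_j\le a_j+l(\lambda)\le1\}$. For $\lambda<\lambda_{j*}$, $a\in\mathcal{Z}_{j,\lambda}$ and $\sigma=(\sigma_0,\dots,\sigma_j)\in\{-1,+1\}^{j+1}$,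 the function $u_j(\lambda,a,\sigma)$ equals $\sigma_kw_{\alpha,\lambda}(x-a_k)$ for $x\in[a_k,a_k+l(\lambda)]$, $k=0,\dots,j$, with $\alpha=(\frac{p|\lambda|}q)^{1/(p-q)}$, and vanishes on the rest of $[0,1]$. *)

(* Defs.v *)
(* Library: MathComp and MathComp-Analysis. *)
From mathcomp Require Import all_boot all_order all_algebra.
From mathcomp Require Import all_classical all_reals all_analysis.
Import Order.TTheory GRing.Theory Num.Theory.
Import numFieldNormedType.Exports.

Set Implicit Arguments.
Unset Strict Implicit.
Unset Printing Implicit Defensive.

Local Open Scope classical_set_scope.
Local Open Scope ring_scope.

(* A function on [0, 1] is a function R -> R of which only the values on
   [0, 1] matter: every notion below depends on u only through its restriction
   to [0, 1], and the sets of pairs (lambda, u) are closed under changing u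
   outside [0, 1].

   [xget x0 P] is an element of P if P is nonempty, and x0 otherwise; it is used
   to name the unique element satisfying a characterization. *)

Definition eq01 (R : realType) (u v : R -> R) : Prop := {in `[0, 1], u =1 v}.

(* The limit is taken inside [0, 1], so it is one-sided at the end points. *)
Definition has_deriv01 (R : realType) (f f' : R -> R) : Prop :=
  forall x : R, x \in `[0, 1] ->
    (fun y => (f y - f x) / (y - x)) @ within `[0, 1]%classic x^' --> f' x.

(* The value of the right-hand side at u x = 0 is 0, also though q - 2 < 0. *)
Definition is_solution (R : realType) (p q lambda : R) (u : R -> R) : Prop :=
  [/\ u 0 = 0, u 1 = 0 &
    exists u1 u2 : R -> R,
      [/\ has_deriv01 u u1, has_deriv01 u1 u2,
          {within `[0, 1]%classic, continuous u2} &
          forall x : R, x \in `]0, 1[ ->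
            - u2 x = lambda * (`|u x| `^ (q - 2) * u x)
                     + `|u x| `^ (p - 2) * u x]].

Definition nontrivial (R : realType) (u : R -> R) : Prop :=
  exists2 x : R, x \in `[0, 1] & u x != 0.

(* The nodal intervals are I_k = ]c k, d k[. *)
Definition nodal_intervals (R : realType) (j : nat) (u : R -> R)
    (c d : 'I_j.+1 -> R) : Prop :=
  [/\ forall k, [/\ 0 <= c k, c k < d k & d k <= 1],
      trivIset setT (fun k => `]c k, d k[%classic),
      forall k x, x \in `]c k, d k[ -> 0 < `|u x| &
      forall x : R, x \in `[0, 1] -> (forall k, x \notin `]c k, d k[) -> u x = 0].

(* The pairs (lambda, u) with u a nontrivial solution having precisely j + 1
   nodal intervals, with sign s (-1)^k on the k-th one from the left. *)
Definition nodal_set (R : realType) (p q : R) (j : nat) (s : R) :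
    set (R * (R -> R)) :=
  [set lu : R * (R -> R) | [/\ is_solution p q lu.1 lu.2, nontrivial lu.2 &
     exists c d : 'I_j.+1 -> R,
       [/\ nodal_intervals lu.2 c d,
           forall i k : 'I_j.+1, (i < k)%N -> c i < c k &
           forall (k : 'I_j.+1) x, x \in `]c k, d k[ ->
             0 < s * (-1) ^+ k * lu.2 x]]].

Definition G (R : realType) (p q lambda z : R) : R :=
  lambda / q * `|z| `^ q + p^-1 * `|z| `^ p.

Definition phi (R : realType) (p q alpha lambda z : R) : R :=
  \int[lebesgue_measure]_(s in `]0, z[)
    (Num.sqrt (2 * (G p q lambda alpha - G p q lambda s)))^-1.

(* T_lambda(alpha), meaningful for alpha > 0 with alpha_min lambda <= alpha
   if lambda <= 0. *)
Definition T (R : realType) (p q lambda alpha : R) : R :=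
  \int[lebesgue_measure]_(s in `]0, alpha[)
    (Num.sqrt (2 * (G p q lambda alpha - G p q lambda s)))^-1.

Definition alpha_min (R : realType) (p q lambda : R) : R :=
  (p * `|lambda| / q) `^ (p - q)^-1.

Definition phi_inv (R : realType) (p q alpha lambda : R) : R -> R :=
  'pinv_(fun=> 0) `[0, alpha]%classic (phi p q alpha lambda).

(* meaningful for 0 <= x <= 2 T_lambda(alpha) *)
Definition w (R : realType) (p q alpha lambda x : R) : R :=
  if x <= T p q lambda alpha then phi_inv p q alpha lambda x
  else phi_inv p q alpha lambda (2 * T p q lambda alpha - x).

Definition alpha_peak (R : realType) (p q lambda : R) : R :=
  xget 0 [set al : R | [/\ 0 < al,
    {in `]0, al] &, {homo T p q lambda : x y / x < y}} &
    {in `[al, +oo[ &, {homo T p q lambda : x y /~ x < y}}]].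

Definition Lambda (R : realType) (p q : R) (j : nat) : R :=
  xget 0 [set L : R | 0 < L /\ T p q L (alpha_peak p q L) = (2 * j + 2)%:R^-1].

Definition lambda_star (R : realType) (p q : R) (j : nat) : R :=
  - ((Num.sqrt (2 * q) * (p / q) `^ ((2 - q) / (2 * (p - q)))
      * \int[lebesgue_measure]_(t in `]0, 1[) (Num.sqrt (t `^ q - t `^ p))^-1)
       `^ (2 * (p - q) / (p - 2))
     * j.+1%:R `^ (2 * (p - q) / (p - 2))).

Definition alpha_under (R : realType) (p q : R) (j : nat) (lambda : R) : R :=
  xget 0 [set al : R | al \in `]0, alpha_peak p q lambda] /\
                       T p q lambda al = (2 * j + 2)%:R^-1].

Definition alpha_over (R : realType) (p q : R) (j : nat) (lambda : R) : R :=
  if 0 < lambda then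
    xget 0 [set al : R | al \in `[alpha_peak p q lambda, +oo[ /\
                         T p q lambda al = (2 * j + 2)%:R^-1]
  else
    xget 0 [set al : R | [/\ 0 < al, alpha_min p q lambda <= al &
                         T p q lambda al = (2 * j + 2)%:R^-1]].

(* Adjacent pieces overlap only at k/(j+1), where both formulas give w = 0, so
   the choice made by [pick] is immaterial. *)
Definition u_glued (R : realType) (p q : R) (j : nat) (alpha lambda : R) :
    R -> R :=
  fun x =>
    if [pick k : 'I_j.+1 | x \in `[k%:R / j.+1%:R, k.+1%:R / j.+1%:R]] is Some k
    then (-1) ^+ k * w p q alpha lambda (x - k%:R / j.+1%:R)
    else 0.

Definition u_under (R : realType) (p q : R) (j : nat) (lambda : R) : R -> R :=
  u_glued p q j (alpha_under p q j lambda) lambda.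

Definition u_over (R : realType) (p q : R) (j : nat) (lambda : R) : R -> R :=
  u_glued p q j (alpha_over p q j lambda) lambda.

Definition ell (R : realType) (p q lambda : R) : R :=
  2 * T p q lambda (alpha_min p q lambda).

Definition Zset (R : realType) (p q : R) (j : nat) (lambda : R) :
    set ('I_j.+1 -> R) :=
  [set a | [/\ forall k, a k \in `[0, 1],
               0 <= a ord0,
               forall k, a k <= a k + ell p q lambda,
               forall i k : 'I_j.+1, i.+1 = k :> nat ->
                 a i + ell p q lambda <= a k &
               a ord_max + ell p q lambda <= 1]].

(* Same remark on [pick] as for [u_glued]. *)
Definition u_dead (R : realType) (p q : R) (j : nat) (lambda : R)
    (a sigma : 'I_j.+1 -> R) : R -> R :=
  fun x =>
    if [pick k : 'I_j.+1 | x \in `[a k, a k + ell p q lambda]] is Some k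
    then sigma k * w p q (alpha_min p q lambda) lambda (x - a k)
    else 0.

Definition C1 (R : realType) (p q : R) (j : nat) (s : R) :
    set (R * (R -> R)) :=
  [set lu : R * (R -> R) | [/\ 0 < lu.1, lu.1 <= Lambda p q j &
      eq01 lu.2 (fun x => s * u_under p q j lu.1 x)]] `|`
  [set lu : R * (R -> R) | [/\ lambda_star p q j <= lu.1, lu.1 < Lambda p q j &
      eq01 lu.2 (fun x => s * u_over p q j lu.1 x)]].

Definition C2 (R : realType) (p q : R) (j : nat) (s : R) :
    set (R * (R -> R)) :=
  [set lu : R * (R -> R) | lu.1 < lambda_star p q j /\
     exists2 a : 'I_j.+1 -> R, Zset p q lu.1 a &
       eq01 lu.2 (fun x => s * u_dead p q lu.1 a (fun k => (-1) ^+ k) x)].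

(* Main.v *)
Require Import Defs.
From mathcomp Require Import all_boot all_order all_algebra.
From mathcomp Require Import all_classical all_reals all_analysis.
From mathcomp Require Import measurable_realfun ring lra.
Import Order.TTheory GRing.Theory Num.Theory.
Import numFieldNormedType.Exports.
(* A solution has constant energy E = u'^2 / 2 + G(u), so on a nodal interval it
   rises from 0 to a maximum alpha with G(alpha) = E and falls back to 0, and
   integrating u' = sqrt(2 (G(alpha) - G(u))) identifies it with a translate of
   w_(alpha, lambda). As G is increasing on the admissible amplitudes, alpha is
   the same for all nodal intervals, which have length 2 T_lambda(alpha). If
   E > 0, then u' does not vanish at the zeros of u, so the intervals fill [0, 1]
   and T_lambda(alpha) = 1 / (2 j + 2); if E = 0, then lambda < 0, alpha is
   alpha_min, and the intervals may be separated by gaps.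
   The substitution s = alpha t turns T_lambda(alpha) into an integral over
   ]0, 1[ whose integrand depends monotonically on alpha for lambda <= 0. For
   lambda > 0, scaling reduces to lambda = 1, where T is unimodal in ln alpha. *)

Set Implicit Arguments.
Unset Strict Implicit.
Unset Printing Implicit Defensive.
Local Open Scope classical_set_scope.
Local Open Scope ring_scope.

(** * Integrals with end-point singularities *)

Section open_interval_integral.
Context {R : realType}.
Notation mu := (@lebesgue_measure R).
Implicit Types (a b : R) (f g F : R -> R).

(** For [lambda != 0] the right-hand side is not Lipschitz at 0, since [q < 2]; uniqueness for
    initial value problems is replaced by explicit integration of the energy identity. An arc of
    amplitude alpha has end slopes of modulus [sqrt (2 G(alpha))], so it can be continued by 0 only
    if [G(alpha) = 0]. The integrands blow up at end points. All of them are bounded by multiples of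
    [(t^q - t^p)^(-1/2)], with equality at [alpha_min]; this is the origin of the integral in
    [lambda_star]. For [lambda > 0] the integrand of T at a given t peaks at an alpha depending on
    t, and an integral of unimodal functions need not be unimodal. But the ratio of [(1 - t^q) / q]
    to [(1 - t^p) / p] stays in [[1, p / q]], so all these peaks lie in one window of [ln alpha], on
    which every integrand is strictly concave. Conversely, the glued functions must be classical
    solutions across junctions and up to 0 and 1. Derivatives are therefore taken relative to
    subsets and assembled over unions of pieces. *)

Lemma continuous_oo_measurable a b f :
  {in `]a, b[, continuous f} ->
  measurable_fun `]a, b[%classic f.
Proof.
move=> cf; apply: subspace_continuous_measurable_fun.
  exact: measurable_itv.
apply/subspace_continuousP => x xab; apply: cvg_within_filter.
by apply: cf; rewrite inE in xab *.
Qed.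

(** Newton-Leibniz for an integrand that may blow up at both ends: it holds on compact subintervals
    exhausting []a, b[]; monotone convergence handles the integrals and continuity of [F] the
    increments. *)
Lemma ge0_FTC2_oo a b f F : a < b ->
  {within `[a, b], continuous F} ->
  {in `]a, b[, forall x : R, is_derive x 1 F (f x)} ->
  {in `]a, b[, continuous f} ->
  {in `]a, b[, forall x, 0 <= f x} ->
  (\int[mu]_(x in `]a, b[) (f x)%:E)%E = (F b - F a)%:E.
Proof.
move=> ab cF dF cf f0.
(* The shift [n.+3] ensures [2 * d n < b - a] already for [n = 0], so that no subinterval
   degenerates. *)
pose d n : R := (b - a) / n.+3%:R.
have d0 n : 0 < d n by rewrite divr_gt0// subr_gt0.
have n3 n : (3 : R) <= n.+3%:R by rewrite ler_nat.
have dlt n : 2 * d n < b - a.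
  rewrite /d mulrCA -ltr_pdivlMl ?subr_gt0// mulVf ?gt_eqF ?subr_gt0//.
  rewrite ltr_pdivrMr// mul1r ltr_nat//.
have dd n m : (n <= m)%N -> d m <= d n.
  move=> nm; rewrite /d ler_pM2l ?subr_gt0// lef_pV2 ?posrE//.
  by rewrite ler_nat.
have dcvg : d @ \oo --> (0 : R).
  have h : (fun n => (b - a) * harmonic (n + 2)%N) @ \oo --> (0 : R).
    rewrite -[X in _ --> X](mulr0 (b - a)); apply: cvgMr.
    by rewrite (cvg_shiftn 2%N (harmonic : R^nat)); exact: cvg_harmonic.
  rewrite [d](_ : _ = (fun n => (b - a) * harmonic (n + 2)%N))//.
  by apply/funext => n; rewrite /d /harmonic /= addn2.
pose I n := `[a + d n, b - d n]%classic.
have sub n x : x \in `[a + d n, b - d n] -> x \in `]a, b[.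
  by rewrite !in_itv/= => /andP[h1 h2]; have := d0 n; lra.
have lt_n n : a + d n < b - d n by have := dlt n; lra.
have bigI : \bigcup_i I i = `]a, b[%classic.
  apply/seteqP; split=> [x [n _ /= xn]|x /= xab]; first exact: sub xn.
  have e0 : 0 < Num.min (x - a) (b - x).
    by move: xab; rewrite in_itv/= lt_min !subr_gt0.
  have /cvgrPdist_lt/(_ _ e0)[n _ /(_ n (leqnn n))/=] := dcvg.
  rewrite sub0r normrN gtr0_norm// lt_min => /andP[h1 h2].
  by exists n => //; rewrite /I /= in_itv/=; apply/andP; split; lra.
have cvgI : (\int[mu]_(x in I n) (f x)%:E)%E @[n --> \oo] -->
    (\int[mu]_(x in `]a, b[) (f x)%:E)%E.
  rewrite -bigI; apply: ge0_nondecreasing_set_cvg_integral.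
  - move=> n m nm; rewrite /I subsetEset => x /=; rewrite !in_itv/= => /andP[h1 h2].
    by have h := dd _ _ nm; apply/andP; split; lra.
  - by move=> n; exact: measurable_itv.
  - move=> n; apply/measurable_EFinP; apply: measurable_funS (continuous_oo_measurable cf).
      exact: measurable_itv.
    by move=> x; exact: sub.
  - by move=> n x /= xn; rewrite lee_fin f0//; exact: sub xn.
have intI n : (\int[mu]_(x in I n) (f x)%:E)%E = (F (b - d n) - F (a + d n))%:E.
  rewrite /I (continuous_FTC2 (F := F))//.
  - apply/subspace_continuousP => x /= xn; apply: cvg_within_filter.
    exact/cf/sub/xn.
  - apply: (derivable_oo_continuousW (a := a) (b := b)) => //.
      move=> x /= /sub; exact: subset_itv_oo_cc.
    have [_ Fa Fb] := (continuous_within_itvP F ab).1 cF.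
    by split=> // x xab; have [] := dF x xab.
  - move=> x xn; rewrite derive1E; apply: derive_val.
    by apply: dF; apply: sub; apply: subset_itv_oo_cc xn.
apply: (cvg_unique _ cvgI) => //.
rewrite /= (funext intI).
apply: cvg_EFin; first by apply: nearW.
have [_ Fa Fb] := (continuous_within_itvP F ab).1 cF.
apply: cvgB.
  have /cvg_at_leftP := Fb; apply; split=> [n|].
    by rewrite ltrBlDl ltrDr.
  by rewrite -[X in _ --> X]subr0; apply: cvgB => //; exact: cvg_cst.
have /cvg_at_rightP := Fa; apply; split=> [n|].
  by rewrite ltrDl.
by rewrite -[X in _ --> X]addr0; apply: cvgD => //; exact: cvg_cst.
Qed.

(** The integral of the nonnegative [f] is the increment of [F], hence finite: exhibiting a
    primitive proves integrability. *)
Lemma ge0_FTC2_oo_integrable a b f F : a < b ->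
  {within `[a, b], continuous F} ->
  {in `]a, b[, forall x : R, is_derive x 1 F (f x)} ->
  {in `]a, b[, continuous f} ->
  {in `]a, b[, forall x, 0 <= f x} ->
  mu.-integrable `]a, b[ (EFin \o f).
Proof.
move=> ab cF dF cf f0; apply/integrableP; split.
  by apply/measurable_EFinP; exact: continuous_oo_measurable.
have -> : (\int[mu]_(x in `]a, b[) `|(EFin \o f) x| =
    \int[mu]_(x in `]a, b[) (f x)%:E)%E.
  by apply: eq_integral => x /[!inE] xab /=; rewrite ger0_norm// f0.
by rewrite (ge0_FTC2_oo ab cF)// ltry.
Qed.

Lemma ge0_Rintegral_FTC2_oo a b f F : a < b ->
  {within `[a, b], continuous F} ->
  {in `]a, b[, forall x : R, is_derive x 1 F (f x)} ->
  {in `]a, b[, continuous f} ->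
  {in `]a, b[, forall x, 0 <= f x} ->
  \int[mu]_(x in `]a, b[) f x = F b - F a.
Proof. by move=> ab cF dF cf f0; rewrite /Rintegral (ge0_FTC2_oo ab cF). Qed.

Lemma Rintegral_oo_cc a b f g : mu.-integrable setT (EFin \o g) ->
  {in `]a, b[, f =1 g} ->
  \int[mu]_(x in `]a, b[) f x = \int[mu]_(x in `[a, b]) g x.
Proof.
move=> ig fg.
transitivity (\int[mu]_(x in `]a, b[) g x).
  by apply: eq_Rintegral => x /[!inE]; exact: fg.
have i (A : set R) : measurable A -> mu.-integrable A (EFin \o g).
  by move=> mA; apply: integrableS ig.
by rewrite Rintegral_itv_bndo_bndc ?Rintegral_itv_obnd_cbnd//; exact: i.
Qed.

Lemma Rintegral_oo_diag a f : \int[mu]_(x in `]a, a[) f x = 0.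
Proof. by rewrite set_itv_ge ?Rintegral_set0// bnd_simp ltxx. Qed.

Section primitive.
Context (a b : R) (f : R -> R).
Hypotheses (ab : a < b) (cf : {in `]a, b[, continuous f})
  (intf : mu.-integrable `]a, b[ (EFin \o f)).

(** Extension by zero gives an integrable function on the whole line, to which the theorems on
    parameterized integrals over closed intervals apply. *)
Let g := f \_ `]a, b[.

Let intg : mu.-integrable setT (EFin \o g).
Proof.
by have := intf; rewrite integrable_mkcond//= -restrict_EFin.
Qed.

Let primE z : z \in `[a, b] ->
  \int[mu]_(x in `]a, z[) f x = parameterized_integral mu a z g.
Proof.
move=> zab; apply: Rintegral_oo_cc => // x xz.
rewrite /g patchE mem_set//=; move: xz zab; rewrite !in_itv/=.
by move=> /andP[-> /=] xz /andP[_]; exact: lt_le_trans.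
Qed.

Lemma primitive_continuous :
  {within `[a, b], continuous (fun z => \int[mu]_(x in `]a, z[) f x)}.
Proof.
rewrite (_ : continuous _ = continuous
  (from_subspace `[a, b] (fun z => parameterized_integral mu a z g))).
  by apply: parameterized_integral_continuous; [exact: ltW|exact: integrableS intg].
apply/propext; split=> h.
  by apply: subspace_eq_continuous h => x /[!inE]; exact: primE.
by apply: subspace_eq_continuous h => x /[!inE] xab; rewrite /from_subspace primE.
Qed.

Lemma primitive_is_derive :
  {in `]a, b[, forall z : R, is_derive z 1
     (fun z => \int[mu]_(x in `]a, z[) f x) (f z)}.
Proof.
move=> z zab.
have gf : {near z, g =1 f}.
  near=> y; rewrite /g patchE mem_set//=.
  by near: y; exact: near_in_itvoo.
have := zab; rewrite in_itv/= => /andP[az zb].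
have cg : {for z, continuous g}.
  rewrite /prop_for /continuous_at.
  rewrite /g patchE mem_set//.
  apply: cvg_trans (cf zab); apply: near_eq_cvg.
  by near=> y; apply/esym; near: y; exact: gf.
have intg' : mu.-integrable `[a, b] (EFin \o g) by exact: integrableS intg.
have [] := continuous_FTC1_closed zb intg' az cg.
move=> dG; rewrite derive1E => GE.
have -> : f z = g z by rewrite /g patchE mem_set.
apply: near_eq_is_derive (DeriveDef dG GE) => //.
near=> y; apply/esym; apply: primE; apply: subset_itv_oo_cc.
by near: y; exact: near_in_itvoo.
Unshelve. all: by end_near. Qed.

End primitive.

(** The primitive of [g - f] vanishes at [a] and has a positive derivative inside, hence is positive
    at [b]. *)
Lemma lt_Rintegral_oo a b f g : a < b ->
  {in `]a, b[, continuous f} -> {in `]a, b[, continuous g} ->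
  mu.-integrable `]a, b[ (EFin \o f) -> mu.-integrable `]a, b[ (EFin \o g) ->
  {in `]a, b[, forall x, f x < g x} ->
  \int[mu]_(x in `]a, b[) f x < \int[mu]_(x in `]a, b[) g x.
Proof.
move=> ab cf cg intf intg fg.
pose F z := \int[mu]_(x in `]a, z[) g x - \int[mu]_(x in `]a, z[) f x.
have dF : {in `]a, b[, forall z : R, is_derive z 1 F (g z - f z)}.
  move=> z zab; have dg := primitive_is_derive cg intg zab.
  have df := primitive_is_derive cf intf zab.
  by rewrite /F; apply: (is_deriveB (f := fun z => \int[mu]_(x in `]a, z[) g x)).
have Fa : F a = 0 by rewrite /F !Rintegral_oo_diag subrr.
rewrite -subr_gt0 -/(F b) -Fa.
apply: (@gtr0_derive1_lt_cc _ F a b) => //.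
- by move=> x /dF[].
- by move=> x xab; rewrite derive1E; have [_ ->] := dF _ xab; rewrite subr_gt0 fg.
- move=> z; apply: cvgB; exact: primitive_continuous.
- by rewrite in_itv/= lexx ltW.
- by rewrite in_itv/= lexx ltW.
Qed.

End open_interval_integral.
(** * Derivatives within a set *)

Section pointwise_derive.
Context {R : realType}.
Implicit Types (f g : R -> R) (a b c x : R).

Lemma is_derive_add f g x a b : is_derive x 1 f a -> is_derive x 1 g b ->
  is_derive x 1 (fun y => f y + g y) (a + b).
Proof. by move=> df dg; exact: is_deriveD. Qed.

Lemma is_derive_sub f g x a b : is_derive x 1 f a -> is_derive x 1 g b ->
  is_derive x 1 (fun y => f y - g y) (a - b).
Proof. by move=> df dg; exact: is_deriveB. Qed.

Lemma is_derive_mul f g x a b : is_derive x 1 f a -> is_derive x 1 g b ->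
  is_derive x 1 (fun y => f y * g y) (a * g x + f x * b).
Proof.
move=> df dg; apply: is_derive_eq.
by rewrite /GRing.scale/= addrC mulrC.
Qed.

Lemma is_derive_scale f x a c : is_derive x 1 f a ->
  is_derive x 1 (fun y => c * f y) (c * a).
Proof. by move=> df; exact: is_deriveZ. Qed.

Lemma is_derive_comp f g x a b : is_derive (g x) 1 f a -> is_derive x 1 g b ->
  is_derive x 1 (fun y => f (g y)) (a * b).
Proof. by move=> df dg; exact: is_derive1_comp. Qed.

Lemma is_derive_continuous f x a : is_derive x 1 f a -> {for x, continuous f}.
Proof.
by move=> [df _]; apply/differentiable_continuous; rewrite -derivable1_diffP.
Qed.

Lemma is_derive_val_eq f x a b : a = b -> is_derive x 1 f a -> is_derive x 1 f b.
Proof. by move=> ->. Qed.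

End pointwise_derive.

Lemma within_continuous_comp {R : realType} (A B : set R) (f g : R -> R) :
  {within B, continuous f} -> {within A, continuous g} ->
  (forall x, A x -> B (g x)) -> {within A, continuous (fun x => f (g x))}.
Proof.
move=> /subspace_continuousP cf /subspace_continuousP cg AB.
apply/subspace_continuousP => x Ax.
apply: (@cvg_comp _ _ _ g f _ (within B (nbhs (g x)))); last exact/cf/AB.
move=> P BP.
have h : nbhs x (fun y => A y -> B (g y) -> P (g y)) := cg x Ax _ BP.
suff : nbhs x (fun y => A y -> P (g y)) by [].
by apply: filterS h => y h Ay; exact: h (AB _ Ay).
Qed.

Section deriv_on.
Context {R : realType}.
Implicit Types (A B : set R) (f g : R -> R) (a b d e x y l : R).

(** Derivative relative to [A], as a first-order expansion. There is no quotient and [x] need not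
    lie in [A], so the notion passes to unions and is vacuous at positive distance from [A]. *)
Definition deriv_on A f x l := forall e, 0 < e ->
  exists2 d, 0 < d & forall y, A y -> `|y - x| < d ->
    `|f y - f x - l * (y - x)| <= e * `|y - x|.

Lemma deriv_on_setU A B f x l :
  deriv_on A f x l -> deriv_on B f x l -> deriv_on (A `|` B) f x l.
Proof.
move=> dA dB e e0; have [d d0 hd] := dA e e0; have [d' d'0 hd'] := dB e e0.
exists (Num.min d d'); first by rewrite lt_min d0.
by move=> y [Ay|By]; rewrite lt_min => /andP[yd yd']; [exact: hd|exact: hd'].
Qed.

Lemma deriv_on_near A B f x l d : 0 < d ->
  (forall y, A y -> `|y - x| < d -> B y) ->
  deriv_on B f x l -> deriv_on A f x l.
Proof.
move=> d0 AB dB e e0; have [d' d'0 hd'] := dB e e0.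
exists (Num.min d d'); first by rewrite lt_min d0.
move=> y Ay; rewrite lt_min => /andP[yd yd']; apply: hd' => //; exact: AB.
Qed.

Lemma deriv_onS A B f x l : A `<=` B -> deriv_on B f x l -> deriv_on A f x l.
Proof. by move=> AB; apply: (@deriv_on_near _ _ _ _ _ 1) => // y /AB. Qed.

Lemma deriv_on_bigcup (I : finType) (A : I -> set R) f x l :
  (forall i, deriv_on (A i) f x l) -> deriv_on (\bigcup_i A i) f x l.
Proof.
move=> dA e e0.
have /choice[d hd] : forall i, exists d, 0 < d /\ forall y, A i y ->
    `|y - x| < d -> `|f y - f x - l * (y - x)| <= e * `|y - x|.
  by move=> i; have [d d0 hd] := dA i e e0; exists d.
exists (\big[Num.min/1]_i d i).
  by elim/big_ind : _ => // [y z y0 z0|i _]; [rewrite lt_min y0|have [] := hd i].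
move=> y [i _ Ay] yd; have [_ ] := hd i; apply => //.
by apply: lt_le_trans yd _; rewrite (bigD1 i)//= ge_min lexx.
Qed.

(** Chain rule for signed translates ([e = 1]) and reflections ([e = -1]), the two operations that
    build [w] and the glued functions from one branch. *)
Lemma deriv_on_affine A B f g x l s e c :
  (forall y, B y -> A (e * (y - c))) ->
  (forall y, B y -> g y = s * f (e * (y - c))) -> B x -> `|e| = 1 ->
  deriv_on A f (e * (x - c)) l -> deriv_on B g x (s * e * l).
Proof.
move=> BA gE Bx e1 dA z z0.
have ys y : e * (y - c) - e * (x - c) = e * (y - x) by ring.
(* Dividing the tolerance by [|s| + 1] also covers [s = 0]. *)
have [d d0 hd] : exists2 d, 0 < d & forall y, A y -> `|y - e * (x - c)| < d ->
    `|f y - f (e * (x - c)) - l * (y - e * (x - c))| <=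
     z / (`|s| + 1) * `|y - e * (x - c)|.
  by apply: dA; rewrite divr_gt0// ltr_wpDl.
exists d => // y By yxd; rewrite (gE y)// (gE x)//.
have -> : s * f (e * (y - c)) - s * f (e * (x - c)) - s * e * l * (y - x) =
    s * (f (e * (y - c)) - f (e * (x - c)) - l * (e * (y - x))) by ring.
have := hd _ (BA _ By); rewrite ys !normrM e1 !mul1r => /(_ yxd) h.
apply: le_trans (ler_wpM2l (normr_ge0 s) h) _.
rewrite mulrA ler_wpM2r// mulrCA; apply: ler_piMr; first exact: ltW.
by rewrite ler_pdivrMr ?ltr_wpDl// mul1r lerDl.
Qed.

Lemma deriv_on_eq A f g x l : {in A, f =1 g} -> A x ->
  deriv_on A f x l -> deriv_on A g x l.
Proof.
move=> fg Ax dA e /dA[d d0 hd]; exists d => // y Ay yd.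
by rewrite -(fg y) ?inE// -(fg x) ?inE//; exact: hd.
Qed.

Lemma deriv_on_quotient A f x l :
  (fun y => (f y - f x) / (y - x)) @ within A x^' --> l <-> deriv_on A f x l.
Proof.
have quot y : y != x -> l - (f y - f x) / (y - x) =
    - (f y - f x - l * (y - x)) / (y - x).
  by move=> yx; field; rewrite subr_eq0.
split.
- move=> /cvgrPdist_le h e /h; rewrite near_withinE => -[d /= d0 hd].
  exists d => // y Ay; have [->|yx] := eqVneq y x.
    by rewrite !subrr mulr0 subr0 normr0 mulr0.
  move=> yxd; have := hd y; rewrite /= distrC => /(_ yxd yx Ay).
  by rewrite quot// normrM normfV normrN ler_pdivrMr// normr_gt0 subr_eq0.
- move=> dA; apply/cvgrPdist_le => e /dA[d d0 hd].
  rewrite near_withinE; exists d => //= y yxd yx Ay.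
  rewrite quot// normrM normfV normrN ler_pdivrMr ?normr_gt0 ?subr_eq0//.
  by apply: hd => //; rewrite distrC.
Qed.

Lemma has_deriv01P f g :
  has_deriv01 f g <-> forall x, x \in `[0, 1] -> deriv_on `[0, 1] f x (g x).
Proof. by split=> h x /h /deriv_on_quotient. Qed.

Lemma deriv_on_is_derive A f x l : (\forall y \near x, A y) ->
  deriv_on A f x l -> is_derive x 1 f l.
Proof.
move=> Ax /deriv_on_quotient fl.
have h : h^-1 *: (f (h *: 1 + x) - f x) @[h --> 0^'] --> l.
  apply/cvgrPdist_le => e e0.
  move/cvgrPdist_le: fl => /(_ e e0); rewrite near_withinE => -[d /= d0 hd].
  have [d' /= d'0 hd'] := Ax.
  near=> h.
  rewrite /GRing.scale/= mulr1.
  have := hd (h + x); rewrite /= opprD addrCA subrr addr0 normrN.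
  have hd0 : `|h| < d by near: h; apply: dnbhs0_lt.
  have hd'0 : `|h| < d' by near: h; apply: dnbhs0_lt.
  have h0 : h != 0 by near: h; exact: nbhs_dnbhs_neq.
  move=> /(_ hd0); rewrite -subr_eq0 addrK => /(_ h0).
  rewrite mulrC; apply; apply: hd' => /=.
  by rewrite opprD addrCA subrr addr0 normrN.
apply: DeriveDef; first by apply/cvg_ex; exists l.
by apply: cvg_lim h; exact: norm_hausdorff.
Unshelve. all: by end_near. Qed.

Lemma deriv_on_continuous A f g :
  (forall x, A x -> deriv_on A f x (g x)) -> {within A, continuous f}.
Proof.
move=> dA; apply/subspace_continuousP => x Ax.
apply/cvgrPdist_le => e e0; have [d d0 hd] := dA x Ax 1 ltr01.
rewrite near_withinE.
have c0 : 0 < 1 + `|g x| by rewrite ltr_pwDl.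
exists (Num.min d (e / (1 + `|g x|))) => /=.
  by rewrite lt_min d0 divr_gt0.
move=> y /=; rewrite lt_min distrC => /andP[yd ye] Ay.
have := hd y Ay yd; rewrite mul1r => h.
rewrite distrC; have -> : f y - f x = (f y - f x - g x * (y - x)) + g x * (y - x) by ring.
apply: le_trans (ler_normD _ _) _; rewrite normrM.
apply: le_trans (lerD h (lexx _)) _; rewrite -{1}(mul1r `|y - x|) -mulrDl.
by rewrite -ler_pdivlMl// mulrC ltW.
Qed.

(** By the mean value theorem, an interior derivative that extends continuously to [[a, b]] is the
    one-sided derivative at the end points. *)
Lemma deriv_on_cc a b f g : {within `[a, b], continuous f} ->
  {in `]a, b[, forall x : R, is_derive x 1 f (g x)} ->
  {within `[a, b], continuous g} ->
  forall x, x \in `[a, b] -> deriv_on `[a, b] f x (g x).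
Proof.
move=> cf df cg x xab e e0.
have /subspace_continuousP/(_ x xab) := cg.
move=> /cvgrPdist_le/(_ e e0); rewrite near_withinE => -[d /= d0 hd].
have mvt y z : y \in `[a, b] -> z \in `[a, b] -> y < z ->
    exists2 c, y < c < z & f z - f y = g c * (z - y).
  rewrite !in_itv/= => /andP[ay yb] /andP[az zb] yz.
  have [c||c cyz E] := @MVT _ f g y z yz.
  - rewrite in_itv/= => /andP[yc cz]; apply: df; rewrite in_itv/=.
    by rewrite (le_lt_trans ay yc) (lt_le_trans cz zb).
  - apply: continuous_subspaceW cf => t /=.
    by rewrite !in_itv/= => /andP[h1 h2]; apply/andP; split; lra.
  - by exists c; rewrite // -in_itv.
exists d => // y yab yxd.
suff [c [cd cab ->]] : exists c, [/\ `|x - c| < d, c \in `[a, b] &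
    f y - f x = g c * (y - x)].
  by rewrite -mulrBl normrM ler_wpM2r// distrC; exact: hd.
move: (xab) (yab); rewrite /= !in_itv/= => /andP[ax xb] /andP[ay yb].
have [yx|xy|->] := ltgtP y x.
- have [c /andP[yc cx] E] := mvt y x yab xab yx.
  exists c; split; [|rewrite in_itv/=; apply/andP; split; lra|lra].
  by move: yxd; rewrite ltr0_norm ?gtr0_norm; lra.
- have [c /andP[yc cx] E] := mvt x y xab yab xy.
  exists c; split; [|rewrite in_itv/=; apply/andP; split; lra|lra].
  by move: yxd; rewrite gtr0_norm ?ltr0_norm; lra.
- by exists x; rewrite !subrr normr0 mulr0.
Qed.

Lemma deriv_on_set0 f x l : deriv_on set0 f x l.
Proof. by move=> e e0; exists 1. Qed.

Lemma deriv_on_far a b f x l : x \notin `[a, b] -> deriv_on `[a, b] f x l.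
Proof.
rewrite in_itv/= negb_and -!ltNge => /orP[xa|bx].
- apply: (@deriv_on_near _ set0 _ _ _ (a - x)); [by rewrite subr_gt0| |exact: deriv_on_set0].
  by move=> y /=; rewrite in_itv/= => /andP[ay _]; rewrite ltr_norml => /andP[]; lra.
- apply: (@deriv_on_near _ set0 _ _ _ (x - b)); [by rewrite subr_gt0| |exact: deriv_on_set0].
  by move=> y /=; rewrite in_itv/= => /andP[_ yb]; rewrite ltr_norml => /andP[]; lra.
Qed.

End deriv_on.

(** * Real powers *)

Section powR.
Context {R : realType}.
Implicit Types (x y t r : R).

Lemma continuous_powR r x : 0 < x -> {for x, continuous (powR (R:=R) ^~ r)}.
Proof.
move=> x0; have [h _] := is_derive1_powR r x0.
by apply/differentiable_continuous; rewrite -derivable1_diffP.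
Qed.

Lemma within_continuous_powR r y : 0 < r -> 0 < y ->
  {within `[0, y], continuous (powR (R:=R) ^~ r)}.
Proof.
move=> r0 y0; apply/(continuous_within_itvP _ y0); split.
- by move=> x; rewrite in_itv/= => /andP[x0 _]; exact: continuous_powR.
- by rewrite powR0 ?gt_eqF//; exact: powR_cvg0.
- by apply: cvg_at_left_filter; exact: continuous_powR.
Qed.

Lemma onem_powR_MVT r t : 0 < t -> t < 1 ->
  exists2 c, t < c < 1 & 1 - t `^ r = r * c `^ (r - 1) * (1 - t).
Proof.
move=> t0 t1.
have [x xt||c ct E] := @MVT R (powR (R:=R) ^~ r) (fun c => r * c `^ (r - 1)) t 1 t1.
- apply: is_derive1_powR; move: xt; rewrite in_itv/= => /andP[+ _].
  exact: lt_trans.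
- apply: derivable_within_continuous => x; rewrite in_itv/= => /andP[tx _].
  by have [] := is_derive1_powR r (lt_le_trans t0 tx).
- by exists c; [move: ct; rewrite in_itv|rewrite -E powR1].
Qed.

Lemma powR_lt1 r t : 0 < r -> 0 < t -> t < 1 -> t `^ r < 1.
Proof.
move=> r0 t0 t1; have -> : 1 = 1 `^ r :> R by rewrite powR1.
by apply: gt0_ltr_powR => //; rewrite nnegrE ltW.
Qed.

Lemma ltr_powR_exp t x y : 0 < t -> t < 1 -> x < y -> t `^ y < t `^ x.
Proof.
move=> t0 t1 xy; have -> : y = x + (y - x) by ring.
rewrite powRD ?(gt_eqF t0) ?implybT//.
by rewrite gtr_pMr ?powR_gt0// powR_lt1// subr_gt0.
Qed.

Lemma onem_powR_le r t : 1 <= r -> 0 < t -> t < 1 -> 1 - t `^ r <= r * (1 - t).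
Proof.
move=> r1 t0 t1; have [c /andP[tc c1] ->] := onem_powR_MVT r t0 t1.
have c0 : 0 < c by exact: lt_trans tc.
rewrite ler_wpM2r ?subr_ge0 ?(ltW t1)// ler_piMr ?(le_trans ler01)//.
rewrite -[leRHS](powRr0 c); apply: ger_powR; last by rewrite subr_ge0.
by rewrite c0 ltW.
Qed.

Lemma onem_powR_ge r t : 0 < r -> 0 < t -> t < 1 ->
  Num.min 1 r * (1 - t) <= 1 - t `^ r.
Proof.
move=> r0 t0 t1; have [r1|r1] := leP 1 r.
  by rewrite mul1r lerD2l lerN2; apply: ge1r_powR; rewrite // t0 ltW.
have [c /andP[tc c1] ->] := onem_powR_MVT r t0 t1.
have c0 : 0 < c by exact: lt_trans tc.
rewrite ler_wpM2r ?subr_ge0 ?(ltW t1)// ler_peMr ?(ltW r0)//.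
have := @ger_powR _ c; rewrite c0 ltW//= => /(_ isT (r - 1) 0).
by rewrite powRr0; apply; rewrite subr_le0 ltW.
Qed.

(** Thus [(1 - t^r) / r] is nonincreasing in [r]: [t^y] is the power [y / x >= 1] of [t^x], and
    Bernoulli's inequality applies. *)
Lemma onem_powR_ratio x y t : 0 < x -> x <= y -> 0 < t -> t < 1 ->
  x * (1 - t `^ y) <= y * (1 - t `^ x).
Proof.
move=> x0 xy t0 t1.
have -> : t `^ y = (t `^ x) `^ (y / x) by rewrite -powRrM mulrCA divff ?mulr1// gt_eqF.
rewrite -ler_pdivlMl// mulrA (mulrC x^-1).
apply: onem_powR_le; rewrite ?powR_gt0 ?powR_lt1//.
by rewrite ler_pdivlMr ?mul1r.
Qed.

Lemma powR_root x r : 0 < x -> 0 < r -> (x `^ r^-1) `^ r = x.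
Proof. by move=> x0 r0; rewrite -powRrM mulVf ?gt_eqF// powRr1// ltW. Qed.

Lemma powR_pred_mul r x : 0 < x -> x `^ (r - 2) * x = x `^ (r - 1).
Proof.
move=> x0; rewrite -{2}(powRr1 (ltW x0)) -powRD ?(gt_eqF x0) ?implybT//.
by congr (_ `^ _); ring.
Qed.

Lemma norm_powR_small r e : 0 < r -> 0 < e ->
  exists2 d : R, 0 < d & forall y, `|y| < d -> `|y| `^ r <= e.
Proof.
move=> r0 e0; exists (e `^ r^-1); first by rewrite powR_gt0.
move=> y yd; rewrite -[leRHS](powR_root e0 r0).
by apply: ge0_ler_powR; rewrite ?nnegrE ?powR_ge0 ?(ltW r0) ?(ltW yd).
Qed.

Lemma normr_powR_pred r y : 1 < r -> `| `|y| `^ (r - 2) * y| = `|y| `^ (r - 1).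
Proof.
move=> r1; have [->|y0] := eqVneq y 0.
  by rewrite mulr0 normr0 powR0// gt_eqF// subr_gt0.
by rewrite normrM (ger0_norm (powR_ge0 _ _)) powR_pred_mul// normr_gt0.
Qed.

(** At 0 the difference quotient has modulus [|y|^(r - 1)], which tends to 0; the formula gives 0
    there even for [r < 2], owing to the factor [x]. *)
Lemma is_derive_norm_powR r x : 1 < r ->
  is_derive x 1 (fun y : R => `|y| `^ r) (r * (`|x| `^ (r - 2) * x)).
Proof.
move=> r1; have [x0|x0|->] := ltgtP x 0.
- have d1 : is_derive x 1 (fun y : R => - y) (- 1) by exact: is_deriveN.
  have nx0 : 0 < - x by rewrite oppr_gt0.
  have := is_derive_comp (g := fun y : R => - y) (is_derive1_powR r nx0) d1.
  move=> d2; apply: (@near_eq_is_derive _ _ _ (fun y : R => (- y) `^ r)) => //.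
    near=> y; rewrite ltr0_norm//; near: y; exact: lt_nbhsl.
  apply: is_derive_val_eq d2; rewrite ltr0_norm//.
  have <- := powR_pred_mul r nx0; ring.
- apply: (@near_eq_is_derive _ _ _ (fun y : R => y `^ r)) => //.
    near=> y; rewrite gtr0_norm//; near: y; exact: lt_nbhsr.
  apply: is_derive_val_eq (is_derive1_powR r x0); rewrite gtr0_norm//.
  by rewrite powR_pred_mul.
- rewrite mulr0 mulr0; apply: (@deriv_on_is_derive _ setT); first exact: filterT.
  move=> e e0; have r10 : 0 < r - 1 by rewrite subr_gt0.
  have [d d0 hd] := norm_powR_small r10 e0; exists d => // y _.
  rewrite normr0 powR0 ?gt_eqF// ?(lt_trans ltr01)// !subr0 mul0r subr0 => yd.
  rewrite (ger0_norm (powR_ge0 _ _)).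
  have -> : `|y| `^ r = `|y| `^ (r - 1) * `|y|.
    by rewrite mulrC mulr_powRB1// (lt_trans ltr01).
  by rewrite ler_wpM2r// hd.
Unshelve. all: by end_near. Qed.

Lemma continuous_norm_powR_pred r : 1 < r ->
  continuous (fun y : R => `|y| `^ (r - 2) * y).
Proof.
move=> r1 x; have [->|x0] := eqVneq x 0.
  apply/cvgrPdist_le => e e0; have r10 : 0 < r - 1 by rewrite subr_gt0.
  have [d d0 hd] := norm_powR_small r10 e0.
  exists d => //= y; rewrite /ball_/= sub0r normrN => yd.
  by rewrite mulr0 sub0r normrN normr_powR_pred// hd.
apply: (@continuousM _ _ (fun y : R => `|y| `^ (r - 2)) id); last exact: cvg_id.
apply: (@continuous_comp R R R (fun y : R => `|y|) (fun y : R => y `^ (r - 2))).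
  exact: norm_continuous.
by apply: continuous_powR; rewrite normr_gt0.
Qed.

End powR.

(** * Unimodality *)

Section unimodal.
Context {R : realType}.
Implicit Types (f : R -> R) (x y z : R).

(** A maximizer on [[x1, x2]] exists by continuity; strict concavity, written without division,
    makes it unique and gives strict monotonicity on both sides, to which the outer pieces are
    attached. *)
Lemma unimodal_of_middle_concave f x1 x2 : x1 <= x2 ->
  {within `[x1, x2], continuous f} ->
  (forall x y, x < y -> y <= x1 -> f x < f y) ->
  (forall x y z, x1 <= x -> x < y -> y < z -> z <= x2 ->
    (z - y) * f x + (y - x) * f z < (z - x) * f y) ->
  (forall x y, x2 <= x -> x < y -> f y < f x) ->
  exists m, (forall x y, x < y -> y <= m -> f x < f y) /\
            (forall x y, m <= x -> x < y -> f y < f x).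
Proof.
move=> x12 cf incr conc decr.
have [m /[!in_itv]/= /andP[x1m mx2] mmax] := EVT_max x12 cf.
have fm x : x1 <= x -> x <= x2 -> x != m -> f x < f m.
  move=> h1 h2 xm.
  have mid1 : x1 <= (x + m) / 2 by lra.
  have mid2 : (x + m) / 2 <= x2 by lra.
  have := mmax ((x + m) / 2); rewrite in_itv/= mid1 mid2 => /(_ isT) h.
  have := mmax x; rewrite in_itv/= h1 h2 => /(_ isT) hx.
  have /orP[lt_xm|lt_mx] : (x < m) || (m < x) by rewrite -neq_lt.
    have a1 : x < (x + m) / 2 by lra.
    have a2 : (x + m) / 2 < m by lra.
    by have := conc _ _ _ h1 a1 a2 mx2; nra.
  have a1 : m < (x + m) / 2 by lra.
  have a2 : (x + m) / 2 < x by lra.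
  by have := conc _ _ _ x1m a1 a2 h2; nra.
have incr2 x y : x1 <= x -> x < y -> y <= m -> f x < f y.
  move=> h1 h2; rewrite le_eqVlt => /predU1P[ym|ym].
    by rewrite ym; apply: fm; [|lra|rewrite lt_eqF -?ym].
  have := conc _ _ _ h1 h2 ym mx2.
  have fxm : f x < f m by apply: fm; [|lra|rewrite lt_eqF// (lt_trans h2)].
  by nra.
have decr2 x y : m <= x -> x < y -> y <= x2 -> f y < f x.
  rewrite le_eqVlt => /predU1P[<-|mx] h2 h1.
    by apply: fm; [lra| |rewrite gt_eqF].
  have := conc _ _ _ x1m mx h2 h1.
  have fym : f y < f m by apply: fm; [lra| |rewrite gt_eqF// (lt_trans mx)].
  by nra.
exists m; split=> x y.
- move=> xy ym; have [yx1|x1y] := leP y x1; first exact: incr.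
  have [x1x|xx1] := leP x1 x; first exact: incr2.
  apply: lt_trans (incr _ _ xx1 (lexx _)) _; exact: incr2.
- move=> mx xy; have [x2x|xx2] := leP x2 x; first exact: decr.
  have [yx2|x2y] := leP y x2; first exact: decr2.
  by apply: lt_trans (decr _ _ (lexx _) x2y) _; exact: decr2.
Qed.

Lemma IVT_crossing f a b v : a <= b -> {within `[a, b], continuous f} ->
  f a <= v /\ v <= f b \/ f b <= v /\ v <= f a ->
  exists2 c, a <= c <= b & f c = v.
Proof.
move=> ab cf h0.
have [|c] := IVT (v := v) ab cf; last by rewrite in_itv/= => cab E; exists c.
by rewrite ge_min le_max; case: h0 => -[-> ->]; rewrite ?orbT.
Qed.

Lemma decreasing_derive_concave f f' x y z : x < y -> y < z ->
  (forall c, c \in `[x, z] -> is_derive c 1 f (f' c)) ->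
  (forall c d, x <= c -> c < d -> d <= z -> f' d < f' c) ->
  (z - y) * f x + (y - x) * f z < (z - x) * f y.
Proof.
move=> xy yz df decr.
have mvt u v : x <= u -> u < v -> v <= z ->
    exists2 c, u < c < v & f v - f u = f' c * (v - u).
  move=> xu uv vz; have sub c : c \in `[u, v] -> c \in `[x, z].
    by rewrite !in_itv/= => /andP[h1 h2]; apply/andP; split; lra.
  have hd c : c \in `]u, v[ -> is_derive c 1 f (f' c).
    by move=> cuv; apply/df/sub; exact: subset_itv_oo_cc.
  have hc : {within `[u, v], continuous f}.
    by apply: derivable_within_continuous => c /sub /df[].
  by have [c cuv E] := MVT uv hd hc; exists c.
have [c /andP[c1 c2] E1] := mvt _ _ (lexx _) xy (ltW yz).
have [d /andP[d1 d2] E2] := mvt _ _ (ltW xy) yz (lexx _).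
have fdc := decr c d (ltW c1) (lt_trans c2 d1) (ltW d2).
rewrite -subr_gt0 (_ : _ - _ = (z - y) * (f y - f x) - (y - x) * (f z - f y)); last by ring.
rewrite E1 E2 (_ : _ - _ = (z - y) * (y - x) * (f' c - f' d)); last by ring.
by rewrite !mulr_gt0 ?subr_gt0.
Qed.

End unimodal.

(** * Concavity of the inverse square root of a sum of two exponentials *)

Section exp_sum.
Context {R : realType} (a b A B : R).
Hypotheses (a0 : 0 < a) (b0 : 0 < b) (A0 : 0 < A) (B0 : 0 < B).
Implicit Types (x y z : R).

Let X x := A * expR (- a * x).
Let Y x := B * expR (b * x).

(** For [x = ln alpha], [a = 2 - q] and [b = p - 2] this is the reduced energy at a fixed [t], and
    the inverse square root of its double is the integrand of the time map. *)
Definition exp_sum x := A * expR (- a * x) + B * expR (b * x).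

Let X0 x : 0 < X x. Proof. by rewrite mulr_gt0 ?expR_gt0. Qed.
Let Y0 x : 0 < Y x. Proof. by rewrite mulr_gt0 ?expR_gt0. Qed.

Let dXY c d x : is_derive x 1 (fun x => c * expR (d * x)) (c * (expR (d * x) * d)).
Proof.
apply: is_derive_scale; apply: is_derive_comp.
by apply: is_derive_val_eq (is_derive_scale d (is_derive_id x 1)); rewrite mulr1.
Qed.

Lemma exp_sum_gt0 x : 0 < exp_sum x.
Proof. by rewrite addr_gt0 ?mulr_gt0 ?expR_gt0. Qed.

Let dS x : is_derive x 1 exp_sum (b * Y x - a * X x).
Proof.
by apply: is_derive_val_eq (is_derive_add (dXY A (- a) x) (dXY B b x)); rewrite /X /Y; ring.
Qed.

Let dD x : is_derive x 1 (fun x => b * Y x - a * X x) (b ^+ 2 * Y x + a ^+ 2 * X x).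
Proof.
apply: is_derive_val_eq (is_derive_sub (is_derive_scale b (dXY B b x))
  (is_derive_scale a (dXY A (- a) x))); rewrite /X /Y; ring.
Qed.

Let YX x y : x < y -> b * Y x >= a * X x -> b * Y y > a * X y.
Proof.
move=> xy h.
have hX : X y < X x by rewrite /X ltr_pM2l// ltr_expR !mulNr ltrN2 ltr_pM2l.
have hY : Y x < Y y by rewrite /Y ltr_pM2l// ltr_expR ltr_pM2l.
by apply: lt_trans (le_lt_trans h _); rewrite ltr_pM2l.
Qed.

Lemma exp_sum_decr x y : x < y -> b * (B * expR (b * y)) <= a * (A * expR (- a * y)) ->
  exp_sum y < exp_sum x.
Proof.
rewrite -/(Y y) -/(X y) => xy h.
apply: (@ltr0_derive1_lt_cc _ exp_sum x y) => //.
- move=> z; rewrite in_itv/= => /andP[xz zy]; rewrite derive1E.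
  have [_ ->] := dS z; rewrite subr_lt0 ltNge; apply/negP => /(YX zy).
  by rewrite ltNge h.
- by apply: derivable_within_continuous => z _; have [] := dS z.
- by rewrite in_itv/= lexx ltW.
- by rewrite in_itv/= lexx ltW.
Qed.

Lemma exp_sum_incr x y : x < y -> a * (A * expR (- a * x)) <= b * (B * expR (b * x)) ->
  exp_sum x < exp_sum y.
Proof.
rewrite -/(Y x) -/(X x) => xy h.
apply: (@gtr0_derive1_lt_cc _ exp_sum x y) => //.
- move=> z; rewrite in_itv/= => /andP[xz zy]; rewrite derive1E.
  by have [_ ->] := dS z; rewrite subr_gt0; exact: YX xz h.
- by apply: derivable_within_continuous => z _; have [] := dS z.
- by rewrite in_itv/= lexx ltW.
- by rewrite in_itv/= lexx ltW.
Qed.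

(* N^(-1/2) is strictly concave where 3 N'^2 < 2 N N''; with u = a X, v = b Y
   this reads u^2 + v^2 < u v (6 + 2 (a / b + b / a)). *)
Lemma exp_sum_concave k x y z : k < 3 + b / a + a / b -> x < y -> y < z ->
  (forall c, x <= c -> c <= z ->
    a * (A * expR (- a * c)) <= k * (b * (B * expR (b * c))) /\
    b * (B * expR (b * c)) <= k * (a * (A * expR (- a * c)))) ->
  (z - y) * (Num.sqrt (2 * exp_sum x))^-1 + (y - x) * (Num.sqrt (2 * exp_sum z))^-1
  < (z - x) * (Num.sqrt (2 * exp_sum y))^-1.
Proof.
move=> kab xy yz kXY.
pose S x := 2 * exp_sum x.
pose D x := b * Y x - a * X x.
have S0 c : 0 < S c by rewrite mulr_gt0 ?exp_sum_gt0.
have dS2 (c : R) : is_derive c 1 S (2 * D c) by exact: is_derive_scale.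
pose f c := S c `^ (- (1 / 2)).
have fE c : (Num.sqrt (2 * exp_sum c))^-1 = f c.
  by rewrite /f powRN div1r powR12_sqrt// ltW.
rewrite !fE.
(* As [S' = 2 D], this is the derivative of [S^(-1/2)]; it decreases strictly where
   [S D' > 3 D^2]. *)
pose f' c := - (S c `^ (- (3 / 2)) * D c).
have df (c : R) : is_derive c 1 f (f' c).
  apply: is_derive_val_eq (is_derive_comp (is_derive1_powR (- (1 / 2)) (S0 c)) (dS2 c)).
  rewrite /f' (_ : - (1 / 2) - 1 = - (3 / 2)); last by field.
  by field.
apply: (decreasing_derive_concave xy yz (fun c _ => df c)) => c d xc cd dz.
rewrite ltrN2.
(* Multiplying [u <= k v] by [u] and [v <= k u] by [v] gives [u^2 + v^2 <= 2 k u v < (6 + 2 (b / a +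
   a / b)) u v], which rearranges to the claim. *)
have gen u v : 0 < u -> 0 < v -> u <= k * v -> v <= k * u ->
    3 * (v - u) ^+ 2 < 2 * (u ^+ 2 + v ^+ 2 + u * v * (b / a + a / b)).
  move=> u0 v0 h1 h2.
  have k2 : k * (u * v) < (3 + b / a + a / b) * (u * v) by rewrite ltr_pM2r// mulr_gt0.
  have u2 : u * u <= k * (u * v) by rewrite mulrCA ler_pM2l.
  have v2 : v * v <= k * (u * v) by rewrite (mulrC u) mulrCA ler_pM2l.
  rewrite -subr_gt0 (_ : _ - _ = 2 * ((3 + b / a + a / b) * (u * v)) - u * u - v * v).
    by lra.
  by ring.
pose g' c := S c `^ (- (5 / 2)) * (S c * (b ^+ 2 * Y c + a ^+ 2 * X c) - 3 * D c ^+ 2).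
have dg (e : R) : is_derive e 1 (fun c => S c `^ (- (3 / 2)) * D c) (g' e).
  apply: is_derive_val_eq (is_derive_mul (is_derive_comp
    (is_derive1_powR (- (3 / 2)) (S0 e)) (dS2 e)) (dD e)).
  rewrite /g' (_ : - (3 / 2) - 1 = - (5 / 2)); last by field.
  have -> : S e `^ (- (3 / 2)) = S e `^ (- (5 / 2)) * S e.
    rewrite -{3}(powRr1 (ltW (S0 e))) -powRD; last by rewrite (gt_eqF (S0 e)) implybT.
    by congr (_ `^ _); field.
  by rewrite -/(D e); field.
apply: (@gtr0_derive1_lt_cc _ (fun c => S c `^ (- (3 / 2)) * D c) c d) => //.
- move=> e; rewrite in_itv/= => /andP[ce ed]; rewrite derive1E.
  have [_ ->] := dg e; rewrite /g' mulr_gt0 ?powR_gt0// subr_gt0.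
  have [] := kXY e; [lra|lra|].
  rewrite -/(X e) -/(Y e) => h1 h2.
  have u0 : 0 < a * X e by rewrite mulr_gt0.
  have v0 : 0 < b * Y e by rewrite mulr_gt0.
  have -> : S e * (b ^+ 2 * Y e + a ^+ 2 * X e) = 2 * ((a * X e) ^+ 2 + (b * Y e) ^+ 2
      + (a * X e) * (b * Y e) * (b / a + a / b)).
    by rewrite /S /exp_sum -/(X e) -/(Y e); field; rewrite !gt_eqF.
  exact: gen.
- by apply: derivable_within_continuous => e _; have [] := dg e.
- by rewrite in_itv/= lexx ltW.
- by rewrite in_itv/= lexx ltW.
Qed.

End exp_sum.

(** * The time map *)

Section time_map.
Context {R : realType} (p q : R).
Hypotheses (q1 : 1 < q) (q2 : q < 2) (p2 : 2 < p).
Notation mu := (@lebesgue_measure R).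
Implicit Types (t s al lam : R).

Let q0 : 0 < q. Proof. exact: lt_trans q1. Qed.
Let p0 : 0 < p. Proof. exact: lt_trans p2. Qed.
Let qp : q < p. Proof. exact: lt_trans p2. Qed.
Let pq0 : 0 < p - q. Proof. by rewrite subr_gt0. Qed.

(** Up to constants, the common majorant of all time kernels, and the time kernel itself at the
    critical amplitude. *)
Definition singular_kernel t := (Num.sqrt (t `^ q - t `^ p))^-1.

Lemma subr_powR_gt0 t : 0 < t -> t < 1 -> 0 < t `^ q - t `^ p.
Proof. by move=> t0 t1; rewrite subr_gt0 ltr_powR_exp. Qed.

Lemma continuous_singular_kernel : {in `]0, 1[, continuous singular_kernel}.
Proof.
move=> t; rewrite in_itv/= => /andP[t0 t1].
apply: (@continuousV _ _ (fun t => Num.sqrt (t `^ q - t `^ p))).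
  by rewrite gt_eqF// sqrtr_gt0 subr_powR_gt0.
apply: (@continuous_comp _ _ _ (fun t => t `^ q - t `^ p) Num.sqrt).
  by apply: continuousB; exact: continuous_powR.
exact: sqrt_continuous.
Qed.

(** The kernel is of order [t^(-q/2)] at 0, integrable since [q < 2], and [(1 - t)^(-1/2)] at 1. The
    sum of the two singular terms has an explicit primitive. *)
Let dominating t := t `^ (- (q / 2)) + (Num.sqrt (1 - t))^-1.

Let dominating_integrable : mu.-integrable `]0, 1[ (EFin \o dominating).
Proof.
have s0 : 0 < 1 - q / 2 by have := q2; lra.
pose F t := (1 - q / 2)^-1 * t `^ (1 - q / 2) - 2 * Num.sqrt (1 - t).
apply: (@ge0_FTC2_oo_integrable _ 0 1 _ F) => //.
- move=> x; apply: cvgB.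
    by apply: cvgMr; exact: within_continuous_powR.
  apply: cvgMr; apply: (@continuous_subspaceT _ _ _ (fun t => Num.sqrt (1 - t))) => y.
  apply: (@continuous_comp _ _ _ (fun t => 1 - t) Num.sqrt).
    by apply: continuousB; [exact: cvg_cst|exact: cvg_id].
  exact: sqrt_continuous.
- move=> t; rewrite in_itv/= => /andP[t0 t1].
  have t10 : 0 < 1 - t by lra.
  have d1 := is_derive1_powR (1 - q / 2) t0.
  have d2 : is_derive t 1 (fun t => 1 - t) (0 - 1) by exact: is_derive_sub.
  have d3 := is_derive_comp (g := fun t => 1 - t) (is_derive1_sqrt t10) d2.
  apply: is_derive_val_eq (is_derive_sub (is_derive_scale _ d1) (is_derive_scale 2 d3)).
  rewrite /dominating mulrA mulVf ?gt_eqF// mul1r.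
  rewrite (_ : 1 - q / 2 - 1 = - (q / 2)); last by ring.
  by congr (_ + _); field; rewrite gt_eqF// sqrtr_gt0.
- move=> t; rewrite in_itv/= => /andP[t0 t1].
  apply: (@continuousD _ _ _ (powR (R:=R) ^~ (- (q / 2)))).
    exact: continuous_powR.
  apply: (@continuousV _ _ (fun t => Num.sqrt (1 - t))).
    by rewrite gt_eqF// sqrtr_gt0 subr_gt0.
  apply: (@continuous_comp _ _ _ (fun t => 1 - t) Num.sqrt).
    by apply: continuousB; [exact: cvg_cst|exact: cvg_id].
  exact: sqrt_continuous.
- by move=> t _; rewrite addr_ge0 ?powR_ge0 ?invr_ge0 ?sqrtr_ge0.
Qed.

Lemma singular_kernel_integrable : mu.-integrable `]0, 1[ (EFin \o singular_kernel).
Proof.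
(* From [t^q - t^p = t^q (1 - t^(p - q)) >= c t^q (1 - t)] the kernel is at most [c^(-1/2)] times
   the product of the two singular factors. On each half of []0, 1[] one factor is at most 2, whence
   the 2 in [C]. *)
pose c := Num.min 1 (p - q).
have c0 : 0 < c by rewrite lt_min ltr01.
pose C := (Num.sqrt c)^-1 * 2.
apply: (@le_integrable _ _ _ mu _ (measurable_itv _) _
  (fun t => (C%:E * (EFin \o dominating) t)%E)).
- apply/measurable_EFinP; exact: continuous_oo_measurable continuous_singular_kernel.
- move=> t; rewrite /= in_itv/= => /andP[t0 t1]; rewrite lee_fin.
  have K0 : 0 <= dominating t.
    by rewrite addr_ge0 ?powR_ge0 ?invr_ge0 ?sqrtr_ge0.
  rewrite ger0_norm ?invr_ge0 ?sqrtr_ge0// ger0_norm; last first.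
    by rewrite mulr_ge0// mulr_ge0// invr_ge0 sqrtr_ge0.
  pose a := t `^ (- (q / 2)); pose b := (Num.sqrt (1 - t))^-1.
  have a0 : 0 < a by rewrite powR_gt0.
  have b0 : 0 < b by rewrite invr_gt0 sqrtr_gt0 subr_gt0.
  have Jab : singular_kernel t <= (Num.sqrt c)^-1 * (a * b).
    rewrite /a powRN -!invfM lef_pV2 ?posrE ?sqrtr_gt0 ?subr_powR_gt0//; last first.
      by rewrite !mulr_gt0 ?sqrtr_gt0 ?powR_gt0 ?subr_gt0.
    have -> : t `^ (q / 2) = Num.sqrt (t `^ q).
      by rewrite -powR12_sqrt ?powR_ge0// -powRrM.
    rewrite -!sqrtrM ?powR_ge0 ?(ltW c0)//.
    rewrite ler_sqrt ?(ltW (subr_powR_gt0 t0 t1))//.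
    have -> : t `^ q - t `^ p = t `^ q * (1 - t `^ (p - q)).
      by rewrite powRB ?(gt_eqF t0) ?implybT//; field; rewrite gt_eqF// powR_gt0.
    rewrite mulrCA ler_wpM2l ?powR_ge0//; exact: onem_powR_ge.
  apply: le_trans Jab _; rewrite /C -mulrA ler_wpM2l ?invr_ge0 ?sqrtr_ge0//.
  have [t2|t2] := leP t (1 / 2).
  - have b2 : b <= 2.
      rewrite /b invf_ple ?posrE ?sqrtr_gt0 ?subr_gt0//.
      by rewrite -[leLHS]gtr0_norm ?invr_gt0// -sqrtr_sqr ler_sqrt; lra.
    rewrite /dominating -/a -/b; nra.
  - have a2 : a <= 2.
      apply: (@le_trans _ _ (t `^ (- 1))).
        by apply/ltW/ltr_powR_exp => //; have := q2; lra.
      by rewrite powR_inv1 ?(ltW t0)// invf_ple ?posrE//; lra.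
    rewrite /dominating -/a -/b; nra.
- by apply: integrableZl.
Qed.
(** The substitution [s = al * t], carried out on the primitive [Phi], so that integrability on []0,
    al[] comes together with the value. *)
Lemma rescaled_kernel_FTC (h : R -> R) al : 0 < al ->
  {in `]0, 1[, continuous h} -> {in `]0, 1[, forall t, 0 <= h t} ->
  mu.-integrable `]0, 1[ (EFin \o h) ->
  mu.-integrable `]0, al[ (EFin \o (fun s => al^-1 * h (s / al))) /\
  \int[mu]_(s in `]0, al[) (al^-1 * h (s / al)) = \int[mu]_(t in `]0, 1[) h t.
Proof.
move=> al0 ch h0 ih.
pose Phi t := \int[mu]_(x in `]0, t[) h x.
pose F s := Phi (s / al).
have ooE s : (s \in `]0, al[) -> s / al \in `]0, 1[.
  by rewrite !in_itv/= => /andP[s0 s1]; rewrite divr_gt0//= ltr_pdivrMr// mul1r.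
have ccE s : `[0, al]%classic s -> `[0, 1]%classic (s / al).
  rewrite /= !in_itv/= => /andP[s0 s1].
  by rewrite divr_ge0 ?(ltW al0)//= ler_pdivrMr// mul1r.
have cF : {within `[0, al], continuous F}.
  apply: (within_continuous_comp (primitive_continuous ltr01 ih) _ ccE).
  apply: continuous_subspaceT => x; apply: cvgMl; exact: cvg_id.
have dF : {in `]0, al[, forall s : R, is_derive s 1 F (al^-1 * h (s / al))}.
  move=> s /ooE sal; rewrite mulrC.
  apply: (is_derive_comp (f := Phi) (g := fun s => s / al)).
    exact: (primitive_is_derive ch ih sal).
  apply: (is_derive_val_eq (a := al^-1 * 1)); first by rewrite mulr1.
  rewrite (_ : (fun s => s / al) = (fun s => al^-1 * s)); last first.
    by apply/funext => y; rewrite mulrC.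
  exact: is_derive_scale.
have cg : {in `]0, al[, continuous (fun s => al^-1 * h (s / al))}.
  move=> s /ooE sal; apply: cvgMr.
  apply: (@continuous_comp _ _ _ (fun s => s / al) h); last exact: ch.
  by apply: cvgMl; exact: cvg_id.
have g0 : {in `]0, al[, forall s, 0 <= al^-1 * h (s / al)}.
  by move=> s /ooE sal; rewrite mulr_ge0 ?invr_ge0 ?(ltW al0)// h0.
split; first exact: ge0_FTC2_oo_integrable al0 cF dF cg g0.
rewrite (ge0_Rintegral_FTC2_oo al0 cF dF cg g0) /F /Phi divff ?gt_eqF//.
by rewrite mul0r Rintegral_oo_diag subr0.
Qed.

(** The inequality is [G(al) >= 0] divided by [al^q]. It is automatic for [lam >= 0] and means
    [alpha_min <= al] for [lam <= 0], so one condition serves both signs. *)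
Definition admissible lam al := 0 < al /\ 0 <= lam / q + al `^ (p - q) / p.

(** This is [(G(al) - G(al t)) / al^2]; the square root of [al^2] cancels the Jacobian of
    [s = al * t]. *)
Definition reduced_energy lam al t :=
  lam / q * al `^ (q - 2) * (1 - t `^ q) + al `^ (p - 2) / p * (1 - t `^ p).

Definition time_kernel lam al t := (Num.sqrt (2 * reduced_energy lam al t))^-1.

Lemma powR_split al r : 0 < al -> al `^ (p - r) = al `^ (q - r) * al `^ (p - q).
Proof.
by move=> al0; rewrite -powRD ?(gt_eqF al0) ?implybT//; congr (_ `^ _); ring.
Qed.

(** The difference of the two sides is [al^(q - 2) (1 - t^q)] times the nonnegative quantity in
    [admissible], so equality holds at the critical amplitude. *)
Lemma reduced_energy_ge lam al t : admissible lam al -> 0 < t -> t < 1 ->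
  al `^ (p - 2) / p * (t `^ q - t `^ p) <= reduced_energy lam al t.
Proof.
move=> [al0 adm] t0 t1; rewrite -subr_ge0.
rewrite (_ : _ - _ = al `^ (q - 2) * (1 - t `^ q) * (lam / q + al `^ (p - q) / p)).
  rewrite !mulr_ge0// ?powR_ge0// subr_ge0 ltW// powR_lt1//.
by rewrite /reduced_energy (powR_split 2)//; field; rewrite !gt_eqF.
Qed.

Lemma reduced_energy_gt0 lam al t : admissible lam al -> 0 < t -> t < 1 ->
  0 < reduced_energy lam al t.
Proof.
move=> adm t0 t1; apply: lt_le_trans (reduced_energy_ge adm t0 t1).
by case: adm => al0 _; rewrite mulr_gt0 ?subr_powR_gt0// divr_gt0 ?powR_gt0.
Qed.

Lemma G_reduced_energy lam al t : 0 < al -> 0 <= t ->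
  G p q lam al - G p q lam (al * t) = al ^+ 2 * reduced_energy lam al t.
Proof.
move=> al0 t0; rewrite /G !ger0_norm ?mulr_ge0 ?(ltW al0)// !powRM ?(ltW al0)//.
have sq r : al `^ r = al ^+ 2 * al `^ (r - 2).
  rewrite -powR_mulrn ?(ltW al0)// -powRD ?(gt_eqF al0) ?implybT//.
  by congr (_ `^ _); ring.
by rewrite /reduced_energy (sq q) (sq p); ring.
Qed.

Lemma time_kernel_G lam al s : admissible lam al -> s \in `]0, al[ ->
  (Num.sqrt (2 * (G p q lam al - G p q lam s)))^-1 =
  al^-1 * time_kernel lam al (s / al).
Proof.
move=> adm; rewrite in_itv/= => /andP[s0 sal].
have al0 : 0 < al by case: adm.
have {1}-> : s = al * (s / al) by rewrite mulrCA divff ?mulr1// gt_eqF.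
rewrite G_reduced_energy ?divr_ge0 ?(ltW s0) ?(ltW al0)//.
rewrite mulrCA sqrtrM ?sqr_ge0// sqrtr_sqr gtr0_norm//.
by rewrite /time_kernel invfM.
Qed.

Lemma continuous_reduced_energy lam al t : 0 < t ->
  {for t, continuous (reduced_energy lam al)}.
Proof.
move=> t0; have c r : {for t, continuous (fun t : R => 1 - t `^ r)}.
  by apply: continuousB; [exact: cvg_cst|exact: continuous_powR].
apply: (@continuousD _ _ _ (fun t => lam / q * al `^ (q - 2) * (1 - t `^ q))).
  by apply: cvgMr; exact: c.
by apply: cvgMr; exact: c.
Qed.

Lemma continuous_time_kernel lam al : admissible lam al ->
  {in `]0, 1[, continuous (time_kernel lam al)}.
Proof.
move=> adm t; rewrite in_itv/= => /andP[t0 t1].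
apply: (@continuousV _ _ (fun t => Num.sqrt (2 * reduced_energy lam al t))).
  by rewrite gt_eqF// sqrtr_gt0 mulr_gt0// reduced_energy_gt0.
apply: (@continuous_comp _ _ _ (fun t => 2 * reduced_energy lam al t) Num.sqrt).
  by apply: cvgMr; exact: continuous_reduced_energy.
exact: sqrt_continuous.
Qed.

Lemma time_kernel_ge0 lam al t : 0 <= time_kernel lam al t.
Proof. by rewrite invr_ge0 sqrtr_ge0. Qed.

Lemma time_kernel_le lam al t c : 0 < c ->
  c * (t `^ q - t `^ p) <= reduced_energy lam al t -> 0 < t -> t < 1 ->
  time_kernel lam al t <= (Num.sqrt (2 * c))^-1 * singular_kernel t.
Proof.
move=> c0 cN t0 t1; have J0 := subr_powR_gt0 t0 t1.
have N0 : 0 < reduced_energy lam al t by apply: lt_le_trans cN; rewrite mulr_gt0.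
rewrite /singular_kernel -invfM lef_pV2 ?posrE; last 2 first.
- by rewrite sqrtr_gt0 mulr_gt0.
- by rewrite mulr_gt0// sqrtr_gt0// mulr_gt0.
rewrite -sqrtrM ?mulr_ge0 ?(ltW c0)//.
by rewrite ler_sqrt -?mulrA ?ler_wpM2l// mulr_ge0// ltW.
Qed.

Lemma time_kernel_integrable lam al : admissible lam al ->
  mu.-integrable `]0, 1[ (EFin \o time_kernel lam al).
Proof.
move=> adm; have al0 : 0 < al by case: adm.
pose C := (Num.sqrt (2 * (al `^ (p - 2) / p)))^-1.
apply: (@le_integrable _ _ _ mu _ (measurable_itv _) _
  (fun t => (C%:E * (EFin \o singular_kernel) t)%E)).
- apply/measurable_EFinP; exact: continuous_oo_measurable (continuous_time_kernel adm).
- move=> t; rewrite /= in_itv/= => /andP[t0 t1]; rewrite lee_fin.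
  rewrite !ger0_norm ?time_kernel_ge0 ?mulr_ge0 ?invr_ge0 ?sqrtr_ge0//.
  apply: time_kernel_le => //; first by rewrite divr_gt0 ?powR_gt0.
  exact: reduced_energy_ge.
- by apply: integrableZl => //; exact: singular_kernel_integrable.
Qed.

Lemma T_integral lam al : admissible lam al ->
  T p q lam al = \int[mu]_(t in `]0, 1[) time_kernel lam al t.
Proof.
move=> adm; have al0 : 0 < al by case: adm.
have [_ <-] := rescaled_kernel_FTC al0 (continuous_time_kernel adm)
  (fun t _ => time_kernel_ge0 lam al t) (time_kernel_integrable adm).
by apply: eq_Rintegral => s /[!inE] sal; exact: time_kernel_G.
Qed.

Lemma phi_kernel_integrable lam al : admissible lam al ->
  mu.-integrable `]0, al[
    (EFin \o (fun s => (Num.sqrt (2 * (G p q lam al - G p q lam s)))^-1)).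
Proof.
move=> adm; have al0 : 0 < al by case: adm.
have [+ _] := rescaled_kernel_FTC al0 (continuous_time_kernel adm)
  (fun t _ => time_kernel_ge0 lam al t) (time_kernel_integrable adm).
apply: eq_integrable => // s /[!inE] sal; rewrite /= time_kernel_G//.
Qed.

(** * Comparison, bounds, scaling and continuity of the time map *)

Lemma lt_T lam al lam' al' : admissible lam al -> admissible lam' al' ->
  (forall t, 0 < t -> t < 1 ->
    reduced_energy lam al t < reduced_energy lam' al' t) ->
  T p q lam' al' < T p q lam al.
Proof.
move=> adm adm' lt_N; rewrite !T_integral//.
apply: lt_Rintegral_oo ltr01 _ _ _ _ _.
- exact: continuous_time_kernel.
- exact: continuous_time_kernel.
- exact: time_kernel_integrable.
- exact: time_kernel_integrable.
move=> t; rewrite in_itv/= => /andP[t0 t1].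
rewrite /time_kernel ltf_pV2 ?posrE ?sqrtr_gt0 ?mulr_gt0 ?reduced_energy_gt0//.
by rewrite ltr_sqrt ?ltr_pM2l ?lt_N// mulr_gt0// reduced_energy_gt0.
Qed.

Lemma T_gt0 lam al : admissible lam al -> 0 < T p q lam al.
Proof.
move=> adm; rewrite T_integral//.
rewrite [ltLHS](_ : _ = \int[mu]_(t in `]0, 1[) (0 : R)); last first.
  by rewrite Rintegral_cst//= mul0r.
apply: lt_Rintegral_oo ltr01 _ _ _ _ _.
- by move=> t _; exact: cvg_cst.
- exact: continuous_time_kernel.
- exact: integrable0.
- exact: time_kernel_integrable.
move=> t; rewrite in_itv/= => /andP[t0 t1].
by rewrite invr_gt0 sqrtr_gt0 mulr_gt0// reduced_energy_gt0.
Qed.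

Definition kernel_mass := \int[mu]_(t in `]0, 1[) singular_kernel t.

Lemma kernel_mass_ge0 : 0 <= kernel_mass.
Proof.
by apply: Rintegral_ge0 => t _; rewrite invr_ge0 sqrtr_ge0.
Qed.

Lemma T_le lam al c : admissible lam al -> 0 < c ->
  (forall t, 0 < t -> t < 1 -> c * (t `^ q - t `^ p) <= reduced_energy lam al t) ->
  T p q lam al <= (Num.sqrt (2 * c))^-1 * kernel_mass.
Proof.
move=> adm c0 cN; rewrite T_integral// -RintegralZl//; last exact: singular_kernel_integrable.
apply: le_Rintegral => //.
- exact: time_kernel_integrable.
- by apply: (@integrableZl _ _ _ mu _ _ _ (EFin \o singular_kernel)) => //; exact: singular_kernel_integrable.
by move=> t; rewrite /= in_itv/= => /andP[t0 t1]; apply: time_kernel_le => //; exact: cN.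
Qed.

Lemma T_le_large lam al : admissible lam al ->
  T p q lam al <= (Num.sqrt (2 * (al `^ (p - 2) / p)))^-1 * kernel_mass.
Proof.
move=> adm; apply: T_le => //; last by move=> t; exact: reduced_energy_ge.
by case: adm => al0 _; rewrite divr_gt0 ?powR_gt0.
Qed.

Lemma admissible_gt0 lam al : 0 <= lam -> 0 < al -> admissible lam al.
Proof.
move=> lam0 al0; split => //.
by rewrite addr_ge0 ?divr_ge0 ?powR_ge0 ?(ltW p0) ?(ltW q0).
Qed.

(** Since [q < 2], the bound tends to 0 with [al]. It comes from dropping the [p]-term and from [p
    (1 - t^q) >= q (1 - t^p) >= q (t^q - t^p)]. *)
Lemma T_le_small lam al : 0 < lam -> 0 < al ->
  T p q lam al <= (Num.sqrt (2 * (lam * al `^ (q - 2) / p)))^-1 * kernel_mass.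
Proof.
move=> lam0 al0; apply: T_le; first exact: admissible_gt0 (ltW lam0) al0.
  by rewrite divr_gt0// mulr_gt0 ?powR_gt0.
move=> t t0 t1; rewrite /reduced_energy.
have h1 : 0 <= al `^ (p - 2) / p * (1 - t `^ p).
  by rewrite mulr_ge0 ?divr_ge0 ?powR_ge0 ?(ltW p0)// subr_ge0 ltW// powR_lt1.
apply: le_trans (lerD (lexx _) h1); rewrite addr0.
have h2 := onem_powR_ratio q0 (ltW qp) t0 t1.
have h3 : t `^ q < 1 by rewrite powR_lt1.
have -> : lam * al `^ (q - 2) / p * (t `^ q - t `^ p) =
    lam * al `^ (q - 2) / (p * q) * (q * (t `^ q - t `^ p)).
  by field; rewrite !gt_eqF.
have -> : lam / q * al `^ (q - 2) * (1 - t `^ q) =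
    lam * al `^ (q - 2) / (p * q) * (p * (1 - t `^ q)).
  by field; rewrite !gt_eqF.
rewrite ler_wpM2l//.
  by rewrite divr_ge0 ?mulr_ge0 ?powR_ge0 ?(ltW lam0) ?(ltW p0) ?(ltW q0).
by apply: le_trans h2; rewrite ler_wpM2l ?(ltW q0)// lerD2r ltW.
Qed.

Lemma T_critical lam al : 0 < al -> lam / q + al `^ (p - q) / p = 0 ->
  T p q lam al = (Num.sqrt (2 * (al `^ (p - 2) / p)))^-1 * kernel_mass.
Proof.
move=> al0 crit; have adm : admissible lam al by split => //; rewrite crit.
rewrite T_integral// -RintegralZl//; last exact: singular_kernel_integrable.
apply: eq_Rintegral => t /[!inE]/=; rewrite in_itv/= => /andP[t0 t1].
have NE : reduced_energy lam al t = al `^ (p - 2) / p * (t `^ q - t `^ p).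
  rewrite /reduced_energy (_ : lam / q = - (al `^ (p - q) / p)); last by lra.
  by rewrite (powR_split 2)//; ring.
rewrite /time_kernel NE /singular_kernel -invfM -sqrtrM ?mulrA//.
by rewrite divr_ge0 ?mulr_ge0 ?powR_ge0 ?(ltW p0).
Qed.

(** [G] with parameter [lam * k^(p - q)] at [k z] is [k^p] times [G] with parameter [lam] at [z];
    the reduced energy is therefore multiplied by [k^(p - 2)]. *)
Lemma T_scaling lam al k : 0 < k -> admissible lam al ->
  admissible (lam * k `^ (p - q)) (k * al) /\
  T p q (lam * k `^ (p - q)) (k * al) =
  (Num.sqrt (k `^ (p - 2)))^-1 * T p q lam al.
Proof.
move=> k0 adm; have [al0 h] := adm.
have adm' : admissible (lam * k `^ (p - q)) (k * al).
  split; first exact: mulr_gt0.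
  rewrite powRM ?(ltW k0) ?(ltW al0)//.
  rewrite (_ : _ + _ = k `^ (p - q) * (lam / q + al `^ (p - q) / p)); last by ring.
  by rewrite mulr_ge0 ?powR_ge0.
split=> //; rewrite !T_integral// -RintegralZl//; last exact: time_kernel_integrable.
apply: eq_Rintegral => t _; rewrite /time_kernel -invfM -sqrtrM ?powR_ge0//.
congr (Num.sqrt _)^-1; rewrite mulrCA; congr (_ * _).
rewrite /reduced_energy !powRM ?(ltW k0) ?(ltW al0)// (powR_split 2 k0); ring.
Qed.

(** Neither term of the reduced energy decreases in [al]: in the first, [al^(q - 2)] decreases but
    its coefficient is nonpositive. The second increases strictly. *)
Lemma T_decreasing lam al al' : lam <= 0 -> admissible lam al -> al < al' ->
  admissible lam al' /\ T p q lam al' < T p q lam al.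
Proof.
move=> lam0 adm lt_al; have [al0 h] := adm.
have al'0 : 0 < al' by exact: lt_trans lt_al.
have pow r : 0 < r -> al `^ r < al' `^ r.
  by move=> r0; apply: gt0_ltr_powR => //; rewrite nnegrE ltW.
have adm' : admissible lam al'.
  split => //; apply: le_trans h _; rewrite lerD2l ler_wpM2r ?invr_ge0 ?(ltW p0)//.
  exact/ltW/pow.
split=> //; apply: lt_T => // t t0 t1; rewrite /reduced_energy.
apply: ler_ltD.
  rewrite ler_wpM2r ?subr_ge0 ?(ltW (powR_lt1 _ _ _))//.
  rewrite ler_wnM2l//; first by rewrite mulr_le0_ge0// invr_ge0 ltW.
  rewrite -[q - 2]opprB !powRN lef_pV2 ?posrE ?powR_gt0//.
  by apply/ltW/pow; have := q2; lra.
rewrite ltr_pM2r ?subr_gt0 ?powR_lt1// ltr_pM2r ?invr_gt0//.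
by apply: pow; have := p2; lra.
Qed.

Lemma T_continuous lam u v : u < v -> 0 < u ->
  (forall al, u <= al -> admissible lam al) ->
  {within `[u, v], continuous (T p q lam)}.
Proof.
move=> uv u0 adm.
(* Truncation at [u] makes the kernel admissible for all [l] in the open interval []0, v + 1[],
   which contains [[u, v]], with one majorant taken at amplitude [u]. Nothing changes for
   [l >= u]. *)
pose f l t := time_kernel lam (Num.max l u) t.
pose c := u `^ (p - 2) / p.
have c0 : 0 < c by rewrite divr_gt0 ?powR_gt0.
have maxu l : u <= Num.max l u by rewrite le_max lexx orbT.
have maxu0 l : 0 < Num.max l u by exact: lt_le_trans (maxu l).
have c_le l t : 0 < t -> t < 1 ->
    c * (t `^ q - t `^ p) <= reduced_energy lam (Num.max l u) t.
  move=> t0 t1; apply: le_trans (reduced_energy_ge (adm _ (maxu l)) t0 t1).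
  rewrite ler_wpM2r ?(ltW (subr_powR_gt0 _ _))// ler_wpM2r ?invr_ge0 ?(ltW p0)//.
  by apply: ge0_ler_powR; rewrite ?nnegrE ?(ltW u0) ?(ltW (maxu0 l))//; have := p2; lra.
have cf : {in `]0, v + 1[%classic, continuous
    (fun l => \int[mu]_(t in `]0, 1[) f l t)}.
  apply: (@continuity_under_integral _ _ _ mu f _ (measurable_itv _) _ _ _ _
      (fun t => (Num.sqrt (2 * c))^-1 * singular_kernel t)).
  - by move=> l _; apply: time_kernel_integrable; exact: adm.
  - apply/aeW => t; rewrite /= in_itv/= => /andP[t0 t1] l _.
    apply: (@continuous_comp _ _ _ (fun l => Num.max l u) (time_kernel lam ^~ t)).
      by apply: continuous_max; [exact: cvg_id|exact: cvg_cst].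
    apply: (@continuousV _ _ (fun al => Num.sqrt (2 * reduced_energy lam al t))).
      by rewrite gt_eqF// sqrtr_gt0 mulr_gt0// reduced_energy_gt0//; exact: adm.
    apply: (@continuous_comp _ _ _ (fun al => 2 * reduced_energy lam al t) Num.sqrt).
      apply: cvgMr; apply: cvgD; apply: cvgMl.
        by apply: cvgMr; exact: continuous_powR.
      by apply: cvgMl; exact: continuous_powR.
    exact: sqrt_continuous.
  - by apply: (@integrableZl _ _ _ mu _ _ _ (EFin \o singular_kernel)) => //; exact: singular_kernel_integrable.
  - move=> l _; apply/aeW => t; rewrite /= in_itv/= => /andP[t0 t1].
    by rewrite ger0_norm ?time_kernel_ge0//; apply: time_kernel_le => //; exact: c_le.
have fT l : u <= l -> \int[mu]_(t in `]0, 1[) f l t = T p q lam l.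
  move=> ul; rewrite (T_integral (adm _ ul)).
  by apply: eq_Rintegral => t _; rewrite /f; have /max_idPl -> := ul.
apply/subspace_continuousP => x /=; rewrite in_itv/= => /andP[ux xv].
suff : T p q lam @ within `[u, v]%classic (nbhs x) --> T p q lam x by [].
rewrite -[X in _ --> X](fT x)//.
have x01 : x \in `]0, v + 1[%classic.
  by rewrite inE/= in_itv/=; apply/andP; split; lra.
apply: cvg_trans (cvg_within_filter _ (cf x x01)).
apply: near_eq_cvg; rewrite near_withinE; near=> y.
by rewrite /= in_itv/= => /andP[uy _]; exact: fT.
Unshelve. all: by end_near. Qed.

(* In the variable ln alpha the kernel is increasing where
   alpha^(p - q) <= (2 - q) / (p - 2), decreasing where
   alpha^(p - q) >= (p / q) (2 - q) / (p - 2), and strictly concave in between. *)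
Lemma T_unimodal1 : exists m, [/\ 0 < m,
  forall x y, 0 < x -> x < y -> y <= m -> T p q 1 x < T p q 1 y &
  forall x y, m <= x -> x < y -> T p q 1 y < T p q 1 x].
Proof.
pose a := 2 - q; pose b := p - 2.
have a0 : 0 < a by rewrite subr_gt0.
have b0 : 0 < b by rewrite subr_gt0.
(* The bounds [q / p <= B / A <= 1] proved next determine both the window [[x1, x2]] and the
   concavity constant [p / q]. *)
pose A t := (1 - t `^ q) / q; pose B t := (1 - t `^ p) / p.
have A0 t : 0 < t -> t < 1 -> 0 < A t.
  by move=> t0 t1; rewrite divr_gt0// subr_gt0 powR_lt1.
have B0 t : 0 < t -> t < 1 -> 0 < B t.
  by move=> t0 t1; rewrite divr_gt0// subr_gt0 powR_lt1.
have BA t : 0 < t -> t < 1 -> B t <= A t.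
  move=> t0 t1; rewrite /A /B ler_pdivrMr// mulrAC ler_pdivlMr//.
  by rewrite mulrC [leRHS]mulrC; exact: onem_powR_ratio (ltW qp) t0 t1.
have AB t : 0 < t -> t < 1 -> A t <= p / q * B t.
  move=> t0 t1; rewrite /A /B mulrCA mulrAC mulrA ler_pM2r ?invr_gt0//.
  by rewrite divff ?gt_eqF// mulr1 lerD2l lerN2 ltW// ltr_powR_exp.
pose E x := expR ((p - q) * x).
have E0 x : 0 < E x by exact: expR_gt0.
have expE x : expR (b * x) = expR (- a * x) * E x.
  by rewrite -expRD; congr expR; rewrite /a /b; ring.
have adm x : admissible 1 (expR x) by apply: admissible_gt0; rewrite ?expR_gt0.
have powE x r : expR x `^ r = expR (r * x) by rewrite /powR gt_eqF ?expR_gt0// expRK.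
have NE x t : reduced_energy 1 (expR x) t = exp_sum a b (A t) (B t) x.
  rewrite /reduced_energy /exp_sum !powE /A /B /a /b opprB.
  by field; rewrite !gt_eqF.
(* In terms of [E = alpha^(p - q)] the kernel at [t] peaks where [E = rho * A t / B t], hence always
   between [rho] and [rho * (p / q)]. *)
pose rho := a / b.
have rho0 : 0 < rho by rewrite divr_gt0.
have pq1 : 1 < p / q by rewrite ltr_pdivlMr ?mul1r.
pose x1 := ln rho / (p - q); pose x2 := ln (rho * (p / q)) / (p - q).
have E1 : E x1 = rho.
  by rewrite /E /x1 mulrCA divff ?gt_eqF// mulr1 lnK.
have E2 : E x2 = rho * (p / q).
  by rewrite /E /x2 mulrCA divff ?gt_eqF// mulr1 lnK// posrE mulr_gt0// divr_gt0.
have leE x y : (x <= y) = (E x <= E y) by rewrite /E ler_expR ler_pM2l.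
pose Th x := T p q 1 (expR x).
have [m [incr decr]] : exists m, (forall x y, x < y -> y <= m -> Th x < Th y) /\
            (forall x y, m <= x -> x < y -> Th y < Th x).
  apply: (@unimodal_of_middle_concave _ Th x1 x2).
  - by rewrite leE E1 E2 ler_peMr ?(ltW rho0) ?(ltW pq1).
  - have lt12 : x1 < x2 by rewrite ltNge leE E1 E2 -ltNge ltr_pMr.
    apply: (within_continuous_comp (B := `[expR x1, expR x2]) (f := T p q 1)).
    + apply: T_continuous; rewrite ?ltr_expR ?expR_gt0// => al le_al.
      by apply: admissible_gt0 => //; apply: lt_le_trans le_al; rewrite expR_gt0.
    + apply: continuous_subspaceT; exact: continuous_expR.
    + by move=> x /=; rewrite !in_itv/= !ler_expR.
  - move=> x y xy yx1; apply: lt_T => // t t0 t1; rewrite !NE.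
    apply: exp_sum_decr => //; [exact: A0|exact: B0|].
    move: yx1; rewrite leE E1 /rho ler_pdivlMr// => h.
    rewrite expE (_ : b * _ = expR (- a * y) * (E y * b * B t)); last by ring.
    rewrite (_ : a * _ = expR (- a * y) * (a * A t)); last by ring.
    rewrite ler_pM2l ?expR_gt0//; apply: ler_pM => //; last exact: BA.
      by rewrite mulr_ge0 ?(ltW b0) ?(ltW (E0 _)).
    exact/ltW/B0.
  (* The concavity inequality is linear in [Th], so it is inherited from the kernels by
     integration. *)
  - move=> x y z x1x xy yz zx2.
    have iK c u : mu.-integrable `]0, 1[ (EFin \o (fun t => c * time_kernel 1 (expR u) t)).
      apply: (@integrableZl _ _ _ mu _ _ _ (EFin \o time_kernel 1 (expR u))) => //.
      exact: time_kernel_integrable.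
    have cK c u : {in `]0, 1[, continuous (fun t => c * time_kernel 1 (expR u) t)}.
      by move=> t t01; apply: cvgMr; exact: continuous_time_kernel.
    have iKE c u : c * Th u = \int[mu]_(t in `]0, 1[) (c * time_kernel 1 (expR u) t).
      by rewrite /Th T_integral// RintegralZl//; exact: time_kernel_integrable.
    rewrite !iKE -(RintegralD _ (iK _ _) (iK _ _))//; apply: (lt_Rintegral_oo ltr01).
    + by move=> t t01; apply: cvgD; exact: cK.
    + exact: cK.
    + exact: (integrableD _ (iK _ _) (iK _ _)).
    + exact: iK.
    move=> t; rewrite in_itv/= => /andP[t0 t1]; rewrite /time_kernel !NE.
    (* In the window [a <= b E <= a p / q]; with [q / p <= B / A <= 1] the two terms to be compared
       have ratio in [[q / p, p / q]], which gives [k = p / q]. This [k] is small enough: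
       [p / q < p = b + 2], and [b < b / a] because [a = 2 - q < 1]. *)
    apply: (@exp_sum_concave _ a b (A t) (B t) a0 b0 (A0 t t0 t1) (B0 t t0 t1) (p / q)) => //.
      have ab0 : 0 < a / b by rewrite divr_gt0.
      have : b < b / a by rewrite ltr_pdivlMr// gtr_pMr//; have := q1; rewrite /a; lra.
      have : p / q < p by rewrite ltr_pdivrMr// ltr_pMr//.
      by rewrite /b; lra.
    move=> c xc cz.
    have h1 : a <= E c * b.
      by rewrite -ler_pdivrMr// -/rho -E1 -leE; exact: le_trans xc.
    have h2 : E c * b <= a * (p / q).
      rewrite -ler_pdivlMr// mulrAC -/rho -E2 -leE; exact: le_trans zx2.
    rewrite expE (_ : b * _ = expR (- a * c) * (E c * b * B t)); last by ring.
    rewrite (_ : a * _ = expR (- a * c) * (a * A t)); last by ring.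
    rewrite !(mulrCA (p / q) (expR _)) !ler_pM2l ?expR_gt0//; split.
      rewrite (mulrCA (p / q)); apply: ler_pM (AB t t0 t1) => //; first exact: ltW.
      exact/ltW/A0.
    rewrite (mulrA (p / q)) (mulrC (p / q) a); apply: ler_pM (BA t t0 t1) => //.
      by rewrite mulr_ge0 ?(ltW b0) ?(ltW (E0 _)).
    exact/ltW/B0.
  - move=> x y x2x xy; apply: lt_T => // t t0 t1; rewrite !NE.
    apply: exp_sum_incr => //; [exact: A0|exact: B0|].
    move: x2x; rewrite leE E2 /rho mulrAC ler_pdivrMr// => h.
    rewrite expE (_ : b * _ = expR (- a * x) * (E x * b * B t)); last by ring.
    rewrite (_ : a * _ = expR (- a * x) * (a * A t)); last by ring.
    rewrite ler_pM2l ?expR_gt0//.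
    apply: (@le_trans _ _ (a * (p / q) * B t)).
      by rewrite -mulrA ler_pM2l//; exact: AB.
    by rewrite ler_pM2r//; exact: B0.
exists (expR m); split; first exact: expR_gt0.
- move=> x y x0 xy ym; have y0 : 0 < y by exact: lt_trans xy.
  have := incr (ln x) (ln y); rewrite /Th !lnK//; apply.
    by rewrite ltr_ln.
  by rewrite -[leRHS]expRK ler_ln// posrE expR_gt0.
- move=> x y mx xy; have x0 : 0 < x by apply: lt_le_trans mx; exact: expR_gt0.
  have y0 : 0 < y by exact: lt_trans xy.
  have := decr (ln x) (ln y); rewrite /Th !lnK//; apply; last by rewrite ltr_ln.
  by rewrite -[leLHS]expRK ler_ln// posrE expR_gt0.
Qed.

(** * The peak of the time map for positive lambda *)

Definition unimodal_at lam m := [/\ 0 < m,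
  {in `]0, m] &, {homo T p q lam : x y / x < y}} &
  {in `[m, +oo[ &, {homo T p q lam : x y /~ x < y}}].

Lemma unimodal_at_max lam m al : unimodal_at lam m -> 0 < al ->
  T p q lam al <= T p q lam m.
Proof.
move=> [m0 incr decr] al0; have [am|ma|->//] := ltgtP al m.
  by apply/ltW/incr; rewrite ?in_itv/= ?al0 ?m0 ?(ltW am) ?lexx.
by apply/ltW/decr; rewrite ?in_itv/= ?lexx ?(ltW ma).
Qed.

Lemma T_scaling1 lam al : 0 < lam -> 0 < al ->
  T p q lam al = (Num.sqrt ((lam `^ (p - q)^-1) `^ (p - 2)))^-1 *
                 T p q 1 (al / lam `^ (p - q)^-1).
Proof.
move=> lam0 al0; set k := lam `^ (p - q)^-1.
have k0 : 0 < k by rewrite powR_gt0.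
have adm : admissible 1 (al / k) by apply: admissible_gt0; rewrite ?divr_gt0.
have [_] := T_scaling k0 adm.
have -> : k * (al / k) = al by rewrite mulrC divfK// gt_eqF.
by have -> : 1 * k `^ (p - q) = lam by rewrite mul1r; exact: powR_root.
Qed.

Lemma unimodal_at_exists lam : 0 < lam -> exists m, unimodal_at lam m.
Proof.
move=> lam0; have [m [m0 incr decr]] := T_unimodal1.
pose k := lam `^ (p - q)^-1.
have k0 : 0 < k by rewrite powR_gt0.
have c0 : 0 < (Num.sqrt (k `^ (p - 2)))^-1 by rewrite invr_gt0 sqrtr_gt0 powR_gt0.
exists (m * k); split; first exact: mulr_gt0.
- move=> x y; rewrite !in_itv/= => /andP[x0 _] /andP[y0 ym] xy.
  rewrite (T_scaling1 lam0 x0) (T_scaling1 lam0 y0) -/k ltr_pM2l//; apply: incr.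
  + exact: divr_gt0.
  + by rewrite ltr_pM2r ?invr_gt0.
  + by rewrite ler_pdivrMr.
- move=> x y; rewrite !in_itv/= !andbT => mx my xy.
  have mk0 : 0 < m * k by exact: mulr_gt0.
  have x0 := lt_le_trans mk0 mx; have y0 := lt_le_trans mk0 my.
  rewrite (T_scaling1 lam0 x0) (T_scaling1 lam0 y0) -/k ltr_pM2l//; apply: decr.
  + by rewrite ler_pdivlMr.
  + by rewrite ltr_pM2r ?invr_gt0.
Qed.

Lemma alpha_peakP lam : 0 < lam -> unimodal_at lam (alpha_peak p q lam).
Proof. by move=> /unimodal_at_exists; exact: xgetPex. Qed.

(** Each of the two peak amplitudes, rescaled by [k], competes with the other one, which gives both
    inequalities. *)
Lemma peak_value lam : 0 < lam ->
  T p q lam (alpha_peak p q lam) =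
  (Num.sqrt ((lam `^ (p - q)^-1) `^ (p - 2)))^-1 * T p q 1 (alpha_peak p q 1).
Proof.
move=> lam0; set k := lam `^ (p - q)^-1.
have k0 : 0 < k by rewrite powR_gt0.
have P := alpha_peakP lam0; have P1 := alpha_peakP (@ltr01 R).
set c := (Num.sqrt (k `^ (p - 2)))^-1.
have c0 : 0 < c by rewrite invr_gt0 sqrtr_gt0 powR_gt0.
have [m0 _ _] := P; have [m10 _ _] := P1.
apply: le_anti; apply/andP; split.
  rewrite (T_scaling1 lam0 m0) -/k -/c (ler_pM2l c0).
  exact: unimodal_at_max P1 (divr_gt0 m0 k0).
have mk0 : 0 < alpha_peak p q 1 * k by exact: mulr_gt0.
have := T_scaling1 lam0 mk0; rewrite -/k -/c mulfK ?lt0r_neq0// => <-.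
exact: unimodal_at_max P mk0.
Qed.

(** At the peak amplitude for [lam'], lowering the parameter to [lam] lowers the reduced energy and
    raises [T]; the peak value for [lam] is at least that large. *)
Lemma peak_value_decr lam lam' : 0 < lam -> lam < lam' ->
  T p q lam' (alpha_peak p q lam') < T p q lam (alpha_peak p q lam).
Proof.
move=> lam0 ll; have lam'0 : 0 < lam' by exact: lt_trans ll.
have [m0 _ _] := alpha_peakP lam'0.
apply: lt_le_trans (unimodal_at_max (alpha_peakP lam0) m0).
apply: lt_T; [by apply: admissible_gt0 => //; exact: ltW..|].
move=> t t0 t1; rewrite /reduced_energy ltrD2r.
rewrite -!mulrA ltr_pM2r// ?mulr_gt0 ?invr_gt0 ?powR_gt0//.
by rewrite subr_gt0 powR_lt1.
Qed.

Lemma peak_value_gt0 lam : 0 < lam -> 0 < T p q lam (alpha_peak p q lam).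
Proof.
move=> lam0; have [m0 _ _] := alpha_peakP lam0.
by apply: T_gt0; apply: admissible_gt0 => //; exact: ltW.
Qed.

(** [L] solves [L^((p - 2) / (p - q)) = (M / t)^2]. With [M] the peak value at [lambda = 1], this
    produces [Lambda]. *)
Lemma scaling_factor_exists M t : 0 < M -> 0 < t -> exists2 L, 0 < L &
  (Num.sqrt ((L `^ (p - q)^-1) `^ (p - 2)))^-1 * M = t.
Proof.
move=> M0 t0; pose y := (M / t) ^+ 2.
have Mt0 : 0 < M / t by exact: divr_gt0.
have y0 : 0 < y by rewrite exprn_gt0.
have p20 : 0 < p - 2 by rewrite subr_gt0.
exists ((y `^ (p - 2)^-1) `^ (p - q)); first by rewrite !powR_gt0.
rewrite -[X in X `^ (p - 2)]powRrM mulfV ?gt_eqF// powRr1 ?powR_ge0//.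
rewrite (powR_root y0 p20) sqrtr_sqr (gtr0_norm Mt0).
by rewrite invf_div divfK// gt_eqF.
Qed.

(** * Amplitudes whose half-period is 1 / (2j + 2) *)

Section nodes.
Variable j : nat.
Let tau : R := (2 * j + 2)%:R^-1.

Let tau0 : 0 < tau. Proof. by rewrite invr_gt0 ltr0n addn2. Qed.

Lemma LambdaP : 0 < Lambda p q j /\
  T p q (Lambda p q j) (alpha_peak p q (Lambda p q j)) = tau.
Proof.
suff h : exists L : R, 0 < L /\ T p q L (alpha_peak p q L) = tau.
  exact: (xgetPex 0 h).
have [L L0 LE] := scaling_factor_exists (peak_value_gt0 ltr01) tau0.
by exists L; split; [exact: L0|exact: (etrans (peak_value L0) LE)].
Qed.

Lemma tau_le_peak lam : 0 < lam ->
  (tau <= T p q lam (alpha_peak p q lam)) = (lam <= Lambda p q j).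
Proof.
move=> lam0; have [L0 LE] := LambdaP.
have [lt|lt|->] := ltgtP lam (Lambda p q j).
- by apply: ltW; have := peak_value_decr lam0 lt; rewrite LE.
- by apply/negbTE; rewrite -ltNge; have := peak_value_decr L0 lt; rewrite LE.
- by rewrite LE lexx.
Qed.

Let sqrt_inv_lt c y : 0 <= c -> (c / tau) ^+ 2 < y -> (Num.sqrt y)^-1 * c < tau.
Proof.
move=> c0 h; have y0 : 0 < y by apply: le_lt_trans h; rewrite sqr_ge0.
rewrite mulrC ltr_pdivrMr ?sqrtr_gt0// -ltr_pdivrMl// mulrC.
have ct0 : 0 <= c / tau by rewrite divr_ge0// ltW.
by rewrite -(ger0_norm ct0) -sqrtr_sqr ltr_sqrt.
Qed.

Lemma T_lt_tau_large lam : exists2 M, 0 < M &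
  forall al, M <= al -> admissible lam al -> T p q lam al < tau.
Proof.
(* [y] exceeds the value at which [kernel_mass / sqrt y] equals [tau], and the threshold for [al]
   makes [al^(p - 2) / p >= y]; the factor 2 in [T_le_large] is given away. *)
pose y := (kernel_mass / tau) ^+ 2 + 1.
have y0 : 0 < y by rewrite ltr_wpDl// sqr_ge0.
have p20 : 0 < p - 2 by rewrite subr_gt0.
exists ((y * p) `^ (p - 2)^-1) => [|al Mal adm]; first by rewrite powR_gt0// mulr_gt0.
apply: le_lt_trans (T_le_large adm) _; apply: sqrt_inv_lt; first exact: kernel_mass_ge0.
have : y * p <= al `^ (p - 2).
  rewrite -[leLHS](powR_root _ p20) ?mulr_gt0//.
  by apply: ge0_ler_powR; rewrite ?nnegrE ?powR_ge0 ?(ltW p20)//; case: adm => /ltW.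
rewrite -ler_pdivlMr// => h.
apply: (@lt_le_trans _ _ y); first by rewrite ltrDl.
by apply: le_trans h _; rewrite ler_peMl ?divr_ge0 ?powR_ge0 ?(ltW p0) ?ler1n.
Qed.

Lemma T_lt_tau_small lam : 0 < lam -> exists2 m, 0 < m &
  forall al, 0 < al -> al <= m -> T p q lam al < tau.
Proof.
move=> lam0.
pose y := (kernel_mass / tau) ^+ 2 + 1.
have y0 : 0 < y by rewrite ltr_wpDl// sqr_ge0.
have q20 : 0 < 2 - q by rewrite subr_gt0.
exists ((lam / (y * p)) `^ (2 - q)^-1) => [|al al0 alm].
  by rewrite powR_gt0// divr_gt0// mulr_gt0.
apply: le_lt_trans (T_le_small lam0 al0) _; apply: sqrt_inv_lt; first exact: kernel_mass_ge0.
have : al `^ (2 - q) <= lam / (y * p).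
  rewrite -[leRHS](powR_root _ q20) ?divr_gt0 ?mulr_gt0//.
  by apply: ge0_ler_powR; rewrite ?nnegrE ?powR_ge0 ?(ltW q20) ?(ltW al0).
have P0 : 0 < al `^ (2 - q) by rewrite powR_gt0.
rewrite -[q - 2]opprB powRN ler_pdivlMr ?mulr_gt0// => h.
apply: (@lt_le_trans _ _ y); first by rewrite ltrDl.
have : y <= lam / al `^ (2 - q) / p.
  by rewrite ler_pdivlMr// ler_pdivlMr// mulrC.
move=> /le_trans; apply; rewrite ler_peMl ?ler1n//.
by rewrite !divr_ge0 ?(ltW lam0) ?(ltW p0) ?(ltW P0).
Qed.

Let T_IVT lam u v : 0 < u -> (forall al, u <= al -> admissible lam al) -> u < v ->
  T p q lam u <= tau /\ tau <= T p q lam v \/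
    T p q lam v <= tau /\ tau <= T p q lam u ->
  exists2 al, u <= al <= v & T p q lam al = tau.
Proof.
move=> u0 adm uv h0.
exact: IVT_crossing (ltW uv) (T_continuous uv u0 adm) h0.
Qed.

Lemma alpha_underP lam : 0 < lam -> lam <= Lambda p q j ->
  alpha_under p q j lam \in `]0, alpha_peak p q lam] /\
  T p q lam (alpha_under p q j lam) = tau.
Proof.
move=> lam0 lamL; have [m0 incr _] := alpha_peakP lam0.
suff h : exists al, al \in `]0, alpha_peak p q lam] /\ T p q lam al = tau.
  exact: (xgetPex 0 h).
have [e e0 he] := T_lt_tau_small lam0.
have Tm : tau <= T p q lam (alpha_peak p q lam) by rewrite tau_le_peak.
pose u := Num.min e (alpha_peak p q lam / 2).
have u0 : 0 < u by rewrite lt_min e0 divr_gt0.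
have ue : u <= e by rewrite ge_min lexx.
have um : u < alpha_peak p q lam.
  by rewrite gt_min; apply/orP; right; move: m0; lra.
have Tu := ltW (he u u0 ue).
have adm al : u <= al -> admissible lam al.
  by move=> u_al; apply: admissible_gt0; [exact: ltW|exact: lt_le_trans u_al].
have [|al /andP[h1 h2] E] := T_IVT u0 adm um.
  by left.
by exists al; rewrite in_itv/= h2 (lt_le_trans u0).
Qed.

Lemma alpha_under_unique lam al : 0 < lam -> lam <= Lambda p q j ->
  al \in `]0, alpha_peak p q lam] -> T p q lam al = tau ->
  al = alpha_under p q j lam.
Proof.
move=> lam0 lamL alm E; have [ulm Eu] := alpha_underP lam0 lamL.
have [_ incr _] := alpha_peakP lam0.
have [lt|lt|//] := ltgtP al (alpha_under p q j lam).
- by have := incr _ _ alm ulm lt; rewrite E Eu ltxx.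
- by have := incr _ _ ulm alm lt; rewrite E Eu ltxx.
Qed.

Let alpha_over_posP lam : 0 < lam -> lam <= Lambda p q j ->
  alpha_over p q j lam \in `[alpha_peak p q lam, +oo[ /\
  T p q lam (alpha_over p q j lam) = tau.
Proof.
move=> lam0 lamL; have [m0 _ decr] := alpha_peakP lam0.
suff h : exists al, al \in `[alpha_peak p q lam, +oo[ /\ T p q lam al = tau.
  by rewrite /alpha_over lam0; exact: (xgetPex 0 h).
have [M M0 hM] := T_lt_tau_large lam.
have Tm : tau <= T p q lam (alpha_peak p q lam) by rewrite tau_le_peak.
pose v := Num.max M (alpha_peak p q lam + 1).
have Mv : M <= v by rewrite le_max lexx.
have mv : alpha_peak p q lam < v.
  by rewrite lt_max; apply/orP; right; rewrite ltrDl.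
have Tv := ltW (hM v Mv (admissible_gt0 (ltW lam0) (lt_trans m0 mv))).
have adm al : alpha_peak p q lam <= al -> admissible lam al.
  by move=> m_al; apply: admissible_gt0; [exact: ltW|exact: lt_le_trans m_al].
have [|al /andP[h1 h2] E] := T_IVT m0 adm mv.
  by right.
by exists al; rewrite in_itv/= h1.
Qed.

Lemma alpha_min_powR lam : alpha_min p q lam `^ (p - q) = p * `|lam| / q.
Proof.
rewrite /alpha_min -powRrM mulVf ?gt_eqF// powRr1//.
by rewrite !mulr_ge0// ?invr_ge0 ltW.
Qed.

Lemma admissible_min lam al : lam <= 0 -> 0 < al ->
  (alpha_min p q lam <= al) <-> admissible lam al.
Proof.
move=> lam0 al0; have E : p * `|lam| / q / p = - (lam / q).
  by rewrite ler0_norm//; field; rewrite !gt_eqF.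
have iff : (0 <= lam / q + al `^ (p - q) / p) = (p * `|lam| / q <= al `^ (p - q)).
  have p10 : 0 < p^-1 by rewrite invr_gt0.
  by rewrite -[RHS](ler_pM2r p10) E; apply/idP/idP; lra.
split=> [h|[_ +]].
  split=> //; rewrite iff -alpha_min_powR.
  by apply: ge0_ler_powR; rewrite ?nnegrE ?powR_ge0 ?(ltW pq0) ?(ltW al0).
rewrite iff -alpha_min_powR => h; rewrite leNgt; apply/negP => lt.
have : al `^ (p - q) < alpha_min p q lam `^ (p - q).
  by apply: gt0_ltr_powR => //; rewrite nnegrE ?powR_ge0 ?(ltW al0).
by rewrite ltNge h.
Qed.

Lemma alpha_min_gt0 lam : lam < 0 -> 0 < alpha_min p q lam.
Proof.
by move=> lam0; rewrite powR_gt0// divr_gt0// mulr_gt0// normr_gt0 lt_eqF.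
Qed.

Lemma alpha_min_critical lam : lam < 0 ->
  lam / q + alpha_min p q lam `^ (p - q) / p = 0.
Proof.
by move=> lam0; rewrite alpha_min_powR ltr0_norm//; field; rewrite !gt_eqF.
Qed.

Lemma admissible_alpha_min lam : lam < 0 -> admissible lam (alpha_min p q lam).
Proof.
move=> lam0; apply/admissible_min; [exact: ltW|exact: alpha_min_gt0|exact: lexx].
Qed.

Lemma T_alpha_min lam : lam < 0 -> T p q lam (alpha_min p q lam) =
  (Num.sqrt (2 * (alpha_min p q lam `^ (p - 2) / p)))^-1 * kernel_mass.
Proof.
move=> lam0; apply: T_critical; [exact: alpha_min_gt0|exact: alpha_min_critical].
Qed.

(** Read off from the positivity of [T] at a critical amplitude; [-1] is an arbitrary negative
    parameter. *)
Lemma kernel_mass_gt0 : 0 < kernel_mass.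
Proof.
have l0 : (- 1 : R) < 0 by rewrite ltrN10.
have := T_gt0 (admissible_alpha_min l0); rewrite T_alpha_min// pmulr_rgt0//.
by rewrite invr_gt0 sqrtr_gt0 mulr_gt0// divr_gt0// powR_gt0// alpha_min_gt0.
Qed.

(** [alpha_min] increases with [|lam|], and [T] at [alpha_min] is proportional to
    [alpha_min^(-(p - 2) / 2)]. *)
Lemma T_alpha_min_incr lam lam' : lam < lam' -> lam' < 0 ->
  T p q lam (alpha_min p q lam) < T p q lam' (alpha_min p q lam').
Proof.
move=> ll lam'0; have lam0 : lam < 0 by exact: lt_trans lam'0.
have m0 := alpha_min_gt0 lam0; have m'0 := alpha_min_gt0 lam'0.
have pos al : 0 < al -> 0 < 2 * (al `^ (p - 2) / p).
  by move=> al0; rewrite mulr_gt0// divr_gt0// powR_gt0.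
rewrite (T_alpha_min lam0) (T_alpha_min lam'0) (ltr_pM2r kernel_mass_gt0).
rewrite ltf_pV2 ?posrE ?sqrtr_gt0 ?pos// ltr_sqrt ?pos// ltr_pM2l// ltr_pM2r ?invr_gt0//.
apply: gt0_ltr_powR; rewrite ?subr_gt0 ?nnegrE ?(ltW m0) ?(ltW m'0)//.
apply: gt0_ltr_powR; rewrite ?invr_gt0 ?nnegrE//.
- by rewrite !mulr_ge0 ?invr_ge0 ?(ltW p0) ?(ltW q0).
- by rewrite !mulr_ge0 ?invr_ge0 ?(ltW p0) ?(ltW q0).
by rewrite ltr_pM2r ?invr_gt0// ltr_pM2l// !ltr0_norm// ltrN2.
Qed.

Lemma lambda_star_lt0 : lambda_star p q j < 0.
Proof.
rewrite oppr_lt0 mulr_gt0 ?powR_gt0 ?ltr0n//.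
by rewrite mulr_gt0 ?kernel_mass_gt0// mulr_gt0 ?powR_gt0 ?divr_gt0// sqrtr_gt0 mulr_gt0.
Qed.

(** [lambda_star] is the explicit solution of this equation: by [T_alpha_min] it reads [alpha_min^(p
    - 2) = 2 p (kernel_mass (j + 1))^2], and solving for [|lambda|] gives the exponent
    [2 (p - q) / (p - 2)]. *)
Lemma T_alpha_min_star :
  T p q (lambda_star p q j) (alpha_min p q (lambda_star p q j)) = tau.
Proof.
have l0 := lambda_star_lt0; rewrite T_alpha_min//.
have p20 : 0 < p - 2 by rewrite subr_gt0.
pose D := Num.sqrt (2 * q) * (p / q) `^ ((2 - q) / (2 * (p - q))).
have D0 : 0 < D by rewrite mulr_gt0 ?powR_gt0 ?divr_gt0// sqrtr_gt0 mulr_gt0.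
have J0 := kernel_mass_gt0.
have j0 : 0 < j.+1%:R :> R by rewrite ltr0n.
have pq : 0 < p / q by rewrite divr_gt0.
have normE : `|lambda_star p q j| = (D * kernel_mass * j.+1%:R) `^ (2 * (p - q) / (p - 2)).
  by rewrite (ltr0_norm l0) opprK -powRM// mulr_ge0// ltW.
have E : alpha_min p q (lambda_star p q j) `^ (p - 2) =
    2 * p * (kernel_mass * j.+1%:R) ^+ 2.
  rewrite /alpha_min -powRrM normE mulrAC powRM ?powR_ge0 ?(ltW pq)//.
  rewrite -[X in _ * X]powRrM.
  have -> : 2 * (p - q) / (p - 2) * ((p - q)^-1 * (p - 2)) = 2%:R.
    by field; rewrite !gt_eqF.
  rewrite powR_mulrn; last by apply/ltW/mulr_gt0 => //; exact: mulr_gt0.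
  (* The exponent in [D] is such that this power of [p / q], times the one coming from [alpha_min],
     is [p / q] itself. *)
  have DE : D ^+ 2 = 2 * q * (p / q) `^ ((2 - q) / (p - q)).
    rewrite exprMn sqr_sqrtr ?mulr_ge0 ?(ltW q0)//; congr (_ * _).
    rewrite -powR_mulrn ?powR_ge0// -powRrM; congr (_ `^ _).
    by field; rewrite !gt_eqF.
  rewrite -mulrA exprMn DE mulrA (mulrCA _ (2 * q)) -powRD ?(gt_eqF pq) ?implybT//.
  have -> : (p - q)^-1 * (p - 2) + (2 - q) / (p - q) = 1.
    by field; rewrite !gt_eqF.
  by rewrite powRr1 ?(ltW pq)//; field; rewrite gt_eqF.
rewrite E.
have -> : 2 * (2 * p * (kernel_mass * j.+1%:R) ^+ 2 / p) =
   (2 * (kernel_mass * j.+1%:R)) ^+ 2 by field; rewrite gt_eqF.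
rewrite sqrtr_sqr ger0_norm; last by rewrite !mulr_ge0 ?(ltW J0) ?(ltW j0).
have -> : tau = (2 * j.+1%:R)^-1.
  by rewrite /tau -natrM mulnS addnC.
by field; rewrite !gt_eqF.
Qed.

Lemma tau_le_T_alpha_min lam : lam < 0 ->
  (tau <= T p q lam (alpha_min p q lam)) = (lambda_star p q j <= lam).
Proof.
move=> lam0; rewrite -T_alpha_min_star.
have [lt|lt|->] := ltgtP (lambda_star p q j) lam.
- by apply: ltW; exact: T_alpha_min_incr.
- by apply/negbTE; rewrite -ltNge; apply: T_alpha_min_incr => //; exact: lambda_star_lt0.
- by rewrite lexx.
Qed.

Let alpha_over_negP lam : lambda_star p q j <= lam -> lam <= 0 ->
  admissible lam (alpha_over p q j lam) /\
  T p q lam (alpha_over p q j lam) = tau.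
Proof.
move=> slam lam0.
suff h : exists al, [/\ 0 < al, alpha_min p q lam <= al & T p q lam al = tau].
  rewrite /alpha_over ltNge lam0/=.
  by have [] := xgetPex 0 h => h1 /(admissible_min lam0 h1).
(* At [lam = 0] the number [alpha_min] is 0 and cannot start the intermediate value argument; there
   [T] is a pure power of the amplitude, and the equation is solved by scaling from amplitude 1. *)
move: lam0; rewrite le_eqVlt => /predU1P[->|lam0].
  have T10 : 0 < T p q 0 1 by apply: T_gt0; exact: admissible_gt0.
  pose y := (T p q 0 1 / tau) ^+ 2.
  have y0 : 0 < y by rewrite exprn_gt0// divr_gt0.
  have p20 : 0 < p - 2 by rewrite subr_gt0.
  have k0 : 0 < y `^ (p - 2)^-1 by rewrite powR_gt0.
  exists (y `^ (p - 2)^-1); split=> //.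
    rewrite /alpha_min normr0 mulr0 mul0r powR0 ?ltW//.
    by rewrite invr_eq0 gt_eqF.
  have [_] := T_scaling k0 (admissible_gt0 (lexx 0) ltr01).
  rewrite mul0r mulr1 => ->.
  rewrite (powR_root y0 p20) /y sqrtr_sqr gtr0_norm ?divr_gt0//.
  by rewrite invf_div divfK// gt_eqF.
have m0 := alpha_min_gt0 lam0.
have [M M0 hM] := T_lt_tau_large lam.
have Tm : tau <= T p q lam (alpha_min p q lam) by rewrite tau_le_T_alpha_min.
pose v := Num.max M (alpha_min p q lam + 1).
have Mv : M <= v by rewrite le_max lexx.
have mv : alpha_min p q lam < v.
  by rewrite lt_max; apply/orP; right; rewrite ltrDl.
have adm al : alpha_min p q lam <= al -> admissible lam al.
  by move=> h; apply/admissible_min => //; [exact: ltW|exact: lt_le_trans h].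
have Tv := ltW (hM v Mv (adm _ (ltW mv))).
have [|al /andP[h1 h2] E] := T_IVT m0 adm mv.
  by right.
by exists al; split=> //; exact: lt_le_trans h1.
Qed.

Lemma alpha_overP lam : lambda_star p q j <= lam -> lam <= Lambda p q j ->
  admissible lam (alpha_over p q j lam) /\
  T p q lam (alpha_over p q j lam) = tau.
Proof.
move=> slam lamL; have [lam0|lam0] := leP lam 0; first exact: alpha_over_negP.
have [+ E] := alpha_over_posP lam0 lamL; rewrite in_itv/= andbT => h.
have [m0 _ _] := alpha_peakP lam0; split=> //.
by apply: admissible_gt0; [exact: ltW|exact: lt_le_trans h].
Qed.

(** Strict monotonicity of [T] on each branch identifies every root with the one chosen by [xget].
    At [lam = Lambda] the branches meet at the peak and the root is attributed to [alpha_under],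
    whence the strict inequality in the second case. *)
Lemma T_eq_tau_cases lam al : admissible lam al -> T p q lam al = tau ->
  [/\ 0 < lam, lam <= Lambda p q j & al = alpha_under p q j lam] \/
  [/\ lambda_star p q j <= lam, lam < Lambda p q j & al = alpha_over p q j lam].
Proof.
move=> adm E; have [al0 _] := adm.
have [lam0|lam0] := leP lam 0.
  have slam : lambda_star p q j <= lam.
    move: lam0; rewrite le_eqVlt => /predU1P[->|lam0]; first exact/ltW/lambda_star_lt0.
    rewrite -tau_le_T_alpha_min// -E.
    have /(admissible_min (ltW lam0) al0) := adm.
    rewrite le_eqVlt => /predU1P[->//|lt]; apply: ltW.
    by have [] := T_decreasing (ltW lam0) (admissible_alpha_min lam0) lt.
  right; split=> //; first by apply: le_lt_trans lam0 _; have [] := LambdaP.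
  have [adm' E'] := alpha_over_negP slam lam0.
  have [lt|lt|//] := ltgtP al (alpha_over p q j lam).
  - by have [_] := T_decreasing lam0 adm lt; rewrite E E' ltxx.
  - by have [_] := T_decreasing lam0 adm' lt; rewrite E E' ltxx.
have P := alpha_peakP lam0; have [m0 incr decr] := P.
have lamL : lam <= Lambda p q j.
  by rewrite -tau_le_peak// -E; exact: unimodal_at_max.
have [alm|mal] := leP al (alpha_peak p q lam).
  left; split=> //; apply: alpha_under_unique => //.
  by rewrite in_itv/= al0.
have mem : al \in `[alpha_peak p q lam, +oo[ by rewrite in_itv/= ltW.
right; split.
- by apply: ltW (lt_trans lambda_star_lt0 lam0).
- rewrite lt_neqAle lamL andbT; apply/eqP => lE.
  have mm : alpha_peak p q lam \in `[alpha_peak p q lam, +oo[ by rewrite in_itv/= lexx.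
  have := decr _ _ mem mm mal; rewrite E.
  by have [_] := LambdaP; rewrite -lE => ->; rewrite ltxx.
have [mem' E'] := alpha_over_posP lam0 lamL.
have [lt|lt|//] := ltgtP al (alpha_over p q j lam).
- by have := decr _ _ mem' mem lt; rewrite E E' ltxx.
- by have := decr _ _ mem mem' lt; rewrite E E' ltxx.
Qed.

End nodes.

(** * Profiles and nodal arcs *)

Definition nonlinearity lam z :=
  lam * (`|z| `^ (q - 2) * z) + `|z| `^ (p - 2) * z.

Lemma G_is_derive lam (z : R) : is_derive z 1 (G p q lam) (nonlinearity lam z).
Proof.
have p1 : 1 < p by exact: lt_trans qp.
apply: is_derive_val_eq (is_derive_add
  (is_derive_scale (lam / q) (is_derive_norm_powR z q1))
  (is_derive_scale p^-1 (is_derive_norm_powR z p1))).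
by rewrite /nonlinearity; field; rewrite !gt_eqF.
Qed.

Lemma continuous_nonlinearity lam : continuous (nonlinearity lam).
Proof.
have p1 : 1 < p by exact: lt_trans qp.
move=> z; apply: (@continuousD R R R (fun z => lam * (`|z| `^ (q - 2) * z))
  (fun z => `|z| `^ (p - 2) * z)).
  by apply: cvgMr; exact: continuous_norm_powR_pred.
exact: continuous_norm_powR_pred.
Qed.

Lemma nonlinearityN lam z : nonlinearity lam (- z) = - nonlinearity lam z.
Proof. by rewrite /nonlinearity normrN; ring. Qed.

Lemma GN lam z : G p q lam (- z) = G p q lam z.
Proof. by rewrite /G normrN. Qed.

Lemma G0 lam : G p q lam 0 = 0.
Proof. by rewrite /G normr0 !powR0 ?gt_eqF// !mulr0 addr0. Qed.

Lemma G_factor lam al : 0 < al ->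
  G p q lam al = al `^ q * (lam / q + al `^ (p - q) / p).
Proof.
move=> al0; rewrite /G gtr0_norm//.
by have := powR_split 0 al0; rewrite !subr0 => ->; ring.
Qed.

Lemma admissible_G lam al : 0 < al -> 0 <= G p q lam al -> admissible lam al.
Proof.
by move=> al0; rewrite G_factor// pmulr_rge0 ?powR_gt0.
Qed.

Lemma G_admissible lam al : admissible lam al -> 0 <= G p q lam al.
Proof. by move=> [al0 h]; rewrite G_factor// mulr_ge0 ?powR_ge0. Qed.

(** For [lam < 0], [G] first decreases, so it is not monotone on []0, al[]; the inequality is the
    positivity of the reduced energy, which rests on [G(al) >= 0]. *)
Lemma G_lt lam al s : admissible lam al -> 0 < s -> s < al ->
  G p q lam s < G p q lam al.
Proof.
move=> adm s0 sal; have al0 : 0 < al by case: adm.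
have sE : s = al * (s / al) by rewrite mulrCA divff ?mulr1// gt_eqF.
rewrite -subr_gt0 sE G_reduced_energy ?divr_ge0 ?(ltW s0) ?(ltW al0)//.
rewrite mulr_gt0 ?exprn_gt0//; apply: reduced_energy_gt0 => //; first exact: divr_gt0.
by rewrite ltr_pdivrMr// mul1r.
Qed.

(** Admissibility gives [lam + (q / p) al^(p - q) >= 0], and [q < p] then makes [lam + al^(p - q)]
    positive. *)
Lemma nonlinearity_gt0 lam al : admissible lam al -> 0 < nonlinearity lam al.
Proof.
move=> [al0 h]; rewrite /nonlinearity gtr0_norm// (powR_split 2)//.
rewrite (_ : _ + _ = al `^ (q - 2) * al * (lam + al `^ (p - q))); last by ring.
rewrite mulr_gt0 ?mulr_gt0 ?powR_gt0//.
have a0 : 0 < al `^ (p - q) by rewrite powR_gt0.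
have : 0 <= q * (lam / q + al `^ (p - q) / p) by rewrite mulr_ge0 ?(ltW q0).
rewrite (_ : q * _ = lam + q / p * al `^ (p - q)); last by field; rewrite !gt_eqF.
have : q / p * al `^ (p - q) < al `^ (p - q).
  by rewrite gtr_pMl// ltr_pdivrMr// mul1r.
by lra.
Qed.

(** * The profile w and its first two derivatives *)

Section profile.
Variables (lam al : R).
Hypothesis adm : admissible lam al.
Let al0 : 0 < al. Proof. by case: adm. Qed.
Let ph := phi p q al lam.
Let Tal := T p q lam al.
Let speed s := Num.sqrt (2 * (G p q lam al - G p q lam s)).

Let speed_gt0 s : 0 < s -> s < al -> 0 < speed s.
Proof. by move=> s0 sal; rewrite sqrtr_gt0 mulr_gt0// subr_gt0 G_lt. Qed.

Let continuous_speed : continuous speed.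
Proof.
move=> s; apply: (@continuous_comp R R R (fun s => 2 * (G p q lam al - G p q lam s)) Num.sqrt).
  apply: cvgMr; apply: cvgB; first exact: cvg_cst.
  exact: is_derive_continuous (G_is_derive lam s).
exact: sqrt_continuous.
Qed.

Lemma phi_continuous : {within `[0, al], continuous ph}.
Proof. exact: (primitive_continuous al0 (phi_kernel_integrable adm)). Qed.

Lemma phi_is_derive (s : R) : s \in `]0, al[ -> is_derive s 1 ph (speed s)^-1.
Proof.
apply: (primitive_is_derive (f := fun s => (speed s)^-1)); last exact: phi_kernel_integrable.
move=> t; rewrite in_itv/= => /andP[t0 tal].
apply: (@continuousV _ _ speed); last exact: continuous_speed.
by rewrite gt_eqF// speed_gt0.
Qed.

Lemma phi0 : ph 0 = 0.
Proof. exact: Rintegral_oo_diag. Qed.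

Lemma phi_incr : {in `[0, al] &, {homo ph : x y / x < y}}.
Proof.
apply: (@gtr0_derive1_lt_cc _ ph 0 al).
- by move=> x /phi_is_derive[].
- move=> x xal; rewrite derive1E; have [_ ->] := phi_is_derive xal.
  by move: xal; rewrite in_itv/= => /andP[x0 x1]; rewrite invr_gt0 speed_gt0.
- exact: phi_continuous.
Qed.

Lemma phi_inj : {in `[0, al] &, injective ph}.
Proof.
move=> x y xal yal E; have [lt|lt|//] := ltgtP x y.
- by have := phi_incr xal yal lt; rewrite E ltxx.
- by have := phi_incr yal xal lt; rewrite E ltxx.
Qed.

Lemma phiK : {in `[0, al], cancel ph (phi_inv p q al lam)}.
Proof.
move=> z zal; apply: (@pinvKV _ _ (fun=> 0) `[0, al]%classic ph).
  by move=> x y /[!inE]; exact: phi_inj.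
by rewrite inE.
Qed.

Lemma phi_inv_mem x : x \in `[0, Tal] ->
  phi_inv p q al lam x \in `[0, al] /\ ph (phi_inv p q al lam x) = x.
Proof.
rewrite in_itv/= => /andP[x0 xT].
have [|z zal zx] := IVT_crossing (v := x) (ltW al0) phi_continuous.
  by left; split; [rewrite phi0|exact: xT].
have zmem : z \in `[0, al] by rewrite in_itv.
by rewrite -zx phiK.
Qed.

Let T0 : 0 < Tal. Proof. exact: T_gt0. Qed.
Let zero_mem : 0 \in `[0, al]. Proof. by rewrite in_itv/= lexx ltW. Qed.
Let al_mem : al \in `[0, al]. Proof. by rewrite in_itv/= lexx ltW. Qed.

Lemma phi_inv0 : phi_inv p q al lam 0 = 0.
Proof. by have := phiK zero_mem; rewrite phi0. Qed.

Lemma phi_inv_T : phi_inv p q al lam Tal = al.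
Proof. exact: (phiK al_mem). Qed.

Lemma phi_inv_oo x : x \in `]0, Tal[ -> phi_inv p q al lam x \in `]0, al[.
Proof.
move=> xT; have [] := phi_inv_mem (subset_itv_oo_cc xT).
move: xT; rewrite !in_itv/= => /andP[x0 xT] /andP[z0 zal] E.
rewrite lt_neqAle [X in _ && X]lt_neqAle z0 zal !andbT; apply/andP; split.
  by apply/eqP => h; move: x0; rewrite -E -h phi0 ltxx.
by apply/eqP => h; move: xT; rewrite -E h ltxx.
Qed.

Lemma phi_inv_continuous : {within `[0, Tal], continuous (phi_inv p q al lam)}.
Proof.
by have := segment_can_le_continuous (ltW al0) phi_continuous phiK; rewrite phi0.
Qed.

Lemma phi_inv_is_derive (x : R) : x \in `]0, Tal[ ->
  is_derive x 1 (phi_inv p q al lam) (speed (phi_inv p q al lam x)).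
Proof.
move=> xT; have [_ E] := phi_inv_mem (subset_itv_oo_cc xT).
have zal := phi_inv_oo xT; set z := phi_inv p q al lam x in E zal *.
have sz : 0 < speed z.
  by move: zal; rewrite in_itv/= => /andP[z0 z1]; exact: speed_gt0.
rewrite -E -[speed z]invrK; apply: is_derive_inverse.
- near=> y; apply: phiK; apply: subset_itv_oo_cc.
  by near: y; exact: near_in_itvoo.
- near=> y; apply: is_derive_continuous (phi_is_derive _).
  by near: y; exact: near_in_itvoo.
- exact: phi_is_derive.
- by rewrite gt_eqF// invr_gt0.
Unshelve. all: by end_near. Qed.

(** [phi' = 1 / speed] blows up at [al], but the derivative [speed] of the inverse is continuous up
    to the ends, so [deriv_on_cc] applies. *)
Lemma phi_inv_deriv_on x : x \in `[0, Tal] ->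
  deriv_on `[0, Tal] (phi_inv p q al lam) x (speed (phi_inv p q al lam x)).
Proof.
apply: (deriv_on_cc phi_inv_continuous (g := fun x => speed (phi_inv p q al lam x))).
  exact: phi_inv_is_derive.
apply: (within_continuous_comp (B := setT) _ phi_inv_continuous) => //.
exact: continuous_subspaceT continuous_speed.
Qed.

(** The derivative of [speed] is [- nonlinearity / speed], and the chain rule multiplies by [speed]:
    the singular factor cancels and a function continuous up to the ends remains. *)
Lemma speed_phi_inv_deriv_on x : x \in `[0, Tal] ->
  deriv_on `[0, Tal] (fun x => speed (phi_inv p q al lam x)) x
    (- nonlinearity lam (phi_inv p q al lam x)).
Proof.
apply: (@deriv_on_cc _ 0 Tal (fun x => speed (phi_inv p q al lam x))
  (fun x => - nonlinearity lam (phi_inv p q al lam x))).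
- apply: (within_continuous_comp (B := setT) _ phi_inv_continuous) => //.
  exact: continuous_subspaceT continuous_speed.
- move=> y yT; have := phi_inv_oo yT; rewrite in_itv/= => /andP[z0 zal].
  have V0 : 0 < 2 * (G p q lam al - G p q lam (phi_inv p q al lam y)).
    by rewrite mulr_gt0// subr_gt0 G_lt.
  have dG := G_is_derive lam (phi_inv p q al lam y).
  have d0 : is_derive (phi_inv p q al lam y) 1 (fun s : R => G p q lam al - G p q lam s)
      (0 - nonlinearity lam (phi_inv p q al lam y)) by exact: is_derive_sub.
  have d1 := is_derive_scale 2 d0.
  have d2 := is_derive_comp
    (g := fun s => 2 * (G p q lam al - G p q lam s)) (is_derive1_sqrt V0) d1.
  apply: is_derive_val_eq (is_derive_comp (f := speed) d2 (phi_inv_is_derive yT)).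
  by rewrite /speed; field; rewrite gt_eqF// sqrtr_gt0.
- apply: (within_continuous_comp (B := setT) (f := fun z => - nonlinearity lam z)
    _ phi_inv_continuous) => //.
  apply: continuous_subspaceT => z; apply: cvgN; exact: continuous_nonlinearity.
Qed.

Let w_ := w p q al lam.

Lemma w_left x : x <= Tal -> w_ x = phi_inv p q al lam x.
Proof. by rewrite /w_ /w -/Tal => ->. Qed.

Lemma w_right x : Tal <= x -> w_ x = phi_inv p q al lam (2 * Tal - x).
Proof.
rewrite /w_ /w -/Tal le_eqVlt => /predU1P[<-|lt].
  by rewrite lexx; congr phi_inv; ring.
by rewrite leNgt lt.
Qed.

Lemma w_reflect x : w_ (2 * Tal - x) = w_ x.
Proof.
have [xT|Tx] := leP x Tal.
  rewrite (w_left xT) w_right; last by lra.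
  by congr phi_inv; ring.
by rewrite (w_right (ltW Tx)) w_left//; lra.
Qed.

Lemma w0 : w_ 0 = 0.
Proof. by rewrite w_left ?phi_inv0// ltW. Qed.

Lemma w_gt0 x : 0 < x -> x < 2 * Tal -> 0 < w_ x.
Proof.
have half y : 0 < y -> y <= Tal -> 0 < w_ y.
  move=> y0; rewrite le_eqVlt => /predU1P[->|yT].
    by rewrite w_left ?phi_inv_T.
  rewrite w_left ?(ltW yT)//.
  by have : y \in `]0, Tal[; [rewrite in_itv/= y0|move=> /phi_inv_oo; rewrite in_itv/= => /andP[]].
move=> x0 x2; have [xT|Tx] := leP x Tal; first exact: half.
by rewrite -w_reflect; apply: half; lra.
Qed.

Definition w_deriv x := if x <= Tal then speed (w_ x) else - speed (w_ x).

(** The end slopes vanish when [G(al) = 0]; this is what permits arcs to be separated by gaps. *)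
Lemma w_deriv0 : w_deriv 0 = Num.sqrt (2 * G p q lam al).
Proof. by rewrite /w_deriv (ltW T0) w0 /speed G0 subr0. Qed.

Lemma w_deriv_2T : w_deriv (2 * Tal) = - Num.sqrt (2 * G p q lam al).
Proof.
rewrite /w_deriv ifF; last by apply/negbTE; rewrite -ltNge; have := T0; lra.
by rewrite -w_reflect subrr w0 /speed G0 subr0.
Qed.

(** The two branches of [w_deriv] agree at [Tal] because the speed vanishes at the maximum. *)
Let w_derivE x : Tal <= x -> w_deriv x = - speed (w_ x).
Proof.
rewrite /w_deriv le_eqVlt => /predU1P[<-|lt]; last by rewrite leNgt lt.
by rewrite lexx w_left// phi_inv_T /speed subrr mulr0 sqrtr0 oppr0.
Qed.

Let setU_half : `[0, 2 * Tal]%classic = `[0, Tal]%classic `|` `[Tal, 2 * Tal]%classic.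
Proof.
apply/seteqP; split=> x /=; rewrite !in_itv/=.
  by move=> /andP[-> ->]; rewrite andbT; have [|/ltW] := leP x Tal; [left|right].
by have := T0 => ? [] /andP[? ?]; apply/andP; split; lra.
Qed.

Let half_deriv_on (f g : R -> R) x : x \in `[0, 2 * Tal] ->
  (x <= Tal -> deriv_on `[0, Tal] f x (g x)) ->
  (Tal <= x -> deriv_on `[Tal, 2 * Tal] f x (g x)) ->
  deriv_on `[0, 2 * Tal] f x (g x).
Proof.
rewrite in_itv/= => /andP[x0 x2] h1 h2; rewrite setU_half; apply: deriv_on_setU.
- have [xT|Tx] := leP x Tal; first exact: h1.
  by apply: deriv_on_far; rewrite in_itv/= x0 -ltNge.
- have [xT|Tx] := ltP x Tal; last exact: h2.
  by apply: deriv_on_far; rewrite in_itv/= x2 andbT -ltNge.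
Qed.

Lemma w_deriv_on x : x \in `[0, 2 * Tal] ->
  deriv_on `[0, 2 * Tal] w_ x (w_deriv x).
Proof.
move=> x2; have := x2; rewrite in_itv/= => /andP[x0 xT2]; apply: half_deriv_on => // xT.
- have xmem : x \in `[0, Tal] by rewrite in_itv/= x0.
  rewrite /w_deriv xT (w_left xT).
  apply: (deriv_on_eq (f := phi_inv p q al lam)) (phi_inv_deriv_on xmem) => //.
  by move=> y /[!inE]/=; rewrite in_itv/= => /andP[_ yT]; rewrite w_left.
- rewrite w_derivE// (w_right xT).
  have -> : - speed (phi_inv p q al lam (2 * Tal - x)) =
      1 * (- 1) * speed (phi_inv p q al lam (- 1 * (x - 2 * Tal))).
    by rewrite mulN1r opprB mul1r mulN1r.
  apply: (deriv_on_affine (A := `[0, Tal]%classic) (f := phi_inv p q al lam)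
    (c := 2 * Tal)).
  + by move=> y /=; rewrite !in_itv/= => /andP[h1 h2]; apply/andP; split; lra.
  + move=> y /=; rewrite in_itv/= => /andP[h1 h2].
    by rewrite w_right// mul1r mulN1r opprB.
  + by rewrite /= in_itv/= xT.
  + by rewrite normrN normr1.
  + by apply: phi_inv_deriv_on; rewrite in_itv/=; apply/andP; split; lra.
Qed.

Lemma w_deriv_deriv_on x : x \in `[0, 2 * Tal] ->
  deriv_on `[0, 2 * Tal] w_deriv x (- nonlinearity lam (w_ x)).
Proof.
move=> x2; have := x2; rewrite in_itv/= => /andP[x0 xT2].
apply: (half_deriv_on (g := fun x => - nonlinearity lam (w_ x))) => // xT.
- have xmem : x \in `[0, Tal] by rewrite in_itv/= x0.
  rewrite (w_left xT).
  apply: (deriv_on_eq (f := fun x => speed (phi_inv p q al lam x)))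
    (speed_phi_inv_deriv_on xmem) => //.
  by move=> y /[!inE]/=; rewrite in_itv/= => /andP[_ yT]; rewrite /w_deriv yT w_left.
- rewrite (w_right xT).
  have -> : - nonlinearity lam (phi_inv p q al lam (2 * Tal - x)) =
      (- 1) * (- 1) * - nonlinearity lam (phi_inv p q al lam (- 1 * (x - 2 * Tal))).
    by rewrite (mulN1r (x - _)) opprB; ring.
  apply: (deriv_on_affine (A := `[0, Tal]%classic)
    (f := fun x => speed (phi_inv p q al lam x)) (c := 2 * Tal)).
  + by move=> y /=; rewrite !in_itv/= => /andP[h1 h2]; apply/andP; split; lra.
  + move=> y /=; rewrite in_itv/= => /andP[h1 h2].
    by rewrite w_derivE// w_right// !mulN1r opprB.
  + by rewrite /= in_itv/= xT.
  + by rewrite normrN normr1.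
  + by apply: speed_phi_inv_deriv_on; rewrite in_itv/=; apply/andP; split; lra.
Qed.

(* Along a monotone piece the energy identity says that phi (v x) has
   derivative 1. *)
Lemma phi_half_arc (v v1 : R -> R) c m : c < m ->
  {within `[c, m], continuous v} -> v c = 0 -> v m = al ->
  {in `]c, m[, forall x, 0 < v x < al} ->
  {in `]c, m[, forall x : R, is_derive x 1 v (v1 x)} ->
  {in `]c, m[, continuous v1} ->
  {in `]c, m[, forall x, v1 x ^+ 2 = 2 * (G p q lam al - G p q lam (v x))} ->
  forall x, x \in `[c, m] -> ph (v x) = x - c.
Proof.
move=> cm cv vc vm v_oo dv cv1 energy.
have sub x y : c <= x -> y <= m -> `]x, y[%classic `<=` `]c, m[%classic.
  by move=> cx ym z /=; rewrite !in_itv/= => /andP[? ?]; apply/andP; split; lra.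
have v1_neq0 x : x \in `]c, m[ -> v1 x != 0.
  move=> xcm; rewrite -sqrf_eq0 energy// gt_eqF// mulr_gt0// subr_gt0.
  by have /andP[] := v_oo x xcm; exact: G_lt.
have [xi xicm Exi] := MVT cm dv cv.
have xi0 : 0 < v1 xi.
  rewrite -(pmulr_lgt0 _ (_ : 0 < m - c)) ?subr_gt0//.
  by rewrite -Exi vc vm subr0.
(* By energy [v1] has no zero in []c, m[], and it is positive at the mean value point [xi]; a
   nonpositive value would create a zero in between. *)
have v1_gt0 x : x \in `]c, m[ -> 0 < v1 x.
  move=> xcm; rewrite ltNge; apply/negP => x0.
  have cont a b : a \in `]c, m[ -> b \in `]c, m[ -> {within `[a, b], continuous v1}.
    rewrite !in_itv/= => /andP[ca am] /andP[cb bm].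
    apply/subspace_continuousP => y /=; rewrite in_itv/= => /andP[ay yb].
    apply: cvg_within_filter; apply: cv1; rewrite in_itv/=; apply/andP; split; lra.
  suff [y ycm y0] : exists2 y, y \in `]c, m[ & v1 y = 0.
    by have := v1_neq0 y ycm; rewrite y0 eqxx.
  have := xcm; rewrite in_itv/= => /andP[cx xm].
  have := xicm; rewrite in_itv/= => /andP[cxi xim].
  have [xxi|xix] := leP x xi.
    have [|y /andP[h1 h2] y0] := IVT_crossing (v := 0) xxi (cont _ _ xcm xicm).
      by left; split=> //; exact: ltW.
    by exists y => //; rewrite in_itv/=; apply/andP; split; lra.
  have [|y /andP[h1 h2] y0] := IVT_crossing (v := 0) (ltW xix) (cont _ _ xicm xcm).
    by right; split=> //; exact: ltW.
  by exists y => //; rewrite in_itv/=; apply/andP; split; lra.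
pose F x := ph (v x) - x.
have v_cc x : `[c, m]%classic x -> `[0, al]%classic (v x).
  rewrite /= in_itv/= => /andP[]; rewrite le_eqVlt => /predU1P[<- _|cx].
    by rewrite vc; exact: zero_mem.
  rewrite le_eqVlt => /predU1P[->|xm]; first by rewrite vm; exact: al_mem.
  have : x \in `]c, m[ by rewrite in_itv/= cx.
  by move=> /v_oo /andP[h1 h2]; rewrite in_itv/= !ltW.
have cF : {within `[c, m], continuous F}.
  have h := within_continuous_comp phi_continuous cv v_cc.
  move=> x; apply: cvgB; first exact: h.
  by apply: (@continuous_subspaceT _ _ _ id) => y; exact: cvg_id.
have dF x : x \in `]c, m[ -> is_derive x 1 F 0.
  move=> xcm; have vx : v x \in `]0, al[ by rewrite in_itv/= v_oo.
  have d := is_derive_comp (phi_is_derive vx) (dv x xcm).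
  have di : is_derive x 1 (fun y : R => y) 1 by exact: is_derive_id.
  apply: is_derive_val_eq (is_derive_sub d di).
  have -> : speed (v x) = v1 x.
    by rewrite /speed -energy// sqrtr_sqr gtr0_norm// v1_gt0.
  by rewrite mulVf ?subrr// v1_neq0.
move=> x; rewrite in_itv/= => /andP[]; rewrite le_eqVlt => /predU1P[<- _|cx xm].
  by rewrite vc phi0 subrr.
have dF' y : y \in `]c, x[ -> is_derive y 1 F 0.
  by move=> ycx; apply: dF; have := sub _ _ (lexx c) xm y; apply.
have cF' : {within `[c, x], continuous F}.
  by apply: continuous_subspaceW cF => y /=; rewrite !in_itv/= => /andP[? ?]; apply/andP; split; lra.
have [y _] := MVT cx dF' cF'; rewrite mul0r /F vc phi0; lra.
Qed.

End profile.

(** The amplitude is the maximum of [v], where [v1 = 0] turns the energy identity into [G(al) = E].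
    The maximum is attained only once, and by [phi_half_arc] each monotone half takes time
    [T(al)]. *)
Lemma nodal_arc lam (v v1 : R -> R) c d E : c < d -> 0 <= E ->
  {within `[c, d], continuous v} -> v c = 0 -> v d = 0 ->
  {in `]c, d[, forall x, 0 < v x} ->
  {in `]c, d[, forall x : R, is_derive x 1 v (v1 x)} ->
  {in `]c, d[, forall x : R, is_derive x 1 v1 (- nonlinearity lam (v x))} ->
  {in `]c, d[, forall x, v1 x ^+ 2 / 2 + G p q lam (v x) = E} ->
  exists al, [/\ admissible lam al, G p q lam al = E, d - c = 2 * T p q lam al &
    forall x, x \in `[c, d] -> v x = w p q al lam (x - c)].
Proof.
move=> cd E0 cv vc vd v0 dv dv1 energy.
have [m /[!in_itv]/= /andP[cm md] mmax] := EVT_max (ltW cd) cv.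
have mid : (c + d) / 2 \in `]c, d[ by rewrite in_itv/=; apply/andP; split; lra.
have vm0 : 0 < v m.
  by apply: lt_le_trans (v0 _ mid) (mmax _ _); exact: subset_itv_oo_cc.
have mcd : m \in `]c, d[.
  rewrite in_itv/= !lt_neqAle cm md !andbT; apply/andP; split.
    by apply/eqP => h; move: vm0; rewrite -h vc ltxx.
  by apply/eqP => h; move: vm0; rewrite h vd ltxx.
have dvb x : x \in `]c, d[ -> derivable v x 1 by move=> /dv[].
have v1m : v1 m = 0.
  have [_ <-] := dv m mcd.
  have [_ ->//] := derive1_at_max (ltW cd) dvb mcd
    (fun t tcd => mmax t (subset_itv_oo_cc tcd)).
set al := v m in vm0 *.
have GE : G p q lam al = E.
  by rewrite -(energy m mcd) v1m expr0n/= mul0r add0r.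
have adm : admissible lam al by apply: admissible_G => //; rewrite GE.
have en x : x \in `]c, d[ -> v1 x ^+ 2 = 2 * (G p q lam al - G p q lam (v x)).
  by move=> xcd; rewrite GE -(energy x xcd); field.
have crit x : x \in `]c, d[ -> v x < al -> v1 x != 0.
  move=> xcd xal; rewrite -sqrf_eq0 en// gt_eqF// mulr_gt0// subr_gt0.
  by apply: G_lt => //; exact: v0.
(* Between two maximum points, a minimum below [al] would be a critical point, which energy
   excludes; so [v] is constant there, against [v1' = - nonlinearity al < 0]. *)
have flat x y : x \in `]c, d[ -> y \in `]c, d[ -> x < y -> v x = al -> v y = al -> False.
  move=> xcd ycd xy xal yal.
  have sub z : z \in `[x, y] -> z \in `]c, d[.
    move: xcd ycd; rewrite !in_itv/= => /andP[? ?] /andP[? ?] /andP[? ?].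
    by apply/andP; split; lra.
  have cv' : {within `[x, y], continuous v}.
    by apply: continuous_subspaceW cv => z /= /sub; exact: subset_itv_oo_cc.
  have [z zxy zmin] := EVT_min (ltW xy) cv'.
  have zal : v z = al.
    have le : v z <= al by apply: mmax; apply/subset_itv_oo_cc/sub.
    move: le; rewrite le_eqVlt => /predU1P[//|lt].
    have zoo : z \in `]x, y[.
      move: zxy; rewrite !in_itv/= !lt_neqAle => /andP[-> ->]; rewrite !andbT.
      apply/andP; split; apply/eqP => h; move: lt.
        by rewrite -h xal ltxx.
      by rewrite h yal ltxx.
    have := crit z (sub _ zxy) lt.
    have [_ <-] := dv z (sub _ zxy).
    have dvb' t : t \in `]x, y[ -> derivable v t 1.
      by move=> txy; apply: dvb; apply: sub; exact: subset_itv_oo_cc.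
    have [_ ->] := derive1_at_min (ltW xy) dvb' zoo
      (fun t txy => zmin t (subset_itv_oo_cc txy)).
    by rewrite eqxx.
  have all t : t \in `[x, y] -> v1 t = 0.
    move=> txy; have tal : v t = al.
      apply: le_anti; rewrite mmax ?subset_itv_oo_cc ?sub//=.
      by rewrite -zal; exact: zmin.
    by apply/eqP; rewrite -sqrf_eq0 en ?sub// tal subrr mulr0.
  pose t := (x + y) / 2.
  have txy : t \in `]x, y[ by rewrite in_itv/= /t; apply/andP; split; lra.
  have tcc : t \in `[x, y] by exact: subset_itv_oo_cc.
  have tal : v t = al.
    apply: le_anti; rewrite mmax ?subset_itv_oo_cc ?sub//=.
    by rewrite -zal; exact: zmin.
  have d0 : is_derive t 1 v1 0.
    have dc : is_derive t 1 (fun=> 0 : R) 0 by exact: is_derive_cst.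
    apply: near_eq_is_derive dc => //.
    near=> s; apply/esym/all; apply: subset_itv_oo_cc.
    by near: s; exact: near_in_itvoo.
  have := dv1 t (sub _ tcc); rewrite tal => -[_ E1].
  move: d0 => [_]; rewrite E1 => /eqP; rewrite oppr_eq0 => /eqP h.
  by have := nonlinearity_gt0 adm; rewrite h ltxx.
have v_lt x : x \in `]c, d[ -> x != m -> v x < al.
  move=> xcd xm; rewrite lt_neqAle mmax ?subset_itv_oo_cc// andbT; apply/eqP => xal.
  have /orP[lt|lt] : (x < m) || (m < x) by rewrite -neq_lt.
  - exact: flat lt xal erefl.
  - exact: flat lt erefl xal.
have cv1 x : x \in `]c, d[ -> {for x, continuous v1}.
  by move=> /dv1; exact: is_derive_continuous.
have := mcd; rewrite in_itv/= => /andP[cm' md'].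
have left x : x \in `[c, m] -> phi p q al lam (v x) = x - c.
  have sub y : y \in `]c, m[ -> (y \in `]c, d[) /\ y != m.
    rewrite !in_itv/= => /andP[h1 h2]; rewrite h1 (lt_trans h2 md')/=.
    by rewrite lt_eqF.
  apply: (phi_half_arc adm cm' (v1 := v1)) => //.
  - by apply: continuous_subspaceW cv => y /=; rewrite !in_itv/= => /andP[? ?]; apply/andP; split; lra.
  - by move=> y /sub[h1 h2]; rewrite v0// v_lt.
  - by move=> y /sub[h1 _]; exact: dv.
  - by move=> y /sub[h1 _]; exact: cv1.
  - by move=> y /sub[h1 _]; exact: en.
(* The descending half is the ascending half of [y => v (- y)]. *)
have right x : x \in `[m, d] -> phi p q al lam (v x) = d - x.
  have sub y : y \in `]- d, - m[ -> (- y \in `]c, d[) /\ - y != m.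
    rewrite !in_itv/= => /andP[h1 h2]; split; first by apply/andP; split; lra.
    by rewrite gt_eqF//; lra.
  move=> xmd; have := @phi_half_arc lam al adm (fun y => v (- y)) (fun y => - v1 (- y))
    (- d) (- m) _ _ _ _ _ _ _ _ (- x).
  rewrite !opprK (addrC (- x)); apply=> //.
  - by rewrite ltrN2.
  - apply: (within_continuous_comp (B := `[c, d]) (g := fun y => - y)) => //.
      by apply: continuous_subspaceT => y; apply: cvgN; exact: cvg_id.
    by move=> y /=; rewrite !in_itv/= => /andP[? ?]; apply/andP; split; lra.
  - by move=> y /sub[h1 h2]; rewrite v0// v_lt.
  - move=> y /sub[h1 _].
    have dN : is_derive y 1 (fun y : R => - y) (- 1) by exact: is_deriveN.
    apply: is_derive_val_eq (is_derive_comp (g := fun y : R => - y) (dv _ h1) dN).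
    by rewrite mulrN1.
  - move=> y /sub[h1 _]; apply: cvgN.
    apply: (@continuous_comp R R R (fun y => - y) v1); last exact: cv1.
    by apply: cvgN; exact: cvg_id.
  - by move=> y /sub[h1 _]; rewrite sqrrN; exact: en.
  - by move: xmd; rewrite !in_itv/= !lerN2 andbC.
have TL : T p q lam al = m - c by apply: left; rewrite in_itv/= cm lexx.
have TR : T p q lam al = d - m by apply: right; rewrite in_itv/= md lexx.
have v_mem x : x \in `[c, d] -> v x \in `[0, al].
  move=> xcd; rewrite in_itv/= mmax// andbT.
  move: xcd; rewrite in_itv/= => /andP[]; rewrite le_eqVlt => /predU1P[<- _|cx].
    by rewrite vc.
  rewrite le_eqVlt => /predU1P[->|xd]; first by rewrite vd.
  by apply/ltW/v0; rewrite in_itv/= cx.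
exists al; split=> //; first by lra.
move=> x xcd; have := xcd; rewrite in_itv/= => /andP[cx xd].
have [xm|mx] := leP x m.
  rewrite w_left ?TL ?lerD2r// -left ?in_itv/= ?cx//.
  by rewrite phiK// v_mem.
rewrite w_right; last by rewrite TL lerD2r ltW.
have -> : 2 * T p q lam al - (x - c) = d - x by lra.
rewrite -right ?in_itv/= ?(ltW mx)//.
by rewrite phiK// v_mem.
Unshelve. all: by end_near. Qed.

(** * Chains of nodal arcs *)

Section chain.
Variables (j : nat) (sg : R).
Hypothesis sgE : sg = 1 \/ sg = -1.
Let tau : R := (2 * j + 2)%:R^-1.
Let sign (k : 'I_j.+1) : R := sg * (-1) ^+ k.

Let sg2 : sg * sg = 1. Proof. by case: sgE => ->; rewrite ?mulrNN mulr1. Qed.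

Let sign2 k : sign k * sign k = 1.
Proof. by rewrite /sign mulrACA sg2 mul1r -expr2 sqrr_sign. Qed.

Let nonlinearity_sign lam k z :
  nonlinearity lam (sign k * z) = sign k * nonlinearity lam z.
Proof.
have /eqP := sign2 k; rewrite -expr2 sqrf_eq1 => /orP[] /eqP ->.
  by rewrite !mul1r.
by rewrite !mulN1r nonlinearityN.
Qed.

Let G_sign lam k z : G p q lam (sign k * z) = G p q lam z.
Proof.
have /eqP := sign2 k; rewrite -expr2 sqrf_eq1 => /orP[] /eqP ->.
  by rewrite mul1r.
by rewrite mulN1r GN.
Qed.

Definition separated (L : R) (a : 'I_j.+1 -> R) :=
  [/\ forall k, 0 <= a k, forall i k : 'I_j.+1, (i < k)%N -> a i + L <= a k &
      forall k, a k + L <= 1].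

(** Form shared by the regular and the dead core solutions, which differ only in whether the arcs
    must tile [[0, 1]]. Requiring the formula on closed arcs is consistent, as [w] vanishes at both
    ends. *)
Definition chain lam al (a : 'I_j.+1 -> R) (u : R -> R) :=
  (forall k x, x \in `[a k, a k + 2 * T p q lam al] ->
    u x = sign k * w p q al lam (x - a k)) /\
  (forall x, x \in `[0, 1] ->
    (forall k, x \notin `[a k, a k + 2 * T p q lam al]) -> u x = 0).

Definition contiguous (a : 'I_j.+1 -> R) := forall k : 'I_j.+1, a k = k%:R / j.+1%:R.

Let j0 : 0 < j.+1%:R :> R. Proof. by rewrite ltr0n. Qed.

Let tauE : tau = (2 * j.+1%:R)^-1.
Proof. by rewrite /tau -natrM mulnS addnC. Qed.

Let tau2 : 2 * tau = j.+1%:R^-1.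
Proof. by rewrite tauE; field; rewrite gt_eqF. Qed.

(** * Chains of arcs are nodal solutions *)

Section to_nodal.
Variables (lam al : R) (a : 'I_j.+1 -> R) (u : R -> R).
Hypothesis adm : admissible lam al.
Let L := 2 * T p q lam al.
Hypotheses (sep : separated L a) (ch : chain lam al a u)
  (alt : G p q lam al = 0 \/ contiguous a /\ T p q lam al = tau).

Let L0 : 0 < L. Proof. by rewrite mulr_gt0// T_gt0. Qed.
Let ww := w p q al lam.
Let wd := w_deriv lam al.
Let wL : ww L = 0.
Proof. by rewrite /ww /L -w_reflect subrr w0. Qed.

Let shared (i k : 'I_j.+1) x : (i < k)%N -> x \in `[a i, a i + L] ->
  x \in `[a k, a k + L] -> x - a i = L /\ x - a k = 0.
Proof.
move=> ik; rewrite !in_itv/= => /andP[h1 h2] /andP[h3 h4].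
by have [_ h _] := sep; have := h i k ik; split; lra.
Qed.

(** At a common end point the profile slopes are [- sqrt (2 G(al))] and [sqrt (2 G(al))]. Both
    vanish if [G(al) = 0]; in the contiguous case the arcs are consecutive and the alternating sign
    compensates. *)
Let deriv_match (i k : 'I_j.+1) x : (i < k)%N -> x \in `[a i, a i + L] ->
  x \in `[a k, a k + L] -> sign i * wd (x - a i) = sign k * wd (x - a k).
Proof.
move=> ik xi xk; have [E1 E2] := shared ik xi xk.
rewrite E1 E2 /wd w_deriv0// w_deriv_2T//.
case: alt => [->|[cont TE]]; first by rewrite mulr0 sqrtr0 oppr0 !mulr0.
have ki : k = i.+1 :> nat.
  have : a k - a i = L by lra.
  rewrite !cont -mulrBl /L TE tau2 => h.
  have : k%:R - i%:R = 1 :> R by rewrite -[LHS](mulfK (lt0r_neq0 j0)) mulrAC h mulVf ?gt_eqF.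
  move=> /eqP; rewrite subr_eq addrC natr1 eqr_nat => /eqP//.
by rewrite /sign ki exprS; ring.
Qed.

Let du x : R :=
  if [pick k : 'I_j.+1 | x \in `[a k, a k + L]] is Some k
  then sign k * wd (x - a k) else 0.

Let duE k x : x \in `[a k, a k + L] -> du x = sign k * wd (x - a k).
Proof.
move=> xk; rewrite /du; case: pickP => [i xi|/(_ k)]; last by rewrite xk.
have [ik|ki|/val_inj -> //] := ltngtP i k; first exact: deriv_match.
by apply/esym; exact: deriv_match.
Qed.

Let outside := [set x | x \in `[0, 1] /\ forall k, x \notin `]a k, a k + L[].

Let u_outside x : outside x -> u x = 0.
Proof.
move=> [x01 xout]; have [chu chz] := ch.
have [/existsP[k xk]|/existsPn h] := boolP [exists k, x \in `[a k, a k + L]]; last exact: chz.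
rewrite (chu k)//; have := xout k; move: xk; rewrite !in_itv/= => /andP[h1 h2].
rewrite negb_and -!leNgt => /orP[h|h].
  by rewrite (_ : x - a k = 0) ?w0 ?mulr0//; lra.
by rewrite (_ : x - a k = L) ?(wL : w _ _ _ _ _ = _) ?mulr0//; lra.
Qed.

Let du_outside x : G p q lam al = 0 -> outside x -> du x = 0.
Proof.
move=> GE [x01 xout]; rewrite /du; case: pickP => // k xk.
have := xout k; move: xk; rewrite !in_itv/= => /andP[h1 h2].
rewrite negb_and -!leNgt => /orP[h|h].
  rewrite (_ : x - a k = 0); last by lra.
  by rewrite /wd w_deriv0// GE mulr0 sqrtr0 mulr0.
rewrite (_ : x - a k = L); last by lra.
by rewrite /wd w_deriv_2T// GE mulr0 sqrtr0 oppr0 mulr0.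
Qed.

Let cover x : contiguous a -> T p q lam al = tau -> x \in `[0, 1] ->
  exists k, x \in `[a k, a k + L].
Proof.
move=> cont TE; rewrite in_itv/= => /andP[x0 x1].
suff h n : (n <= j.+1)%N -> x <= n%:R / j.+1%:R -> exists k, x \in `[a k, a k + L].
  by apply: (h j.+1) => //; rewrite divff// gt_eqF.
elim: n => [_|n IH nj xn].
  rewrite mul0r => x0'; exists ord0; rewrite cont mul0r add0r in_itv/= x0/=.
  exact: le_trans x0' (ltW L0).
have [le|lt] := leP x (n%:R / j.+1%:R); first exact: IH (ltnW nj) le.
exists (Ordinal nj); rewrite cont in_itv/= (ltW lt)/=.
apply: le_trans xn _; rewrite /L TE tau2 -natr1 mulrDl mul1r//.
Qed.

(** Relative derivatives on the closed arcs combine over their finite union. If the arcs tile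
    [[0, 1]], this suffices; if [G(al) = 0], the complement of the open arcs is added, where [f]
    vanishes. *)
Let pieces_deriv (f f' : R -> R) x : x \in `[0, 1] ->
  (forall k, x \in `[a k, a k + L] -> deriv_on `[a k, a k + L] f x (f' x)) ->
  (G p q lam al = 0 -> forall y, outside y -> f y = 0) ->
  (G p q lam al = 0 -> outside x -> f' x = 0) ->
  deriv_on `[0, 1] f x (f' x).
Proof.
move=> x01 onP f0 f'0.
pose P := \bigcup_(k in [set: 'I_j.+1]) `[a k, a k + L]%classic.
have dP : deriv_on P f x (f' x).
  apply: deriv_on_bigcup => k.
  by have [xk|xk] := boolP (x \in `[a k, a k + L]); [exact: onP|exact: deriv_on_far].
case: alt => [GE|[cont TE]]; last first.
  by apply: deriv_onS dP => y /(cover cont TE)[k yk]; exists k.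
apply: (@deriv_onS _ _ (P `|` outside)).
  move=> y y01; have [[k yk]|h] := pselect (exists k, y \in `[a k, a k + L]).
    by left; exists k.
  right; split=> // k; apply/negP => yk; apply: h; exists k.
  exact: subset_itv_oo_cc.
apply: deriv_on_setU => //.
(* Around a point of [outside] only zero values occur within [outside]; a point of an open arc has
   positive distance from [outside]. *)
have [xout|xin] := pselect (outside x).
  move=> e e0; exists 1 => // y yout _.
  rewrite (f0 GE)// (f0 GE)// (f'0 GE)// mul0r !subr0 normr0.
  by rewrite mulr_ge0 ?(ltW e0).
have [k xk] : exists k, x \in `]a k, a k + L[.
  by apply: contrapT => h; apply: xin; split=> // k; apply/negP => xk; apply: h; exists k.
have /andP[h1 h2] := xk.
apply: (@deriv_on_near _ _ set0 _ _ _ (Num.min (x - a k) (a k + L - x))); last exact: deriv_on_set0.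
  by rewrite lt_min !subr_gt0; move: xk; rewrite in_itv.
move=> y [_ /(_ k)]; rewrite lt_min => /negP yk /andP[g1 g2]; apply: yk.
move: g1 g2; rewrite in_itv/= !ltr_norml => /andP[? ?] /andP[? ?].
by apply/andP; split; lra.
Qed.

Let piece_affine (f g : R -> R) (l : R -> R) k x : x \in `[a k, a k + L] ->
  (forall y, y \in `[a k, a k + L] -> g y = sign k * f (y - a k)) ->
  (forall y, y \in `[0, L] -> deriv_on `[0, L] f y (l y)) ->
  deriv_on `[a k, a k + L] g x (sign k * l (x - a k)).
Proof.
move=> xk gE df; rewrite -[sign k]mulr1.
have sub y : y \in `[a k, a k + L] -> 1 * (y - a k) \in `[0, L].
  by rewrite !in_itv/= mul1r => /andP[? ?]; apply/andP; split; lra.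
rewrite -{1}[x - a k]mul1r.
apply: (deriv_on_affine (A := `[0, L]%classic) (f := f) (c := a k)) => //.
- by move=> y yk; rewrite gE// mul1r.
- by rewrite normr1.
- by apply: df; exact: sub.
Qed.

Lemma chain_nodal : nodal_set p q j sg (lam, u).
Proof.
have [a0 asep a1] := sep; have [chu chz] := ch.
have cont_nl : continuous (nonlinearity lam) by exact: continuous_nonlinearity.
have d1 : has_deriv01 u du.
  apply/has_deriv01P => x x01.
  apply: (pieces_deriv (f' := du)) => //; last by move=> GE; exact: du_outside.
  - move=> k xk; rewrite (duE xk); apply: (piece_affine (f := ww) (l := wd)) => //.
      exact: chu.
    by move=> y yL; exact: w_deriv_on.
have d2 : has_deriv01 du (fun x => - nonlinearity lam (u x)).
  apply/has_deriv01P => x x01.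
  apply: (pieces_deriv (f' := fun x => - nonlinearity lam (u x))) => //.
  - move=> k xk.
    have -> : - nonlinearity lam (u x) = sign k * - nonlinearity lam (ww (x - a k)).
      by rewrite (chu k x xk) -/ww nonlinearity_sign mulrN.
    apply: (piece_affine (f := wd) (l := fun y => - nonlinearity lam (ww y))) => //.
      by move=> y; exact: duE.
    by move=> y yL; exact: w_deriv_deriv_on.
  - by move=> GE y yout; exact: du_outside.
  - by move=> _ xout; rewrite u_outside// /nonlinearity !mulr0 addr0 oppr0.
have cu : {within `[0, 1], continuous u}.
  apply: (@deriv_on_continuous _ _ _ du) => x x01.
  by move/has_deriv01P : d1 => /(_ x x01).
have pos k x : x \in `]a k, a k + L[ -> 0 < sign k * u x.
  move=> xk; rewrite (chu k) ?subset_itv_oo_cc// mulrA sign2 mul1r.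
  by move: xk; rewrite in_itv/= => /andP[h1 h2]; apply: w_gt0 => //; rewrite -?/L; lra.
have in01 x : x \in `[0, 1] -> (forall k, x \notin `]a k, a k + L[) -> u x = 0.
  by move=> x01 xout; exact: u_outside.
split.
- split.
  + apply: in01 => [|k]; first by rewrite in_itv/= lexx ler01.
    by rewrite in_itv/= negb_and -!leNgt a0.
  + apply: in01 => [|k]; first by rewrite in_itv/= lexx ler01.
    by rewrite in_itv/= negb_and -!leNgt a1 orbT.
  + exists du, (fun x => - nonlinearity lam (u x)); split => //.
      apply: (within_continuous_comp (B := setT) (f := fun z => - nonlinearity lam z) _ cu) => //.
      by apply: continuous_subspaceT => z; apply: cvgN; exact: cont_nl.
    by move=> x _; rewrite opprK.
- exists (a ord0 + L / 2).
    by rewrite in_itv/=; have := a0 ord0; have := a1 ord0; have := L0; move=> *; apply/andP; split; lra.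
  have := pos ord0 (a ord0 + L / 2); rewrite in_itv/= => h.
  apply/eqP => u0; move: h; rewrite u0 mulr0 ltxx => h.
  by have : false by apply: h; have := L0; move=> ?; apply/andP; split; lra.
- exists a, (fun k => a k + L); split.
  + split.
    * by move=> k; rewrite a0 a1 ltrDl L0.
    * apply/trivIsetP => i k _ _ ik; apply/seteqP; split=> // y [/=].
      rewrite !in_itv/= => /andP[? ?] /andP[? ?].
      have /orP[lt|lt] : (i < k)%N || (k < i)%N by rewrite -neq_ltn.
        by have := asep i k lt; lra.
      by have := asep k i lt; lra.
    * by move=> k x /pos h; rewrite /= normr_gt0; apply/eqP => u0; move: h; rewrite u0 mulr0 ltxx.
    * exact: in01.
  + by move=> i k ik; have := asep i k ik; have := L0; lra.
  + exact: pos.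
Qed.

End to_nodal.

(** * Nodal solutions are chains of arcs *)

Lemma separated_ge L a (k : 'I_j.+1) : separated L a -> k%:R * L <= a k.
Proof.
move=> [a0 asep _]; case: k; elim=> [|n IH] nj; first by rewrite mul0r.
have nj' := ltnW nj; have := asep (Ordinal nj') (Ordinal nj) (ltnSn n).
have := IH nj'; rewrite /= -[n.+1%:R]natr1 mulrDl mul1r; lra.
Qed.

Lemma separated_total L a : separated L a -> j.+1%:R * L <= 1.
Proof.
move=> sep; have := separated_ge ord_max sep; have [_ _ /(_ ord_max)] := sep.
by rewrite /= -[j.+1%:R]natr1 mulrDl mul1r; lra.
Qed.

(** There is no slack: the arcs to the left bound [a k] below by [k * L], and those from [k] to the
    right bound it above by the same number. *)
Lemma separated_contiguous L a : 0 <= L -> j.+1%:R * L = 1 -> separated L a ->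
  contiguous a.
Proof.
move=> L0 jL sep k; have LE : L = j.+1%:R^-1.
  by rewrite -[LHS](mulKf (lt0r_neq0 j0)) jL mulr1.
rewrite -LE; apply: le_anti; rewrite (separated_ge k sep) andbT.
have [_ asep a1] := sep.
suff h n : (n <= j)%N -> forall i : 'I_j.+1, (i + n)%N = j -> a i + (n.+1)%:R * L <= 1.
  have kj : (k <= j)%N by rewrite -ltnS.
  have := h (j - k)%N (leq_subr _ _) k (subnKC kj).
  have : (j - k).+1%:R = j.+1%:R - k%:R :> R by rewrite -subSn// natrB// ltnW.
  by move=> ->; rewrite mulrBl jL; lra.
elim: n => [_ i _|n IH nj i inj]; first by rewrite mul1r; exact: a1.
have ij : (i.+1 < j.+1)%N.
  have : (i < i + n.+1)%N by rewrite addnS ltnS leq_addr.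
  by rewrite inj.
have := IH (ltnW nj) (Ordinal ij); rewrite /= addSnnS => /(_ inj).
have := asep i (Ordinal ij) (ltnSn i).
by rewrite -[n.+2%:R]natr1 mulrDl mul1r; lra.
Qed.

Lemma nodal_chain lam u : nodal_set p q j sg (lam, u) ->
  exists al a, [/\ admissible lam al, separated (2 * T p q lam al) a,
    chain lam al a u & G p q lam al = 0 \/ contiguous a /\ T p q lam al = tau].
Proof.
move=> [/= [u0 u1 [du [ddu [/has_deriv01P D1 /has_deriv01P D2 _ ode]]]] _
  [c [d [[cd triv pos out] ord sgn]]]].
have oo01 (x : R) : x \in `]0, 1[ -> \forall y \near x, y \in `[0, 1].
  move=> x01; near=> y; apply: subset_itv_oo_cc.
  by near: y; exact: near_in_itvoo.
have du1 (x : R) : x \in `]0, 1[ -> is_derive x 1 u (du x).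
  move=> x01; apply: (@deriv_on_is_derive _ `[0, 1]%classic); first exact: oo01.
  by apply: D1; exact: subset_itv_oo_cc.
have du2 (x : R) : x \in `]0, 1[ -> is_derive x 1 du (- nonlinearity lam (u x)).
  move=> x01; apply: (@deriv_on_is_derive _ `[0, 1]%classic); first exact: oo01.
  have -> : - nonlinearity lam (u x) = ddu x.
    by rewrite /nonlinearity -ode// opprK.
  by apply: D2; exact: subset_itv_oo_cc.
have cu : {within `[0, 1], continuous u} by apply: (@deriv_on_continuous _ _ _ du).
have cdu : {within `[0, 1], continuous du} by apply: (@deriv_on_continuous _ _ _ ddu).
pose e x := 1 / 2 * (du x * du x) + G p q lam (u x).
have G_cont : continuous (G p q lam).
  by move=> z; exact: is_derive_continuous (G_is_derive lam z).
have ce : {within `[0, 1], continuous e}.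
  move=> x; apply: cvgD; first by apply: cvgMr; apply: cvgM; exact: cdu.
  by apply: (within_continuous_comp (B := setT) _ cu) => //; exact: continuous_subspaceT.
have de (x : R) : x \in `]0, 1[ -> is_derive x 1 e 0.
  move=> x01; have h1 := du1 x x01; have h2 := du2 x x01.
  apply: is_derive_val_eq (is_derive_add
    (is_derive_scale (1 / 2) (is_derive_mul h2 h2))
    (is_derive_comp (G_is_derive lam (u x)) h1)).
  by field.
(* Since [u 0 = 0], the energy at 0 is purely kinetic, hence nonnegative; [nodal_arc] derives
   admissibility of the amplitude from this. *)
pose E := du 0 ^+ 2 / 2.
have E0 : 0 <= E by rewrite divr_ge0// sqr_ge0.
have eE (x : R) : x \in `]0, 1[ -> du x ^+ 2 / 2 + G p q lam (u x) = E.
  rewrite in_itv/= => /andP[x0 x1].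
  have ex : e x = e 0.
    have de' (y : R) : y \in `]0, x[ -> is_derive y 1 e 0.
      rewrite in_itv/= => /andP[y0 yx]; apply: de.
      by rewrite in_itv/= y0 (lt_trans yx).
    have ce' : {within `[0, x], continuous e}.
      apply: continuous_subspaceW ce => y /=; rewrite !in_itv/= => /andP[-> yx].
      by rewrite (le_trans yx)// ltW.
    have [y _] := MVT x0 de' ce'; rewrite mul0r => /eqP; rewrite subr_eq0 => /eqP//.
  by move: ex; rewrite /e u0 G0 /E !expr2 => ex; lra.
have disj (i k : 'I_j.+1) : (i < k)%N -> d i <= c k.
  move=> ik; rewrite leNgt; apply/negP => lt.
  have ci := ord i k ik; have [_ cdk _] := cd k; have [_ cdi _] := cd i.
  have nik : i != k by rewrite neq_ltn ik.
  have /trivIsetP/(_ i k I I nik) := triv.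
  pose y := (c k + Num.min (d i) (d k)) / 2.
  have : c k < Num.min (d i) (d k) by rewrite lt_min lt.
  have : Num.min (d i) (d k) <= d i by rewrite ge_min lexx.
  have : Num.min (d i) (d k) <= d k by rewrite ge_min lexx orbT.
  move=> m1 m2 m3 /seteqP[/(_ y) h _]; apply: h; split => /=.
    by rewrite in_itv/= /y; apply/andP; split; lra.
  by rewrite in_itv/= /y; apply/andP; split; lra.
have ends (i k : 'I_j.+1) : (d k <= c i) || (d i <= c k) || (i == k).
  have [lt|lt|/val_inj ->] := ltngtP i k; last by rewrite eqxx !orbT.
  - by rewrite (disj _ _ lt) orbT.
  - by rewrite (disj _ _ lt).
(* The intervals are open and disjoint, so an end point of one of them lies in none. *)
have uc k : u (c k) = 0.
  have [c0 ckd d1] := cd k; apply: out => [|i].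
    by rewrite in_itv/= c0 (le_trans (ltW ckd)).
  rewrite in_itv/= negb_and -!leNgt.
  by case/orP: (ends i k) => [/orP[h|h]|/eqP ->];
    [rewrite (le_trans (ltW ckd) h)|rewrite h orbT|rewrite lexx].
have ud k : u (d k) = 0.
  have [c0 ckd d1] := cd k; apply: out => [|i].
    by rewrite in_itv/= d1 (le_trans c0)// ltW.
  rewrite in_itv/= negb_and -!leNgt.
  by case/orP: (ends i k) => [/orP[h|h]|/eqP ->];
    [rewrite h|rewrite (le_trans h (ltW ckd)) orbT|rewrite lexx orbT].
have arc k : exists al, [/\ admissible lam al, G p q lam al = E,
    d k - c k = 2 * T p q lam al &
    forall x, x \in `[c k, d k] -> sign k * u x = w p q al lam (x - c k)].
  have [c0 ckd d1] := cd k.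
  have sub (x : R) : x \in `]c k, d k[ -> x \in `]0, 1[.
    by rewrite !in_itv/= => /andP[? ?]; apply/andP; split; lra.
  apply: (@nodal_arc lam (fun x => sign k * u x) (fun x => sign k * du x)) => //.
  - move=> x; apply: cvgMr; move: x; apply: continuous_subspaceW cu => x /=.
    by rewrite !in_itv/= => /andP[? ?]; apply/andP; split; lra.
  - by rewrite uc mulr0.
  - by rewrite ud mulr0.
  - by move=> x /sgn.
  - by move=> x /sub/du1 h; exact: is_derive_scale.
  - move=> x /sub/du2 h; rewrite nonlinearity_sign -mulrN; exact: is_derive_scale.
  - by move=> x /sub/eE <-; rewrite G_sign exprMn expr2 sign2 mul1r.
have [al [adm GE LE0 _]] := arc ord0.
have {}arc k : d k = c k + 2 * T p q lam al /\
    forall x, x \in `[c k, d k] -> u x = sign k * w p q al lam (x - c k).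
  have [al' [adm' GE' LE' uE]] := arc k.
  have al_eq : al' = al.
    have [al0 _] := adm; have [al'0 _] := adm'.
    have [lt|lt|//] := ltgtP al' al.
    - by have := G_lt adm al'0 lt; rewrite GE GE' ltxx.
    - by have := G_lt adm' al0 lt; rewrite GE GE' ltxx.
  rewrite al_eq in LE' uE; split=> [|x xk]; first by rewrite -LE' addrC subrK.
  by rewrite -uE// mulrA sign2 mul1r.
have dE k : d k = c k + 2 * T p q lam al by have [] := arc k.
have sep : separated (2 * T p q lam al) c.
  split=> [k|i k ik|k]; first by have [] := cd k.
    by rewrite -dE; exact: disj.
  by rewrite -dE; have [] := cd k.
exists al, c; split=> //.
  split=> [k x|x x01 xout]; first by rewrite -dE; have [_] := arc k; apply.
  apply: out => // k; apply: contra (xout k); rewrite -dE.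
  exact: subset_itv_oo_cc.
have [E_eq0|E_neq0] := eqVneq E 0; [by left; rewrite GE|right].
(* Where [u] vanishes on an interval, so does [du], and the energy would be 0. *)
have nogap x y : 0 <= x -> x < y -> y <= 1 -> (forall t, x < t -> t < y -> u t = 0) -> False.
  move=> x0 xy y1 ut0; pose t := (x + y) / 2.
  have t01 : t \in `]0, 1[ by rewrite in_itv/= /t; apply/andP; split; lra.
  have txy : t \in `]x, y[ by rewrite in_itv/= /t; apply/andP; split; lra.
  have dc : is_derive t 1 (fun=> 0 : R) 0 by exact: is_derive_cst.
  have [_ d0] : is_derive t 1 u 0.
    apply: near_eq_is_derive dc => //; near=> s.
    have : s \in `]x, y[ by near: s; exact: near_in_itvoo.
    by rewrite in_itv/= => /andP[h1 h2]; rewrite ut0.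
  have [_ d1] := du1 t t01.
  have := eE t t01; rewrite -d1 d0 ut0 ?G0; last 2 first.
  - by rewrite /t; lra.
  - by rewrite /t; lra.
  by rewrite expr0n/= mul0r addr0 => /esym /eqP; apply/negP.
have c_first : c ord0 = 0.
  apply: le_anti; have [-> ckd dk1] := cd ord0; rewrite andbT leNgt.
  apply/negP => c0; apply: (nogap 0 (c ord0)) => //; first by rewrite (le_trans (ltW ckd)).
  move=> t t0 tc; apply: out => [|k].
    by rewrite in_itv/= (ltW t0)/=; lra.
  rewrite in_itv/= negb_and -!leNgt.
  have [->|k0] := eqVneq k ord0; first by rewrite (ltW tc).
  by rewrite (le_trans (ltW tc))//; apply/ltW/ord; rewrite /= lt0n.
have c_next (i k : 'I_j.+1) : k = i.+1 :> nat -> c k = d i.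
  move=> ki; have ik : (i < k)%N by rewrite ki.
  apply: le_anti; rewrite (disj i k ik) andbT leNgt; apply/negP => lt.
  have [ci0 cdi di1] := cd i; have [ck0 cdk dk1] := cd k.
  apply: (nogap (d i) (c k)) => //; [by lra|by lra|].
  move=> t t0 tc; apply: out => [|n].
    by rewrite in_itv/=; apply/andP; split; lra.
  rewrite in_itv/= negb_and -!leNgt.
  have [ni|ik'] := leqP n i.
    have : d n <= d i.
      move: ni; rewrite leq_eqVlt => /predU1P[/val_inj -> //|ni].
      by have := disj n i ni; lra.
    by move=> dn; rewrite (le_trans dn (ltW t0)) orbT.
  have : c k <= c n.
    move: ik'; rewrite -ki leq_eqVlt => /predU1P[/val_inj -> //|ni].
    exact/ltW/ord.
  by move=> cn; rewrite (le_trans (ltW tc) cn).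
have d_last : d ord_max = 1.
  have [c0 cdm dm1] := cd ord_max.
  apply: le_anti; rewrite dm1/= leNgt; apply/negP => lt.
  apply: (nogap (d ord_max) 1) => //; first by lra.
  move=> t t0 t1; apply: out => [|k].
    by rewrite in_itv/=; apply/andP; split; lra.
  rewrite in_itv/= negb_and -!leNgt.
  have : d k <= d ord_max.
    have : (k <= j)%N by rewrite -ltnS.
    rewrite leq_eqVlt => /predU1P[kj|kj].
      by have -> : k = ord_max by exact: val_inj.
    have := disj k ord_max kj; lra.
  by move=> dk; rewrite (le_trans dk (ltW t0)) orbT.
pose L := 2 * T p q lam al.
have cL n (nj : (n < j.+1)%N) : c (Ordinal nj) = n%:R * L.
  elim: n nj => [|n IH] nj.
    by rewrite mul0r -c_first; congr c; exact: val_inj.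
  rewrite (c_next (Ordinal (ltnW nj)))// dE IH -/L -[n.+1%:R]natr1 mulrDl mul1r//.
have jL : j.+1%:R * L = 1.
  apply: etrans d_last; rewrite dE -/L (_ : ord_max = Ordinal (ltnSn j)); last exact: val_inj.
  by rewrite cL -[j.+1%:R]natr1 mulrDl mul1r.
have L0 : 0 <= L by rewrite mulr_ge0// ltW// T_gt0.
split; first exact: separated_contiguous L0 jL sep.
have : 2 * T p q lam al = 2 * tau.
  by rewrite tau2 -[LHS](mulKf (lt0r_neq0 j0)) jL mulr1.
by move/(mulfI (_ : 2 != 0)); apply.
Unshelve. all: by end_near. Qed.

(** * Identification with the explicit families *)

Definition chain_fun lam al (a : 'I_j.+1 -> R) (x : R) : R :=
  if [pick k : 'I_j.+1 | x \in `[a k, a k + 2 * T p q lam al]] is Some k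
  then (-1) ^+ k * w p q al lam (x - a k) else 0.

Lemma chain_eq01 lam al a u : chain lam al a u ->
  eq01 u (fun x => sg * chain_fun lam al a x).
Proof.
move=> [chu chz] x x01; rewrite /chain_fun; case: pickP => [k xk|h].
  by rewrite (chu k x xk) mulrA.
by rewrite mulr0 chz// => k; rewrite h.
Qed.

(** The arc picked by [chain_fun] can differ from a given one only at a common end point, where both
    profiles are 0. *)
Lemma eq01_chain lam al a u : admissible lam al -> separated (2 * T p q lam al) a ->
  eq01 u (fun x => sg * chain_fun lam al a x) -> chain lam al a u.
Proof.
move=> adm sep uE; have [a0 asep a1] := sep.
have w0' := w0 adm.
have w2T : w p q al lam (2 * T p q lam al) = 0 by rewrite -w_reflect subrr w0'.
split=> [k x xk|x x01 xout]; last first.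
  rewrite uE// /chain_fun; case: pickP => [k xk|_]; last by rewrite mulr0.
  by have := xout k; rewrite xk.
have x01 : x \in `[0, 1].
  by have := a0 k; have := a1 k; move: xk; rewrite !in_itv/= => /andP[? ?] ? ?;
    apply/andP; split; lra.
rewrite uE// /chain_fun; case: pickP => [i xi|/(_ k)]; last by rewrite xk.
rewrite mulrA -/(sign i).
have [ik|ki|/val_inj -> //] := ltngtP i k; move: xi xk; rewrite !in_itv/= => /andP[? ?] /andP[? ?].
- have := asep i k ik => ?.
  rewrite (_ : x - a i = 2 * T p q lam al); last by lra.
  by rewrite (_ : x - a k = 0) ?w2T ?w0' ?mulr0//; lra.
- have := asep k i ki => ?.
  rewrite (_ : x - a k = 2 * T p q lam al); last by lra.
  by rewrite (_ : x - a i = 0) ?w2T ?w0' ?mulr0//; lra.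
Qed.

Let even_nodes (k : 'I_j.+1) : R := k%:R / j.+1%:R.

Lemma u_glued_chain lam al x : T p q lam al = tau ->
  u_glued p q j al lam x = chain_fun lam al even_nodes x.
Proof.
move=> TE; rewrite /u_glued /chain_fun.
have -> : [pick k : 'I_j.+1 | x \in `[k%:R / j.+1%:R, k.+1%:R / j.+1%:R]] =
    [pick k | x \in `[even_nodes k, even_nodes k + 2 * T p q lam al]].
  apply: eq_pick => k; rewrite TE tau2 /even_nodes.
  by rewrite -[k.+1%:R]natr1 mulrDl mul1r.
by case: pickP.
Qed.

Lemma even_nodes_separated : separated (2 * tau) even_nodes.
Proof.
rewrite tau2; split=> [k|i k ik|k]; rewrite /even_nodes.
- by rewrite divr_ge0// ltW.
- rewrite -[X in _ + X]mul1r -mulrDl ler_pM2r ?invr_gt0//.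
  by rewrite natr1 ler_nat.
- by rewrite -[X in _ + X]mul1r -mulrDl ler_pdivrMr// mul1r natr1 ler_nat.
Qed.

Lemma contiguous_even a : contiguous a -> a = even_nodes.
Proof. by move=> cont; apply/funext. Qed.

(** [Zset] compares consecutive entries only; iterating its inequalities to reach all pairs uses
    [ell >= 0]. *)
Lemma separated_Zset lam a : 0 <= ell p q lam ->
  separated (ell p q lam) a <-> Zset p q lam a.
Proof.
move=> l0; split.
- move=> [a0 asep a1]; split => //.
  + move=> k; rewrite in_itv/= a0/=; have := a1 k; lra.
  + by move=> k; rewrite lerDl.
  + by move=> i k ik; apply: asep; rewrite -ik.
- move=> [a01 a0 _ step a1].
  have asep (i k : 'I_j.+1) : (i < k)%N -> a i + ell p q lam <= a k.
    case: k => k kj /=; elim: k kj => // k IH kj.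
    rewrite ltnS leq_eqVlt => /predU1P[ik|ik].
      by apply: step => /=; rewrite ik.
    have := IH (ltnW kj) ik; have := step (Ordinal (ltnW kj)) (Ordinal kj) erefl.
    lra.
  split=> // k; first by have := a01 k; rewrite in_itv/= => /andP[].
  have : (k <= j)%N by rewrite -ltnS.
  rewrite leq_eqVlt => /predU1P[kj|kj].
    by have -> : k = ord_max by exact: val_inj.
  by have := asep k ord_max kj; lra.
Qed.

Lemma nodal_setE : nodal_set p q j sg = (C1 p q j sg `|` C2 p q j sg)%classic.
Proof.
apply/seteqP; split=> -[lam u].
- move=> /nodal_chain [al [a [adm sep ch alt]]].
  have regular : contiguous a -> T p q lam al = tau -> C1 p q j sg (lam, u).
    move=> /contiguous_even aE TE; have uE := chain_eq01 ch.
    have glued : eq01 u (fun x => sg * u_glued p q j al lam x).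
      by move=> x x01; rewrite uE// u_glued_chain// aE.
    have [[lam0 lamL alE]|[slam lamL alE]] := T_eq_tau_cases adm TE.
    + rewrite alE in glued; left; split; [exact: lam0|exact: lamL|exact: glued].
    + rewrite alE in glued; right; split; [exact: slam|exact: lamL|exact: glued].
  case: alt => [GE|[cont TE]]; last by left; exact: regular.
  have [al0 _] := adm.
  have crit : lam / q + al `^ (p - q) / p = 0.
    by move/eqP: GE; rewrite G_factor// mulf_eq0 gt_eqF ?powR_gt0//= => /eqP.
  have lam0 : lam < 0.
    have h : 0 < al `^ (p - q) / p by rewrite divr_gt0// powR_gt0.
    have : lam / q < 0 by lra.
    by rewrite pmulr_llt0 ?invr_gt0.
  have alE : al = alpha_min p q lam.
    have /(admissible_min (ltW lam0) al0) := adm.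
    rewrite le_eqVlt => /predU1P[//|lt].
    have := G_lt adm (alpha_min_gt0 lam0) lt.
    by rewrite GE ltNge G_admissible//; exact: admissible_alpha_min.
  have T0 : 0 < T p q lam al by exact: T_gt0.
  have TL : T p q lam al <= tau.
    have := separated_total sep; rewrite mulrC -ler_pdivlMr// mul1r -tau2.
    by rewrite ler_pM2l.
  (* Fitting [j + 1] arcs into [[0, 1]] gave [T <= tau], while [lambda_star <= lam] gives
     [T >= tau]. Equality leaves no gap, so this zero-energy solution, which occurs at
     [lam = lambda_star], belongs to [C1]. *)
  have [slam|lams] := leP (lambda_star p q j) lam.
    left; have TE : T p q lam al = tau.
      apply: le_anti; rewrite TL/= alE; have := tau_le_T_alpha_min j lam0.
      by move=> ->.
    apply: regular => //; apply: separated_contiguous sep.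
      by rewrite mulr_ge0// ltW.
    by rewrite TE tau2 divff// gt_eqF.
  right; split; first exact: lams.
  exists a.
    by apply/separated_Zset; rewrite /ell -alE// mulr_ge0// ltW.
  (* At amplitude [alpha_min], [chain_fun] and [u_dead] with signs [(-1)^k] agree by unfolding. *)
  by rewrite alE in ch; exact: (chain_eq01 ch).
- have reg al : admissible lam al -> T p q lam al = tau ->
      eq01 u (fun x => sg * u_glued p q j al lam x) -> nodal_set p q j sg (lam, u).
    move=> adm TE uE; have sep : separated (2 * T p q lam al) even_nodes.
      by rewrite TE; exact: even_nodes_separated.
    apply: (chain_nodal (a := even_nodes) adm sep); last by right.
    by apply: eq01_chain => // x x01; rewrite uE// u_glued_chain.
  case=> [[/= [lam0 lamL uE]|/= [slam lamL uE]]|/= [lams [a Z uE]]].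
  + have [mem TE] := alpha_underP lam0 lamL.
    apply: reg TE uE; apply: admissible_gt0; first exact: ltW.
    by move: mem; rewrite in_itv/= => /andP[].
  + have [adm TE] := alpha_overP slam (ltW lamL).
    exact: reg adm TE uE.
  + have lam0 : lam < 0 := lt_trans lams (lambda_star_lt0 j).
    have adm := admissible_alpha_min lam0.
    have sep : separated (2 * T p q lam (alpha_min p q lam)) a.
      by apply/separated_Zset => //; rewrite /ell mulr_ge0// ltW// T_gt0.
    apply: (chain_nodal (a := a) adm sep).
      by apply: eq01_chain => // x x01; rewrite uE.
    left; rewrite G_factor ?alpha_min_gt0// alpha_min_critical// mulr0//.
Qed.

End chain.

End time_map.

Theorem theorem6p5 (R : realType) (p q : R) (hq1 : 1 < q) (hq2 : q < 2)
    (hp : 2 < p) (j : nat) (s : R) (hs : s = 1 \/ s = -1) :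
  nodal_set p q j s = (C1 p q j s `|` C2 p q j s)%classic.
Proof. exact: nodal_setE. Qed.
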